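(* Let $\mathcal H$ be a complex separable Hilbert space and let $A(\cdot)$ be a family of trace class operators on $\mathcal H$ that is analytic, in trace norm, on an open neighborhood $\Omega_0\subset\mathbb C$ of $z=0$. Write $A(z)=A_0+A_1z+O(z^2)$ as $z\to0$, with $A_0,A_1\in\mathcal B_1(\mathcal H)$. Assume that $1\in\sigma_{\rm d}(A_0)$. With $P_0,Q_0,D_0,n_0,\nu_0,\widetilde A_1$ as defined in the context, one has, as $z\to0$, $$\begin{aligned}{\det}_{\mathcal H}(I_{\mathcal H}-A(z))&=\big[{\det}_{Q_0\mathcal H}(I_{Q_0\mathcal H}-Q_0A_0Q_0)+O(z)\big]\,(-1)^{n_0}\,{\det}_{P_0\mathcal H}\big(P_0D_0P_0+P_0[A_1+O(z)]P_0\,z\big)\\&={\det}_{Q_0\mathcal H}(I_{Q_0\mathcal H}-Q_0A_0Q_0)\,{\det}_{\mathbb C^{n_0-\nu_0}}\big(\widetilde A_1\big)\,(-z)^{n_0-\nu_0}+O\big(z^{n_0-\nu_0+1}\big),\end{aligned}$$ and $n_0-\nu_0$ is the geometric multiplicity of the eigenvalue $1$ of $A_0$. If $1$ is a semisimple eigenvalue of $A_0$ (i.e., $D_0=0$ and $\nu_0=0$), then $$\begin{aligned}{\det}_{\mathcal H}(I_{\mathcal H}-A(z))&={\det}_{Q_0\mathcal H}(I_{Q_0\mathcal H}-Q_0A_0Q_0)\,{\det}_{P_0\mathcal H}(P_0A_1P_0)\,(-z)^{n_0}+O\big(z^{n_0+1}\big)\\&={\det}_{\mathcal H}(I_{\mathcal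 H}-P_0-A_0)\,{\det}_{P_0\mathcal H}(P_0A_1P_0)\,z^{n_0}+O\big(z^{n_0+1}\big).\end{aligned}$$ In particular, if $1$ is a simple eigenvalue of $A_0$ (i.e., $n_0=1$, $D_0=0$, $\nu_0=0$), then $${\det}_{\mathcal H}(I_{\mathcal H}-A(z))={\det}_{\mathcal H}(I_{\mathcal H}-P_0-A_0)\,{\det}_{P_0\mathcal H}(P_0A_1P_0)\,z+O(z^2).$$
   Context: $\mathcal B_1(\mathcal H)$ is the trace class and ${\det}_{\mathcal H}(I_{\mathcal H}-A)$, $A\in\mathcal B_1(\mathcal H)$, is the Fredholm determinant. $\sigma_{\rm d}(T)$ is the discrete spectrum of $T$ (isolated eigenvalues of finite algebraic multiplicity). $P_0=-\frac{1}{2\pi i}\oint_{\mathcal C_0}(A_0-\zeta I_{\mathcal H})^{-1}\,d\zeta$ is the Riesz projection of $A_0$ for the eigenvalue $1$ ($\mathcal C_0$ a small counterclockwise circle centered at $1$, such that neither it nor its interior meets $\sigma(A_0)\setminus\{1\}$), $Q_0=I_{\mathcal H}-P_0$, $n_0=\dim(\operatorname{ran}P_0)$ is the algebraic multiplicity of the eigenvalue $1$, and $D_0=(A_0-I_{\mathcal H})P_0$ (so $D_0=P_0D_0P_0$ is nilpotent on $P_0\mathcal H$). Operators such as $Q_0A_0Q_0$ and $P_0A_1P_0$ are regarded as operators on $Q_0\mathcal H=\operatorname{ran}Q_0$ and $P_0\mathcal H=\operatorname{ran}P_0$, respectively; ${\det}_{P_0\mathcal H}$ is the ordinary determinant on the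 $n_0$-dimensional space $P_0\mathcal H$. Let $S\colon P_0\mathcal H\to\mathbb C^{n_0}$ be a linear isomorphism such that $SP_0D_0P_0S^{-1}$ is in Jordan canonical form (zeros on the main diagonal, and entries $0$ or $1$ directly above it, all other entries $0$). $\nu_0$ is the number of entries $1$ in this matrix, $0\le\nu_0\le n_0-1$. $\widetilde A_1$ is the $(n_0-\nu_0)\times(n_0-\nu_0)$ matrix obtained from the $n_0\times n_0$ matrix $SP_0A_1P_0S^{-1}$ by striking the $\nu_0$ rows and the $\nu_0$ columns in which $SP_0D_0P_0S^{-1}$ contains an entry $1$ (i.e., if there is a $1$ at position $(i,i+1)$, row $i$ and column $i+1$ are struck). Inside the determinant over $P_0\mathcal H$, $O(z)$ denotes an operator-valued term whose norm is $O(|z|)$ as $z\to0$. *)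

(* Defs.v *)
From HB Require Import structures.
From mathcomp Require Import all_boot all_order all_algebra.
From mathcomp Require Import all_classical all_reals all_analysis.
From mathcomp Require Import complex sesquilinear.
Set Implicit Arguments.
Unset Strict Implicit.
Unset Printing Implicit Defensive.
Import Order.TTheory GRing.Theory Num.Theory Num.Def.
Import numFieldNormedType.Exports.
Local Open Scope classical_set_scope.
Local Open Scope complex_scope.
Local Open Scope ring_scope.

(* A complex Hilbert space is a complete normed space H over R[i] with an inner
   product dot, linear in its first argument and conjugate-linear in the second,
   that induces the norm.  An operator on a closed subspace V of H is a function
   T : H -> H of which only the restriction to V matters; an operator on H itself
   is the case V = setT.  Norms in H and absolute values in R[i] are elements of
   R[i] (real and nonnegative), hence the injections M%:C of real bounds. *)

(* The standard topology of R[i], as for an abstract numClosedFieldType. *)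
#[non_forgetful_inheritance]
HB.instance Definition _ (R : realType) := NormedModule.copy R[i] (R[i])^o.

Definition separable (X : topologicalType) :=
  exists2 D : set X, countable D & dense D.

Section Operators.
Variables (R : realType) (H : completeNormedModType R[i]).
Variable dot : {dot H for conjC}.
Implicit Types (V W : set H) (T S P F : H -> H).

Definition dot_induces_norm := forall x : H, `|x| ^+ 2 = dot x x.

Definition linear_on (U : lmodType R[i]) V (f : H -> U) :=
  forall (a : R[i]) x y, V x -> V y -> f (a *: x + y) = a *: f x + f y.

Definition bounded_on V T :=
  [/\ forall x, V x -> V (T x), linear_on V T
    & exists M : R, forall x, V x -> `|T x| <= M%:C * `|x| ].

Definition positive_on V S :=
  bounded_on V S /\ forall x, V x -> 0 <= dot (S x) x.

(* S = |T| = (T^* T)^(1/2) on V: S is positive and S^2 = T^* T. *)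
Definition is_abs V T S :=
  positive_on V S /\
  forall x y, V x -> V y -> dot (S (S x)) y = dot (T x) (T y).

Definition orthonormal_basis V (B : set H) :=
  [/\ B `<=` V, {in B &, forall e f, dot e f = (e == f)%:R}
    & forall x, V x -> {in B, forall e, dot x e = 0} -> x = 0].

(* tr |T| = \sum_e <|T| e, e>, which does not depend on the orthonormal basis. *)
Definition trace_norm V T : \bar R :=
  xget +oo%E [set t : \bar R | exists (S : H -> H) (B : set H),
    [/\ is_abs V T S, orthonormal_basis V B
      & t = \esum_(e in B) (complex.Re (dot (S e) e))%:E]].

Definition trace_class V T := bounded_on V T /\ (trace_norm V T < +oo)%E.

Definition lin_comb n (e : 'I_n -> H) (c : 'rV[R[i]]_n) : H :=
  \sum_i c 0 i *: e i.

Definition is_basis W n (e : 'I_n -> H) := set_bij setT W (lin_comb e).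

Definition has_dim W n := exists e : 'I_n -> H, is_basis W e.

(* Independent of the basis e of W; the value 0 is junk, used when W is not a
   finite-dimensional subspace invariant under T. *)
Definition findim_det W T : R[i] :=
  xget 0 [set d | exists n (e : 'I_n -> H) (M : 'M[R[i]]_n),
    [/\ is_basis W e, forall j, T (e j) = \sum_i M i j *: e i & d = \det M]].

Definition finite_rank V F := bounded_on V F /\ exists n, has_dim (F @` V) n.

(* The determinant det(I - T) of a trace class operator T on V: the continuous
   extension, with respect to the trace norm, of the determinant of I - F, F of
   finite rank, where det(I - F) is the ordinary determinant of the restriction
   of I - F to the finite-dimensional invariant subspace ran F. *)
Definition is_fredholm_det V T (d : R[i]) :=
  forall eps : R, 0 < eps -> exists2 delta : R, 0 < delta &
    forall F, finite_rank V F ->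
      (trace_norm V (fun x => T x - F x)%R < delta%:E)%E ->
      `|findim_det (F @` V) (fun x => x - F x) - d| < eps%:C.

Definition fredholm_det V T : R[i] := xget 0 [set d | is_fredholm_det V T d].

Definition spectrum T : set R[i] := [set zeta |
  ~ exists B : H -> H, [/\ bounded_on setT B,
      forall x, B (T x - zeta *: x) = x & forall x, T (B x) - zeta *: B x = x]].

Definition resolvent T (zeta : R[i]) (x : H) : H :=
  xget 0 [set u | T u - zeta *: u = x].

(* Counterclockwise parametrization zeta = c + r e^(it), dzeta = i r e^(it) dt. *)
Definition circle_integral (c : R[i]) (r : R) (f : R[i] -> R[i]) : R[i] :=
  let e t : R[i] := r%:C * (cos t +i* sin t) in
  let g t : R[i] := f (c + e t) * ('i * e t) in
  (\int[lebesgue_measure]_(t in `[0, 2 * pi]) complex.Re (g t)) +i*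
  (\int[lebesgue_measure]_(t in `[0, 2 * pi]) complex.Im (g t)).

Definition isolating_radius T (lambda : R[i]) (r : R) :=
  0 < r /\
  forall zeta, spectrum T zeta -> `|zeta - lambda| <= r%:C -> zeta = lambda.

(* P = - (2 pi i)^-1 \oint (T - zeta)^-1 dzeta, the operator-valued integral
   being taken weakly. *)
Definition is_riesz_projection T (lambda : R[i]) (r : R) P :=
  bounded_on setT P /\
  forall x y, dot (P x) y = - (2 * pi%:C * 'i)^-1 *
    circle_integral lambda r (fun zeta => dot (resolvent T zeta x) y).

Definition discrete_spectrum T : set R[i] := [set lambda |
  (exists2 x, x != 0 & T x = lambda *: x) /\
  exists (r : R) P n, [/\ isolating_radius T lambda r,
    is_riesz_projection T lambda r P & has_dim (range P) n]].

Definition analytic_in_trace_norm (Omega : set R[i]) (A : R[i] -> H -> H) :=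
  forall z0, Omega z0 -> exists2 B, trace_class setT B &
    forall eps : R, 0 < eps -> \forall z \near z0^',
      (trace_norm setT (fun x => (z - z0)^-1 *: (A z x - A z0 x) - B x)%R
        < eps%:E)%E.

Definition first_order_expansion (A : R[i] -> H -> H) (A0 A1 : H -> H) :=
  exists K : R, \forall z \near (0 : R[i]),
    (trace_norm setT (fun x => A z x - (A0 x + z *: A1 x))%R
      <= (K * Normc.normc z ^+ 2)%:E)%E.

(* S restricts to a linear isomorphism from W onto the n-dimensional column
   space. *)
Definition is_coordinates W n (S : H -> 'cV[R[i]]_n) :=
  linear_on W S /\ set_bij W setT S.

(* The matrix of S T S^-1, for S as above and T an operator on W. *)
Definition rep_mx W n (S : H -> 'cV[R[i]]_n) T : 'M[R[i]]_n :=
  \matrix_(i, j) S (T (xget 0 [set x | W x /\ S x = delta_mx j 0])) i 0.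

End Operators.

Section Jordan.
Variables (F : fieldType) (n : nat).
Implicit Types J M : 'M[F]_n.

Definition nilpotent_jordan_form J :=
  forall i j : 'I_n, if j == i.+1 :> nat then J i j = 0 \/ J i j = 1
                     else J i j = 0.

Definition num_ones J : nat := #|[pred ij : 'I_n * 'I_n | J ij.1 ij.2 == 1]|.

Definition kept_rows J := [seq i <- enum 'I_n | [forall j, J i j != 1]].
Definition kept_cols J := [seq j <- enum 'I_n | [forall i, J i j != 1]].

(* M without the rows and columns in which J has an entry 1.  If J is in
   nilpotent Jordan form, kept_rows J and kept_cols J have n - num_ones J
   elements, so that the default value of nth is never used. *)
Definition strike J M : 'M[F]_(n - num_ones J) :=
  \matrix_(i, j) M (nth (widen_ord (leq_subr _ _) i) (kept_rows J) i)
                   (nth (widen_ord (leq_subr _ _) j) (kept_cols J) j).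

End Jordan.

(* Main.v *)
(* Trace class operators are the limits of finite-rank operators in the nuclear norm: the trace
   norm and the nuclear norm coincide, by the spectral theorem for |T|.  The finite-rank
   determinant is locally Lipschitz for this norm, because 1 - (S + b (x) a) is the product of
   1 - S and a rank-one perturbation of 1; hence it extends to trace class operators and stays
   multiplicative.  With K = (1 - Q A Q)^-1 on ran Q, factoring 1 - A through 1 - Q A Q gives
     det(1 - A) = det_Q(1 - Q A Q) det_P(P - P A P - P A K Q A P).
   For A = A(z), the projection P = P0 commutes with A0, so both off-diagonal blocks are O(z) and
   the last term is O(z^2): this is the first expansion.  Eigenvectors of A0 for 1 lie in ran P0,
   so 1 - Q0 A0 Q0 is injective, hence invertible, and remains so for small z.

   In Jordan coordinates the remaining determinant is det(J + z (M1 + O(z))).  The n0 - nu0 rows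
   in which J vanishes yield the factor z^(n0 - nu0); what is left at z = 0 has the nu0 unit
   vectors of J as its other rows, and expanding along these gives (-1)^nu0 det(strike J M1).

   The contour integral is the limit of its Riemann sums over N-th roots of unity; for r = 1
   and lambda = 0 these are the operators (1 - w T^N)^-1, |w| = 1, and the identity
   (1 - T^(2N))^-1 = (1 - T^N)^-1 (1 + T^N)^-1 passes to the limit P0 = P0 P0. *)

(* The trace norm is defined through a choice of [|T|] and of a basis, so neither its triangle
   inequality nor its behaviour under composition is visible. Estimates are therefore made with
   [nuc], where both reduce to concatenating and mapping lists of pairs. The dictionary between the
   two norms is used only at the ends: [trace_norm_nuc] reads the hypotheses and the definition of
   the determinant, and [nuc_trace_norm] supplies the finite-rank test operators that make the value
   of [fredholm_det] unique.

   A list fixes a matrix, but an operator has many lists. The determinant of a list is first shown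
   to depend on the operator alone ([fdet_unique]); from then on identities between operators yield
   identities between determinants.

   The hypotheses provide a single circle. The textbook proof of [P0 P0 = P0] compares two
   concentric circles; here the Riemann sums on the given circle satisfy exact algebraic identities,
   and only their convergence at rate [1 / N] is analytic. *)
Require Import Defs.
From HB Require Import structures.
From mathcomp Require Import all_boot all_order all_algebra.
From mathcomp Require Import all_classical all_reals all_analysis.
From mathcomp Require Import perm complex sesquilinear ring lra zify.
Set Implicit Arguments.
Unset Strict Implicit.
Unset Printing Implicit Defensive.
Import Order.TTheory GRing.Theory Num.Theory Num.Def.
Import numFieldNormedType.Exports.
Local Open Scope classical_set_scope.
Local Open Scope complex_scope.
Local Open Scope ring_scope.

(** * Complex numbers and Hilbert space *)

Section ComplexModulus.
Variable R : realType.
Local Notation C := R[i].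
Local Notation normc := (@Normc.normc R).
Implicit Types (a b c : C) (t : R).

Lemma normcE a : `|a| = (normc a)%:C.
Proof. by case: a. Qed.

Lemma normc_ge0 a : 0 <= normc a.
Proof. by case: a => x y; rewrite /= sqrtr_ge0. Qed.

Lemma normcM a b : normc (a * b) = normc a * normc b.
Proof. exact: Normc.normcM. Qed.

Lemma normcD a b : normc (a + b) <= normc a + normc b.
Proof. exact: le_normcD. Qed.

Lemma normcN a : normc (- a) = normc a.
Proof. exact: normcN. Qed.

Lemma normcB a b : normc (a - b) <= normc a + normc b.
Proof. by rewrite -(normcN b) normcD. Qed.

Lemma normcBC a b : normc (a - b) = normc (b - a).
Proof. by rewrite -normcN opprB. Qed.

Lemma normc0 : normc 0 = 0. Proof. exact: Normc.normc0. Qed.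
Lemma normc1 : normc 1 = 1. Proof. exact: Normc.normc1. Qed.

Lemma normcN1 : normc (-1) = 1. Proof. by rewrite normcN normc1. Qed.

Lemma normcV a : normc a^-1 = (normc a)^-1. Proof. exact: Normc.normcV. Qed.

Lemma normcX a n : normc (a ^+ n) = normc a ^+ n.
Proof. by elim: n => [|n ih]; rewrite ?expr0 ?normc1 // !exprS normcM ih. Qed.

Lemma normc_eq0 a : (normc a == 0) = (a == 0).
Proof. by apply/eqP/eqP => [/Normc.eq0_normc //|->]; rewrite normc0. Qed.

Lemma normc_gt0 a : (0 < normc a) = (a != 0).
Proof. by rewrite lt_def normc_ge0 andbT normc_eq0. Qed.

Lemma normc_real t : normc t%:C = `|t|.
Proof. by rewrite /= expr0n addr0 sqrtr_sqr. Qed.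

Lemma normc_ge_Re a : `|complex.Re a| <= normc a.
Proof. by have := normc_ge_Re a; rewrite normcE lecR. Qed.

Lemma normc_conj a : normc (conjC a) = normc a.
Proof. by case: a => x y; rewrite /= sqrrN. Qed.

Lemma mul_conjC_normc a : a * conjC a = (normc a ^+ 2)%:C.
Proof. by rewrite -[LHS]sqr_normc normcE rmorphXn. Qed.

Lemma normc_sum (I : Type) (r : seq I) (P : pred I) (F : I -> C) :
  normc (\sum_(i <- r | P i) F i) <= \sum_(i <- r | P i) normc (F i).
Proof.
elim/big_ind2: _ => [|x y z w h1 h2|//]; first by rewrite normc0.
by apply: (le_trans (normcD _ _)); apply: lerD.
Qed.

Lemma normc_prod (I : Type) (r : seq I) (P : pred I) (F : I -> C) :
  normc (\prod_(i <- r | P i) F i) = \prod_(i <- r | P i) normc (F i).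
Proof. by elim/big_ind2: _ => [|x y z w <- <-|//]; rewrite ?normc1 ?normcM. Qed.

Lemma ge0_Re a : 0 <= a -> a = (complex.Re a)%:C.
Proof. by case: a => x y; rewrite lecE /= => /andP[/eqP-> _]. Qed.

Lemma Re_ge0 a : 0 <= a -> 0 <= complex.Re a.
Proof. by case: a => x y; rewrite lecE /= => /andP[_]. Qed.

Lemma ReD a b : complex.Re (a + b) = complex.Re a + complex.Re b.
Proof. by case: a b => [? ?] [? ?]. Qed.

Lemma ReN a : complex.Re (- a) = - complex.Re a.
Proof. by case: a. Qed.

Lemma ReB a b : complex.Re (a - b) = complex.Re a - complex.Re b.
Proof. by rewrite ReD ReN. Qed.

Lemma ReMl t a : complex.Re (t%:C * a) = t * complex.Re a.
Proof. by case: a => x y; rewrite /= mul0r subr0. Qed.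

Lemma Re_conj a : complex.Re (conjC a) = complex.Re a.
Proof. by case: a. Qed.

Lemma Re_sum (I : Type) (r : seq I) (P : pred I) (F : I -> C) :
  complex.Re (\sum_(i <- r | P i) F i) = \sum_(i <- r | P i) complex.Re (F i).
Proof. by elim/big_ind2: _ => [//|x y z w <- <-|//]; rewrite ReD. Qed.

Lemma conjC_real t : conjC (t%:C) = t%:C.
Proof. exact: conjc_real. Qed.

End ComplexModulus.

Lemma ler_eps (R : realType) (x y : R) : (forall e, 0 < e -> x <= y + e) -> x <= y.
Proof.
move=> h; rewrite leNgt; apply/negP => xy.
have := h ((x - y) / 2); lra.
Qed.

Lemma ler_epsM (R : realType) (x y k : R) : 0 <= k ->
  (forall e, 0 < e -> x <= y + k * e) -> x <= y.
Proof.
move=> k0 h; apply: ler_eps => e e0.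
have k1 : 0 < k + 1 by lra.
have /h : 0 < e / (k + 1) by rewrite divr_gt0.
move/le_trans; apply; rewrite lerD2l mulrCA.
by apply: ler_piMr; [apply: ltW|rewrite ler_pdivrMr //; lra].
Qed.

Section InnerProduct.
Variables (R : realType) (H : completeNormedModType R[i]).
Variable dot : {dot H for conjC}.
Hypothesis Hdot : dot_induces_norm dot.
Local Notation C := R[i].
Local Notation normc := (@Normc.normc R).
Implicit Types (x y z : H) (a b c : C) (t : R) (V W : set H) (T S : H -> H).

Lemma dotDl x y z : dot (x + y) z = dot x z + dot y z.
Proof. exact: linearDl. Qed.
Lemma dotDr x y z : dot x (y + z) = dot x y + dot x z.
Proof. exact: linearDr. Qed.
Lemma dotZl a x y : dot (a *: x) y = a * dot x y.
Proof. exact: linearZl_LR. Qed.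
Lemma dotZr a x y : dot x (a *: y) = conjC a * dot x y.
Proof. by rewrite linearZr_LR. Qed.
Lemma dot0l x : dot 0 x = 0. Proof. exact: linear0l. Qed.
Lemma dot0r x : dot x 0 = 0. Proof. exact: linear0r. Qed.
Lemma dotNl x y : dot (- x) y = - dot x y. Proof. exact: linearNl. Qed.
Lemma dotNr x y : dot x (- y) = - dot x y. Proof. exact: linearNr. Qed.
Lemma dotBl x y z : dot (x - y) z = dot x z - dot y z.
Proof. by rewrite dotDl dotNl. Qed.
Lemma dotBr x y z : dot x (y - z) = dot x y - dot x z.
Proof. by rewrite dotDr dotNr. Qed.
Lemma dot_suml (I : Type) (r : seq I) (P : pred I) (F : I -> H) y :
  dot (\sum_(i <- r | P i) F i) y = \sum_(i <- r | P i) dot (F i) y.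
Proof. by elim/big_ind2: _ => [|x1 x2 z w <- <-|//]; rewrite ?dot0l ?dotDl. Qed.
Lemma dot_sumr (I : Type) (r : seq I) (P : pred I) (F : I -> H) y :
  dot y (\sum_(i <- r | P i) F i) = \sum_(i <- r | P i) dot y (F i).
Proof. exact: linear_sumr. Qed.
Lemma dotC x y : dot y x = conjC (dot x y).
Proof. by rewrite hermitian_subproof expr0 mul1r. Qed.

(** The norm of [H] takes its values in [R[i]]; estimates use its real part, for which the order is
    total and [lra] applies. *)
Definition nm x : R := complex.Re `|x|.

Lemma nmE x : `|x| = (nm x)%:C.
Proof. by rewrite /nm -ge0_Re. Qed.

Lemma nm_ge0 x : 0 <= nm x.
Proof. by rewrite /nm Re_ge0. Qed.

Lemma nm0 : nm 0 = 0. Proof. by rewrite /nm normr0. Qed.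

Lemma nm_eq0 x : nm x = 0 -> x = 0.
Proof. by move=> h; apply/eqP; rewrite -normr_eq0 nmE h. Qed.

Lemma nmZ a x : nm (a *: x) = normc a * nm x.
Proof. by apply: complexI; rewrite -nmE normrZ normcE nmE -rmorphM. Qed.

Lemma nmD x y : nm (x + y) <= nm x + nm y.
Proof. by rewrite -lecR rmorphD /= -!nmE ler_normD. Qed.

Lemma nmN x : nm (- x) = nm x.
Proof. by rewrite /nm normrN. Qed.

Lemma nmB x y : nm (x - y) <= nm x + nm y.
Proof. by rewrite -(nmN y) nmD. Qed.

Lemma nmBC x y : nm (x - y) = nm (y - x).
Proof. by rewrite -nmN opprB. Qed.

Lemma nm_tri z x y : nm (x - y) <= nm (x - z) + nm (z - y).
Proof. by apply: le_trans (nmD _ _); rewrite addrA subrK. Qed.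

Lemma nm_sum (I : Type) (r : seq I) (P : pred I) (F : I -> H) :
  nm (\sum_(i <- r | P i) F i) <= \sum_(i <- r | P i) nm (F i).
Proof.
elim/big_ind2: _ => [|x y z w h1 h2|//]; first by rewrite nm0.
by apply: (le_trans (nmD _ _)); apply: lerD.
Qed.

Lemma dotxx x : dot x x = (nm x ^+ 2)%:C.
Proof. by rewrite -Hdot nmE rmorphXn. Qed.

Lemma dotxx_Re x : complex.Re (dot x x) = nm x ^+ 2.
Proof. by rewrite dotxx. Qed.

Lemma nm_sqrD x y : nm (x + y) ^+ 2 = nm x ^+ 2 + nm y ^+ 2 + 2 * complex.Re (dot x y).
Proof.
rewrite -!dotxx_Re dotDl !dotDr !ReD (dotC y x) Re_conj; lra.
Qed.

Lemma nm_sqrB x y : nm (x - y) ^+ 2 = nm x ^+ 2 + nm y ^+ 2 - 2 * complex.Re (dot x y).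
Proof. by rewrite nm_sqrD nmN dotNr ReN; lra. Qed.

Lemma nm_pythagoras x y : dot x y = 0 -> nm (x + y) ^+ 2 = nm x ^+ 2 + nm y ^+ 2.
Proof. by rewrite nm_sqrD => ->; rewrite /= mulr0 addr0. Qed.

Lemma dot_eq0 x : dot x x = 0 -> x = 0.
Proof.
by rewrite dotxx => /(congr1 (@complex.Re R)) /= /eqP; rewrite sqrf_eq0 => /eqP /nm_eq0.
Qed.

Definition subsp V := V 0 /\ forall a x y, V x -> V y -> V (a *: x + y).

(** Closedness is phrased as stability under approximation in norm, the only form in which it is
    used. *)
Definition csubsp V := subsp V /\
  forall x, (forall e : R, 0 < e -> exists2 y, V y & nm (x - y) <= e) -> V x.

Section Subsp.
Variable V : set H.
Hypothesis sV : subsp V.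
Lemma sub0 : V 0. Proof. by case: sV. Qed.
Lemma subD x y : V x -> V y -> V (x + y).
Proof. by move=> vx vy; rewrite -[x]scale1r; apply: sV.2. Qed.
Lemma subZ a x : V x -> V (a *: x).
Proof. by move=> vx; rewrite -[_ *: _]addr0; apply: sV.2 => //; exact: sub0. Qed.
Lemma subN x : V x -> V (- x).
Proof. by move=> vx; rewrite -scaleN1r; apply: subZ. Qed.
Lemma subB x y : V x -> V y -> V (x - y).
Proof. by move=> vx vy; apply: subD => //; apply: subN. Qed.
Lemma sub_sum (I : eqType) (r : seq I) (P : pred I) (F : I -> H) :
  (forall i, i \in r -> P i -> V (F i)) -> V (\sum_(i <- r | P i) F i).
Proof.
move=> h; rewrite big_seq_cond; elim/big_ind: _ => [|x y|i /andP[]]; [exact: sub0|exact: subD|exact: h].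
Qed.

Section LinearOn.
Variables (U : lmodType C) (f : H -> U).
Hypothesis lf : linear_on V f.
Lemma linD x y : V x -> V y -> f (x + y) = f x + f y.
Proof. by move=> vx vy; rewrite -[x in LHS]scale1r lf // scale1r. Qed.
Lemma lin0 : f 0 = 0.
Proof. by apply: (addrI (f 0)); rewrite -linD ?addr0 //; exact: sub0. Qed.
Lemma linZ a x : V x -> f (a *: x) = a *: f x.
Proof. by move=> vx; rewrite -[a *: x]addr0 lf ?lin0 ?addr0 //; exact: sub0. Qed.
Lemma linN x : V x -> f (- x) = - f x.
Proof. by move=> vx; rewrite -[- x]scaleN1r linZ // scaleN1r. Qed.
Lemma linB x y : V x -> V y -> f (x - y) = f x - f y.
Proof. by move=> vx vy; rewrite linD ?linN //; exact: subN. Qed.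
Lemma lin_sum (I : eqType) (r : seq I) (P : pred I) (F : I -> H) :
  (forall i, i \in r -> P i -> V (F i)) ->
  f (\sum_(i <- r | P i) F i) = \sum_(i <- r | P i) f (F i).
Proof.
elim: r => [|i r ih] h; first by rewrite !big_nil lin0.
have hr j : j \in r -> P j -> V (F j) by move=> jr; apply: h; rewrite inE jr orbT.
rewrite !big_cons; case: ifPn => Pi; last exact: ih.
rewrite linD ?ih //; first by apply: h => //; rewrite mem_head.
exact: sub_sum.
Qed.
End LinearOn.
End Subsp.

Lemma subspT : subsp setT. Proof. by []. Qed.
Lemma csubspT : csubsp setT. Proof. by []. Qed.

(* Complex polarization: the real form [<Sx, x>] on V determines its
   Hermitian symmetry. *)
Lemma positive_sym V S : subsp V -> positive_on dot V S ->
  forall x y, V x -> V y -> dot (S x) y = dot x (S y).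
Proof.
move=> sV [[SV lS _] pS] x y vx vy.
have im z : V z -> complex.Im (dot (S z) z) = 0.
  by move=> vz; rewrite (ge0_Re (pS _ vz)).
have := im _ (subD sV vx vy); rewrite (linD lS) // dotDl !dotDr.
have := im _ (subD sV vx (subZ sV 'i vy)).
rewrite (linD lS) ?(linZ sV lS) //; last exact: subZ.
rewrite dotDl !dotDr !dotZl !dotZr.
rewrite (ge0_Re (pS _ vx)) (ge0_Re (pS _ vy)) [dot x (S y)]dotC.
case: (dot (S x) y) => p q; case: (dot (S y) x) => p' q' /=.
move=> h1 h2; congr (_ +i* _); lra.
Qed.

(** Positivity of the form at [x - (t w) y], with [w = <S x, y>] and [t] real, is a quadratic
    inequality in [t]; the factor [w] absorbs the phase. *)
Lemma positive_CS V S : subsp V -> positive_on dot V S ->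
  forall x y, V x -> V y ->
  normc (dot (S x) y) ^+ 2 <= complex.Re (dot (S x) x) * complex.Re (dot (S y) y).
Proof.
move=> sV pS x y vx vy.
have [[SV lS _] pSx] := pS.
have key t : 0 <= complex.Re (dot (S x) x) - 2 * t * normc (dot (S x) y) ^+ 2
   + t ^+ 2 * normc (dot (S x) y) ^+ 2 * complex.Re (dot (S y) y).
  set w := dot (S x) y.
  have vz : V (x - (t%:C * w) *: y) by apply: subB => //; apply: subZ.
  have := Re_ge0 (pSx _ vz).
  rewrite (linB sV lS) ?(linZ sV lS) //; last exact: subZ.
  rewrite dotBl !dotBr !dotZl !dotZr.
  have -> : dot (S y) x = conjC w by rewrite (positive_sym sV pS) // -dotC.
  rewrite -/w (ge0_Re (pSx _ vy)).
  have e1 : conjC (t%:C * w) * w = (t * normc w ^+ 2)%:C.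
    by rewrite rmorphM /= conjC_real -mulrA [conjC w * w]mulrC mul_conjC_normc -rmorphM.
  have e2 : t%:C * w * conjC w = (t * normc w ^+ 2)%:C.
    by rewrite -mulrA mul_conjC_normc -rmorphM.
  have e3 : t%:C * w * (conjC (t%:C * w) * (complex.Re (dot (S y) y))%:C) =
     (t ^+ 2 * normc w ^+ 2 * complex.Re (dot (S y) y))%:C.
    by rewrite mulrA mul_conjC_normc normcM normc_real exprMn real_normK ?num_real // -rmorphM.
  rewrite e3 e1 e2 !ReB /=; lra.
have a0 := Re_ge0 (pSx _ vx); have b0 := Re_ge0 (pSx _ vy).
move: key a0 b0; set n2 := _ ^+ 2; set a := complex.Re _; set b := complex.Re _.
have n0 : 0 <= n2 by apply: sqr_ge0.
move=> key a0 b0.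
have [b00|bN0] := eqVneq b 0.
  (* For [b = 0] the inequality is affine in [t], and this [t] turns it into [0 <= - a - 2] unless
     [n2 = 0]. *)
  have := key ((a + 1) / n2); rewrite b00 !mulr0 addr0.
  have [->//|nN0] := eqVneq n2 0.
  by rewrite -!mulrA mulVf // mulr1; lra.
have := key b^-1; have b_gt0 : 0 < b by rewrite lt_def bN0.
have -> : a - 2 * b^-1 * n2 + b^-1 ^+ 2 * n2 * b = (a * b - n2) / b by field.
by rewrite pmulr_lge0 ?invr_gt0 // subr_ge0.
Qed.

Lemma positive_on_id V : subsp V -> positive_on dot V id.
Proof.
move=> sV; split; last by move=> x _; rewrite dotxx ler0c sqr_ge0.
by split=> //; exists 1 => x _; rewrite mul1r.
Qed.

Lemma CS x y : normc (dot x y) <= nm x * nm y.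
Proof.
rewrite -(@ler_pXn2r _ 2) ?nnegrE ?normc_ge0 ?mulr_ge0 ?nm_ge0 // exprMn -!dotxx_Re.
exact: (positive_CS subspT (positive_on_id subspT)).
Qed.

Lemma nm_complete (u : nat -> H) :
  (forall e : R, 0 < e -> exists N, forall n m, (N <= n)%N -> (N <= m)%N -> nm (u n - u m) <= e) ->
  exists l, forall e : R, 0 < e -> exists N, forall n, (N <= n)%N -> nm (u n - l) <= e.
Proof.
move=> h.
have cu : cauchy (u @ \oo).
  apply/cauchy_ballP => e e0; near_simpl.
  have e0' : 0 < complex.Re e / 2 by case: e e0 => p q; rewrite ltcE /= => /andP[_ p0]; lra.
  have [N hN] := h _ e0'.
  exists ([set n | (N <= n)%N], [set n | (N <= n)%N]) => /=.
    by split; exists N.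
  move=> [n m] /= [Nn Nm]; rewrite -ball_normE /ball_ /= nmE.
  have -> : e = (complex.Re e)%:C by rewrite -ge0_Re // ltW.
  rewrite ltcR; apply: le_lt_trans (hN _ _ Nn Nm) _; lra.
have /cvg_ex[l hl] : cvg (u @ \oo) by apply: cauchy_cvg.
exists l => e e0; move/cvgrPdist_le: hl => /(_ e%:C).
rewrite ltcR => /(_ e0) [N _ hN]; exists N => n Nn.
by have := hN n Nn; rewrite nmE lecR nmBC.
Unshelve. all: end_near.
Qed.

End InnerProduct.

(** * Orthogonal projections, Riesz representation and adjoints *)

Section Projection.
Variables (R : realType) (H : completeNormedModType R[i]).
Variable dot : {dot H for conjC}.
Hypothesis Hdot : dot_induces_norm dot.
Local Notation C := R[i].
Local Notation normc := (@Normc.normc R).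
Implicit Types (x y z : H) (a b c : C) (t : R) (V W : set H) (T S X G : H -> H).

Definition is_proj V x p := V p /\ forall v, V v -> dot (x - p) v = 0.

Lemma nm_parallelogram x y :
  nm (x - y) ^+ 2 = 2 * nm x ^+ 2 + 2 * nm y ^+ 2 - nm (x + y) ^+ 2.
Proof. by rewrite (nm_sqrB Hdot) (nm_sqrD Hdot); lra. Qed.

(** A minimizing sequence for the distance to [V] is Cauchy by the parallelogram law, and the first
    variation at its limit vanishes in every direction of [V]. *)
Lemma proj_exists V x : csubsp V -> exists p, is_proj V x p.
Proof.
move=> [sV cV].
pose D := [set t : R | exists2 v, V v & t = nm (x - v) ^+ 2].
have D0 : D !=set0 by exists (nm (x - 0) ^+ 2), 0 => //; exact: sub0.
have Dlb : has_lbound D by exists 0 => _ [v _ ->]; exact: sqr_ge0.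
pose d := inf D.
have dle v : V v -> d <= nm (x - v) ^+ 2 by move=> vv; apply: ge_inf => //; exists v.
have near e : 0 < e -> exists2 v, V v & nm (x - v) ^+ 2 <= d + e.
  move=> e0; have [_ [v vv ->] /ltW hv] := inf_adherent e0 (conj D0 Dlb).
  by exists v.
have par v w : V v -> V w ->
    nm (v - w) ^+ 2 <= 2 * nm (x - v) ^+ 2 + 2 * nm (x - w) ^+ 2 - 4 * d.
  move=> vv vw.
  have -> : v - w = (x - w) - (x - v) by rewrite opprB [RHS]addrC addrA subrK.
  rewrite nm_parallelogram.
  have -> : (x - w) + (x - v) = 2 *: (x - 2^-1 *: (v + w)).
    rewrite scalerBr scalerA mulfV ?pnatr_eq0 // scale1r scaler_nat mulr2n opprD.
    by rewrite addrACA [- w + _]addrC.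
  rewrite nmZ exprMn.
  have -> : normc 2 ^+ 2 = 4.
    by rewrite -(rmorph_nat (real_complex R)) normc_real normr_nat -natrX.
  have := dle _ (subZ sV 2^-1 (subD sV vv vw)); lra.
have /choice[u hu] : forall n : nat, exists v, V v /\ nm (x - v) ^+ 2 <= d + n.+1%:R^-1.
  by move=> n; have [|v vv hv] := near n.+1%:R^-1; [rewrite invr_gt0|exists v].
have small (e : R) : 0 < e -> exists N, forall n, (N <= n)%N -> n.+1%:R^-1 <= e.
  move=> e0; exists (Num.truncn e^-1) => n Nn.
  rewrite -[leRHS]invrK lef_pV2 ?posrE ?invr_gt0 //.
  by apply: le_trans (ltW (truncnS_gt _)) _; rewrite ler_nat ltnS.
have [e e0|p hp] := nm_complete (u := u).
  have e40 : 0 < e ^+ 2 / 4 by rewrite divr_gt0 // exprn_gt0.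
  have [N hN] := small _ e40; exists N => n m Nn Nm.
  rewrite -(@ler_pXn2r _ 2) ?nnegrE ?nm_ge0 ?(ltW e0) //.
  have [vn hn] := hu n; have [vm hm] := hu m.
  have := par _ _ vn vm; have := hN _ Nn; have := hN _ Nm.
  move: hn hm; move: (n.+1%:R^-1) (m.+1%:R^-1) => i j; lra.
have Vp : V p.
  apply: cV => e e0; have [N hN] := hp _ e0; exists (u N); first by case: (hu N).
  by rewrite nmBC; exact: hN.
have pmin : nm (x - p) ^+ 2 <= d.
  have k0 : 0 <= 2 * (nm (x - p) + 1) + 1 by have := nm_ge0 (x - p); lra.
  apply: (ler_epsM k0) => e e0.
  have e1 : 0 < Num.min e 1 by rewrite lt_min e0 ltr01.
  have [N hN] := hp _ e1; have [N' hN'] := small _ e0.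
  have := hN (maxn N N') (leq_maxl _ _); have := hN' (maxn N N') (leq_maxr _ _).
  have [vn] := hu (maxn N N').
  move: (u _) vn => v vv; move: (_^-1) => q hv hq.
  rewrite le_min => /andP[ve v1].
  have := nm_tri v x p; have := nm_tri p x v; rewrite (nmBC p).
  have := nm_ge0 (x - p); have := nm_ge0 (v - p); have := nm_ge0 (x - v).
  nra.
exists p; split => // v vv.
set w := dot _ _.
have key t : 0 <= t ^+ 2 * normc w ^+ 2 * nm v ^+ 2 - 2 * t * normc w ^+ 2.
  have := dle _ (subD sV Vp (subZ sV (t%:C * w) vv)).
  rewrite opprD addrA (nm_sqrB Hdot) nmZ exprMn normcM exprMn normc_real real_normK ?num_real //.
  have -> : dot (x - p) ((t%:C * w) *: v) = t%:C * (normc w ^+ 2)%:C.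
    by rewrite dotZr -/w rmorphM /= conjC_real -mul_conjC_normc -mulrA [w * _]mulrC.
  rewrite ReMl /=; lra.
have [->|w0] := eqVneq w 0; first by [].
have n0 : 0 < normc w ^+ 2 by rewrite exprn_gt0 // normc_gt0.
(* Any [t] with [0 < t * nm v ^+ 2 < 2] makes the right-hand side negative; the [+ 1] covers
   [v = 0]. *)
have := key ((nm v ^+ 2 + 1)^-1).
have q0 : 0 < nm v ^+ 2 + 1 by have := sqr_ge0 (nm v); lra.
move: (nm v ^+ 2) q0 (normc w ^+ 2) n0 => q q0 r r0.
have -> : (q + 1)^-1 ^+ 2 * r * q - 2 * (q + 1)^-1 * r = - (r * (q + 2) / (q + 1) ^+ 2).
  by field; rewrite gt_eqF.
rewrite oppr_ge0 leNgt divr_gt0 ?mulr_gt0 ?exprn_gt0 //; lra.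
Qed.

Definition proj V x := xget 0 [set p | is_proj V x p].

Section ProjTheory.
Variable V : set H.
Hypothesis cV : csubsp V.

Lemma projP x : is_proj V x (proj V x).
Proof. by have [p hp] := proj_exists x cV; apply: xgetPex; exists p. Qed.

Lemma proj_in x : V (proj V x). Proof. by case: (projP x). Qed.

Lemma proj_orth x v : V v -> dot (x - proj V x) v = 0.
Proof. by case: (projP x) => _; apply. Qed.

Lemma proj_unique x p : is_proj V x p -> p = proj V x.
Proof.
case: cV => sV _ [vp hp]; apply/eqP; rewrite -subr_eq0; apply/eqP; apply: (dot_eq0 Hdot).
have vd : V (p - proj V x) by apply: subB => //; exact: proj_in.
have := hp _ vd; have := proj_orth x vd; rewrite !dotBl.
by move=> /eqP; rewrite subr_eq0 => /eqP-> /eqP; rewrite subr_eq0 => /eqP->; rewrite subrr.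
Qed.

Lemma proj_id x : V x -> proj V x = x.
Proof. by move=> vx; apply/esym/proj_unique; split=> // v _; rewrite subrr dot0l. Qed.

Lemma proj_linear a x y : proj V (a *: x + y) = a *: proj V x + proj V y.
Proof.
apply/esym/proj_unique; split; first by apply: (cV.1).2; exact: proj_in.
move=> v vv; rewrite opprD addrACA -scalerBr dotDl dotZl !proj_orth //.
by rewrite mulr0 addr0.
Qed.

Lemma nm_proj_sqr x : nm x ^+ 2 = nm (proj V x) ^+ 2 + nm (x - proj V x) ^+ 2.
Proof.
have := nm_pythagoras Hdot (proj_orth x (proj_in x)).
by rewrite subrK addrC.
Qed.

Lemma nm_proj x : nm (proj V x) <= nm x.
Proof.
rewrite -(@ler_pXn2r _ 2) ?nnegrE ?nm_ge0 // [leRHS]nm_proj_sqr lerDl.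
exact: sqr_ge0.
Qed.

End ProjTheory.

(** The component [w] of some [x0] outside the kernel, taken orthogonal to the kernel, represents
    [phi] after rescaling: [y - (phi y / phi w) w] lies in the kernel for every [y] of [V]. *)
Lemma riesz_representation V (phi : H -> C) (M : R) : csubsp V ->
  (forall a x y, V x -> V y -> phi (a *: x + y) = a * phi x + phi y) ->
  (forall x, V x -> normc (phi x) <= M * nm x) ->
  exists2 v, V v & forall y, V y -> phi y = dot y v.
Proof.
move=> cV lphi bphi; have [sV clV] := cV.
have [h0|/existsNP[x0 /not_implyP[vx0 /eqP phx0]]] := pselect (forall y, V y -> phi y = 0).
  by exists 0 => [|y vy]; [exact: sub0|rewrite dot0r h0].
pose K := [set y | V y /\ phi y = 0].
have phi0 : phi 0 = 0.
  have := lphi 1 0 0 (sub0 sV) (sub0 sV).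
  by rewrite scale1r addr0 mul1r => /eqP; rewrite -subr_eq subrr => /eqP.
have phiB x y : V x -> V y -> phi (x - y) = phi x - phi y.
  by move=> vx vy; rewrite addrC -scaleN1r lphi // mulN1r addrC.
have cK : csubsp K.
  split; first split.
  - by split; [exact: sub0|].
  - move=> a x y [vx px] [vy py]; split; first exact: sV.2.
    by rewrite lphi // px py mulr0 addr0.
  move=> x hx; have vx : V x.
    by apply: clV => e e0; have [y [vy _] hy] := hx e e0; exists y.
  split=> //; apply/eqP; rewrite -normc_eq0 eq_le normc_ge0 andbT.
  have M0 : 0 <= Num.max M 0 by rewrite le_max lexx orbT.
  apply: (ler_epsM M0) => e e0; rewrite add0r; have [y [vy py] hy] := hx e e0.
  have -> : phi x = phi (x - y) by rewrite phiB // py subr0.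
  apply: le_trans (bphi _ (subB sV vx vy)) _.
  apply: le_trans (ler_wpM2l M0 hy).
  by apply: ler_wpM2r; [exact: nm_ge0|rewrite le_max lexx].
pose w := x0 - proj K x0.
have [vp pp] := proj_in cK x0.
have vw : V w by exact: subB.
have pw : phi w = phi x0 by rewrite phiB // pp subr0.
have pw0 : phi w != 0 by rewrite pw.
have w0 : dot w w != 0.
  by apply: contra pw0 => /eqP/(dot_eq0 Hdot) ->; rewrite phi0.
exists (conjC (phi w / dot w w) *: w); first exact: subZ.
move=> y vy; rewrite dotZr conjCK.
have : dot (y - (phi y / phi w) *: w) w = 0.
  rewrite dotC; apply/eqP; rewrite fmorph_eq0; apply/eqP; apply: proj_orth cK _ _ _.
  split; first by apply: subB => //; exact: subZ.
  rewrite phiB //; last exact: subZ.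
  have -> : phi ((phi y / phi w) *: w) = phi y / phi w * phi w.
    by rewrite -[_ *: w]addr0 lphi ?phi0 ?addr0 //; exact: sub0.
  by rewrite divfK // subrr.
rewrite dotBl dotZl => /eqP; rewrite subr_eq0 => /eqP ->.
by field; rewrite pw0 w0.
Qed.

Definition opb V T (M : R) := forall x, V x -> nm (T x) <= M * nm x.

(** [T] is regarded as a map from [V] to [H]. Its adjoint is then defined, linear and bounded on all
    of [H] with values in [V], so that later uses need no membership condition on its argument. *)
Lemma adjoint_exists V T (M : R) : csubsp V -> 0 <= M -> linear_on V T -> opb V T M ->
  exists Ts : H -> H, [/\ forall z, V (Ts z),
    forall y z, V y -> dot (T y) z = dot y (Ts z),
    forall a x y, Ts (a *: x + y) = a *: Ts x + Ts y
    & forall z, nm (Ts z) <= M * nm z].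
Proof.
move=> cV M0 lT bT.
have /choice[Ts hTs] : forall z, exists v, V v /\ forall y, V y -> dot (T y) z = dot y v.
  move=> z; have [a x y vx vy|x vx|v vv hv] :=
      riesz_representation (phi := fun y => dot (T y) z) (M := M * nm z) cV.
  - by rewrite lT // dotDl dotZl.
  - apply: le_trans (CS Hdot _ _) _; rewrite mulrAC.
    by apply: ler_wpM2r; [exact: nm_ge0|exact: bT].
  by exists v.
exists Ts; split.
- by move=> z; case: (hTs z).
- by move=> y z vy; case: (hTs z) => _; apply.
- move=> a x y; apply/eqP; rewrite -subr_eq0; apply/eqP; apply: (dot_eq0 Hdot).
  have [vx hx] := hTs x; have [vy hy] := hTs y; have [vz hz] := hTs (a *: x + y).
  set u := _ - _ in |- *.
  have vu : V u by apply: (subB cV.1) => //; apply: cV.1.2.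
  rewrite {2}/u dotBr dotDr dotZr -hx // -hy // -hz //.
  by rewrite dotDr dotZr subrr.
- move=> z; have [vz hz] := hTs z.
  have : nm (Ts z) ^+ 2 <= M * nm (Ts z) * nm z.
    rewrite -(dotxx_Re Hdot) -hz //; apply: le_trans (ler_norm _) _.
    apply: le_trans (normc_ge_Re _) _; apply: le_trans (CS Hdot _ _) _.
    by apply: ler_wpM2r; [exact: nm_ge0|exact: bT].
  have [->|n0] := eqVneq (nm (Ts z)) 0; first by rewrite mulr_ge0 // nm_ge0.
  have n1 : 0 < nm (Ts z) by rewrite lt_def n0 nm_ge0.
  by rewrite expr2 mulrAC ler_pM2r.
Qed.

Definition lop V T := [/\ forall x, V x -> V (T x), linear_on V T
  & exists2 M : R, 0 <= M & opb V T M].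

Lemma bounded_onP V T : bounded_on V T <-> lop V T.
Proof.
split=> [[h1 h2 [M hM]]|[h1 h2 [M M0 hM]]]; split=> //.
  exists (Num.max M 0); first by rewrite le_max lexx orbT.
  move=> x vx; have := hM x vx; rewrite !nmE -rmorphM lecR => /le_trans; apply.
  by apply: ler_wpM2r; [exact: nm_ge0|rewrite le_max lexx].
by exists M => x vx; rewrite !nmE -rmorphM lecR; exact: hM.
Qed.

(* [G] inverts [1 - X], not [X]. *)
Definition is_inv V X G (M : R) := [/\ forall x, V x -> V (G x), linear_on V G,
  opb V G M, forall x, V x -> G (x - X x) = x & forall y, V y -> G y - X (G y) = y].

Lemma is_inv_exists V X (M : R) : csubsp V -> (forall x, V x -> V (X x)) -> linear_on V X ->
  (forall y, V y -> exists2 x, V x & x - X x = y) ->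
  (forall x, V x -> nm x <= M * nm (x - X x)) ->
  exists G, is_inv V X G M.
Proof.
move=> cV vX lX surj bnd; have sV := cV.1.
have inj x y : V x -> V y -> x - X x = y - X y -> x = y.
  move=> vx vy e; apply/eqP; rewrite -subr_eq0; apply/eqP; apply: nm_eq0.
  apply/eqP; rewrite eq_le nm_ge0 andbT.
  apply: le_trans (bnd _ (subB sV vx vy)) _.
  have -> : x - y - X (x - y) = (x - X x) - (y - X y).
    by rewrite (linB sV lX) // !opprD !opprK addrACA.
  by rewrite e subrr nm0 mulr0.
have /choice[G hG] : forall y, exists x, V y -> V x /\ x - X x = y.
  move=> y; have [/surj[x vx e]|nv] := pselect (V y); first by exists x.
  by exists 0.
have GV y : V y -> V (G y) by move=> /hG[].
have GE y : V y -> G y - X (G y) = y by move=> /hG[].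
exists G; split => //.
- move=> a x y vx vy; apply: inj.
  + by apply: GV; apply: sV.2.
  + by apply: sV.2; apply: GV.
  rewrite GE; last by apply: sV.2.
  rewrite lX; [|exact: GV|exact: GV].
  by rewrite opprD addrACA -scalerBr !GE.
- by move=> y vy; apply: le_trans (bnd _ (GV _ vy)) _; rewrite GE.
- by move=> x vx; apply: inj; rewrite ?GE //; [apply: GV| ]; apply: subB => //; exact: vX.
Qed.

End Projection.

(** * The Fredholm alternative *)

Section FredholmAlternative.
Variables (R : realType) (H : completeNormedModType R[i]).
Variable dot : {dot H for conjC}.
Hypothesis Hdot : dot_induces_norm dot.
Local Notation C := R[i].
Local Notation normc := (@Normc.normc R).
Implicit Types (x y z : H) (a b c : C) (t : R) (V W : set H) (T S X G : H -> H)
  (s : seq (H * H)).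

Lemma half_pow_small (K e : R) : 0 < e -> exists N, forall n, (N <= n)%N -> K * 2^-1 ^+ n <= e.
Proof.
move=> e0; exists (Num.truncn (`|K| / e)) => n Nn.
have : `|K| / e <= 2 ^+ n.
  apply: le_trans (ltW (truncnS_gt _)) _; rewrite -natrX ler_nat.
  by apply: leq_trans (ltn_expl n (ltnSn 1)); rewrite ltnS.
rewrite ler_pdivrMr // => h; apply: le_trans (ler_wpM2r _ (ler_norm K)) _.
  by rewrite exprn_ge0.
by rewrite exprVn ler_pdivrMr ?exprn_gt0 // mulrC.
Qed.

Lemma neumann_surj V X y : csubsp V -> (forall x, V x -> V (X x)) -> linear_on V X ->
  opb V X (1 / 2) -> V y -> exists2 x, V x & x - X x = y.
Proof.
move=> cV VX lX bX vy; have sV := cV.1.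
pose u := fix u n := if n is m.+1 then y + X (u m) else 0.
have Vu n : V (u n).
  by elim: n => [|n ih] /=; [exact: sub0|apply: subD => //; exact: VX].
have du n : nm (u n.+1 - u n) <= nm y * 2^-1 ^+ n.
  elim: n => [|n ih] /=; first by rewrite (lin0 sV lX) addr0 subr0 expr0 mulr1.
  rewrite opprD addrACA subrr add0r -(linB sV lX) //; last by exact: (Vu n.+1).
  apply: le_trans (bX _ _) _; first by apply: subB => //; exact: (Vu n.+1).
  by rewrite exprS mulrCA mul1r; apply: ler_wpM2l.
(* The factor [1 - 2^-1 ^+ k] is the exact geometric sum that the induction on [k] requires; [cau]
   drops it. *)
have dist n k : nm (u (n + k)%N - u n) <= nm y * 2 * 2^-1 ^+ n * (1 - 2^-1 ^+ k).
  elim: k => [|k ih]; first by rewrite addn0 subrr nm0 expr0 subrr mulr0.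
  apply: le_trans (nm_tri (u (n + k)%N) _ _) _; rewrite addnS.
  apply: le_trans (lerD (du _) ih) _.
  by rewrite exprD exprS; lra.
have cau n k : nm (u (n + k)%N - u n) <= nm y * 2 * 2^-1 ^+ n.
  apply: le_trans (dist n k) _; apply: ler_piMr.
    by rewrite !mulr_ge0 ?nm_ge0 ?exprn_ge0.
  by rewrite gerBl exprn_ge0.
have [e e0|x hx] := nm_complete (u := u).
  have [N hN] := half_pow_small (nm y * 2) (divr_gt0 e0 (@ltr0n R 2)).
  exists N => n m Nn Nm; apply: le_trans (nm_tri (u N) _ _) _.
  rewrite (nmBC (u N)); have := cau N (n - N)%N; have := cau N (m - N)%N.
  by rewrite !subnKC //; have := hN _ (leqnn N); lra.
have Vx : V x.
  apply: cV.2 => e e0; have [N hN] := hx _ e0; exists (u N) => //.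
  by rewrite nmBC; exact: hN.
exists x => //; apply/eqP; rewrite -subr_eq0; apply/eqP; apply: nm_eq0.
apply/eqP; rewrite eq_le nm_ge0 andbT; apply: (@ler_epsM _ _ _ 2) => // e e0.
have [N hN] := hx _ e0.
have -> : x - X x - y = (x - u N.+1) + (X (u N) - X x).
  by rewrite /= opprD addrA addrA subrK addrAC.
apply: le_trans (nmD _ _) _; rewrite -(linB sV lX) // add0r.
have := bX _ (subB sV (Vu N) Vx); have := hN N (leqnn _); have := hN N.+1 (leqnSn _).
rewrite (nmBC _ x); lra.
Qed.

Lemma neumann V X : csubsp V -> (forall x, V x -> V (X x)) -> linear_on V X ->
  opb V X (1 / 2) -> exists G, is_inv V X G 2.
Proof.
move=> cV VX lX bX; apply: is_inv_exists => //.
  by move=> y vy; exact: neumann_surj.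
move=> x vx; have := bX x vx.
have : nm x <= nm (x - X x) + nm (X x) by rewrite -[x in leLHS](subrK (X x)) nmD.
lra.
Qed.

(* A sequence of pairs [(a, b)] encodes the finite-rank operator [sum of <-, a> b]; its weight
   [wt] bounds the nuclear norm.  Only the second components are required to lie in [V]. *)
Definition rank_one_sum s x := \sum_(p <- s) dot x p.1 *: p.2.
Local Notation fr := rank_one_sum.
Definition ins V s := forall p, p \in s -> V p.2.
Definition wt s : R := \sum_(p <- s) nm p.1 * nm p.2.
Definition opapprox V T := forall e : R, 0 < e ->
  exists2 s, ins V s & opb V (fun x => T x - fr s x) e.

Lemma wt_ge0 s : 0 <= wt s.
Proof. by apply: sumr_ge0 => p _; rewrite mulr_ge0 ?nm_ge0. Qed.

Lemma wt_cat s1 s2 : wt (s1 ++ s2) = wt s1 + wt s2.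
Proof. exact: big_cat. Qed.

Lemma fr_cat s1 s2 x : fr (s1 ++ s2) x = fr s1 x + fr s2 x.
Proof. exact: big_cat. Qed.

Lemma ins_cat V s1 s2 : ins V s1 -> ins V s2 -> ins V (s1 ++ s2).
Proof. by move=> h1 h2 p; rewrite mem_cat => /orP[/h1|/h2]. Qed.

Lemma fr_linear s a x y : fr s (a *: x + y) = a *: fr s x + fr s y.
Proof.
rewrite /fr scaler_sumr -big_split /=; apply: eq_bigr => p _.
by rewrite dotDl dotZl scalerDl scalerA.
Qed.

Lemma fr_in V s x : subsp V -> ins V s -> V (fr s x).
Proof.
by move=> sV iV; apply: sub_sum => // p ps _; apply: subZ => //; exact: iV.
Qed.

Lemma nm_fr s x : nm (fr s x) <= wt s * nm x.
Proof.
apply: le_trans (nm_sum _ _ _) _; rewrite /wt mulr_suml; apply: ler_sum => p _.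
rewrite nmZ mulrAC; apply: ler_wpM2r; first exact: nm_ge0.
by rewrite mulrC; exact: CS.
Qed.

Lemma fr_lop V s : subsp V -> ins V s -> lop V (fr s).
Proof.
move=> sV iV; split; [by move=> x _; exact: fr_in|by move=> a x y _ _; exact: fr_linear|].
by exists (wt s); [exact: wt_ge0|move=> x _; exact: nm_fr].
Qed.

Definition mapfr T s := [seq (p.1, T p.2) | p <- s].

Lemma fr_map V T s x : subsp V -> linear_on V T -> ins V s ->
  fr (mapfr T s) x = T (fr s x).
Proof.
move=> sV lT iV; rewrite /fr big_map (lin_sum sV lT).
  by rewrite !big_seq; apply: eq_bigr => p ps; rewrite (linZ sV lT) //; exact: iV.
by move=> p ps _; apply: subZ => //; exact: iV.
Qed.

Lemma ins_map V W T s : (forall x, V x -> W (T x)) -> ins V s -> ins W (mapfr T s).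
Proof. by move=> VT iV _ /mapP[p ps ->]; apply: VT; exact: iV. Qed.

Lemma wt_map V T (M : R) s : opb V T M -> ins V s -> wt (mapfr T s) <= M * wt s.
Proof.
move=> bT iV; rewrite /wt big_map big_seq [in leRHS]big_seq mulr_sumr.
apply: ler_sum => p ps; rewrite mulrCA; apply: ler_wpM2l; [exact: nm_ge0|].
exact: bT (iV _ ps).
Qed.

Lemma big_frE s x : fr s x = \sum_i dot x (tnth (in_tuple s) i).1 *: (tnth (in_tuple s) i).2.
Proof. by rewrite /fr big_tnth. Qed.

(** The equation [x - fr s x = y] is a linear system with matrix [1 - A] for the numbers
    [dot x (a i)]. A kernel vector of [1 - A] would be the coordinate vector of a fixed point of
    [fr s] in [V]. *)
Lemma finite_rank_inverse V s : csubsp V -> ins V s ->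
  (forall x, V x -> x = fr s x -> x = 0) -> exists M G, is_inv V (fr s) G M.
Proof.
move=> cV iV inj; have sV := cV.1.
pose a i := (tnth (in_tuple s) i).1; pose b i := (tnth (in_tuple s) i).2.
have Vb i : V (b i) by apply: iV; rewrite mem_tnth.
have frE x : fr s x = \sum_i dot x (a i) *: b i by exact: big_frE.
pose A : 'M[C]_(size s) := \matrix_(i, j) dot (b j) (a i).
have uA : 1%:M - A \in unitmx.
  rewrite -unitmx_tr unitmxE unitfE; apply/negP => /det0P[v v0].
  rewrite -[v *m _]trmxK trmx_mul trmxK => /(congr1 trmx); rewrite trmxK.
  move wE : v^T => w hw.
  pose x := \sum_i w i 0 *: b i.
  have hi i : dot x (a i) = w i 0.
    have : ((1%:M - A) *m w) i 0 = 0 by rewrite hw linear0 mxE.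
    rewrite mulmxBl mul1mx mxE [X in _ + X]mxE [X in _ - X]mxE.
    move=> /eqP; rewrite subr_eq0 => /eqP ->.
    by rewrite dot_suml; apply: eq_bigr => j _; rewrite dotZl mxE mulrC.
  have x0 : x = 0.
    apply: inj; first by apply: sub_sum => // i _ _; exact: subZ.
    by rewrite frE; apply: eq_bigr => i _; rewrite hi.
  case/negP: v0; apply/eqP/rowP => i; rewrite mxE.
  by have := hi i; rewrite x0 dot0l -wE mxE.
pose B := invmx (1%:M - A).
pose ph y : 'cV[C]_(size s) := \col_i dot y (a i).
(* The solution in closed form: [B *m ph y] lists the numbers [dot x (a i)] of the solution [x]. *)
pose g y := y + \sum_i (B *m ph y) i 0 *: b i.
have Vg y : V y -> V (g y).
  by move=> vy; apply: subD => //; apply: sub_sum => // i _ _; exact: subZ.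
have gE y : g y - fr s (g y) = y.
  have hB : B *m ph y = ph y + A *m (B *m ph y).
    apply/eqP; rewrite -subr_eq; apply/eqP.
    rewrite -[X in X - _]mul1mx. rewrite -mulmxBl /B. by rewrite mulKVmx.
  have hi i : dot (g y) (a i) = (B *m ph y) i 0.
    rewrite hB mxE dotDl dot_suml; congr (_ + _); first by rewrite mxE.
    rewrite mxE; apply: eq_bigr => j _.
    by rewrite dotZl [A _ _]mxE mulrC.
  rewrite frE; under eq_bigr do rewrite hi.
  by rewrite /g addrK.
have ginj x : V x -> g (x - fr s x) = x.
  move=> vx; apply/eqP; rewrite -subr_eq0; apply/eqP; apply: inj.
    by apply: subB => //; apply: Vg; apply: subB => //; exact: fr_in.
  apply/eqP; rewrite -subr_eq0; apply/eqP.
  have -> : forall u v, fr s (u - v) = fr s u - fr s v.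
    by move=> u v; rewrite addrC -scaleN1r fr_linear scaleN1r addrC.
  have -> : forall u v u' v' : H, u - v - (u' - v') = (u - u') - (v - v').
    by move=> u v u' v'; rewrite !opprD !opprK addrACA.
  by rewrite gE subrr.
exists (1 + \sum_i (\sum_j normc (B i j) * nm (a j)) * nm (b i)).
apply: is_inv_exists => //.
- by move=> x _; exact: fr_in.
- by move=> c x y _ _; exact: fr_linear.
- by move=> y vy; exists (g y); [exact: Vg|exact: gE].
- move=> x vx; rewrite -[x in leLHS]ginj //; move: (x - fr s x) => y.
  rewrite /g; apply: le_trans (nmD _ _) _; rewrite mulrDl mul1r lerD2l.
  apply: le_trans (nm_sum _ _ _) _; rewrite mulr_suml; apply: ler_sum => i _.
  rewrite nmZ mulrAC; apply: ler_wpM2r; first exact: nm_ge0.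
  rewrite mxE; apply: le_trans (normc_sum _ _ _) _; rewrite mulr_suml.
  apply: ler_sum => j _; rewrite normcM -mulrA; apply: ler_wpM2l; first exact: normc_ge0.
  by rewrite mxE mulrC; exact: CS.
Qed.

(** Write [T = E + fr s] with [E] of norm at most 1/2 and [K = (1 - E)^-1]. Then
    [K (1 - T) = 1 - K fr s], and [K fr s] has finite rank; since [K] is injective, this operator is
    injective together with [1 - T]. *)
Theorem fredholm_alternative V T : csubsp V -> lop V T -> opapprox V T ->
  (forall x, V x -> T x = x -> x = 0) -> exists M G, is_inv V T G M.
Proof.
move=> cV [VT lT _] aT inj; have sV := cV.1.
have [|s iV bE] := aT (1 / 2); first by rewrite divr_gt0.
have frV x : V x -> V (fr s x) by move=> _; exact: fr_in.
have lfr : linear_on V (fr s) by move=> a x y _ _; exact: fr_linear.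
pose E x := T x - fr s x.
have VE x : V x -> V (E x) by move=> vx; apply: subB => //; [exact: VT|exact: frV].
have lE : linear_on V E.
  move=> a x y vx vy; rewrite /E lT // lfr // opprD addrACA; congr (_ + _).
  by rewrite scalerBr.
have [K [VK lK bK KE EK]] := neumann cV VE lE bE.
have split1 x : x - T x = (x - E x) - fr s x by rewrite /E opprB addrCA [RHS]addrC addKr.
have iV' : ins V (mapfr K s) by apply: ins_map iV.
have frE x : fr (mapfr K s) x = K (fr s x) by exact: (fr_map x sV lK iV).
have key x : V x -> K (x - T x) = x - fr (mapfr K s) x.
  move=> vx; rewrite split1 (linB sV lK) ?frE ?KE //; last exact: frV.
  by apply: subB => //; exact: VE.
have Kinj x : V x -> K x = 0 -> x = 0.
  by move=> vx e; rewrite -(EK x vx) e (lin0 sV lE) subrr.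
have [|M [G [VG lG bG GE EG]]] := finite_rank_inverse cV iV'.
  move=> x vx e; apply: inj => //; apply/esym/eqP; rewrite -subr_eq0; apply/eqP.
  apply: Kinj; first by apply: subB => //; exact: VT.
  by rewrite key // -e subrr.
have bG' y : V y -> nm (G y) <= Num.max M 0 * nm y.
  move=> vy; apply: le_trans (bG _ vy) _; apply: ler_wpM2r; first exact: nm_ge0.
  by rewrite le_max lexx.
exists (Num.max M 0 * 2); apply: is_inv_exists => //.
  move=> y vy; exists (G (K y)); first by apply: VG; exact: VK.
  have vGK : V (G (K y)) by apply: VG; apply: VK.
  apply/eqP; rewrite -subr_eq0; apply/eqP; apply: Kinj.
    by apply: subB => //; apply: subB => //; exact: VT.
  rewrite (linB sV lK) ?key ?EG ?subrr //; first exact: VK.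
  by apply: subB => //; exact: VT.
move=> x vx; have vd : V (x - T x) by apply: subB => //; exact: VT.
rewrite -[x in leLHS]GE // -key //; apply: le_trans (bG' _ (VK _ vd)) _.
rewrite -mulrA; apply: ler_wpM2l; first by rewrite le_max lexx orbT.
exact: bK.
Qed.

End FredholmAlternative.

(** * Finite-rank determinants *)

Section DeterminantIdentities.
Variable F : fieldType.

(** The matrix with rows [(1, A)] and [(B, 1)] has two block triangular factorizations. *)
Lemma sylvester_det m n (A : 'M[F]_(m, n)) (B : 'M[F]_(n, m)) :
  \det (1%:M - A *m B) = \det (1%:M - B *m A).
Proof.
have h1 : block_mx 1%:M A B 1%:M = block_mx 1%:M A 0 1%:M *m block_mx (1%:M - A *m B) 0 B 1%:M.
  by rewrite mulmx_block !mul1mx !mul0mx !mulmx1 !add0r subrK.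
have h2 : block_mx 1%:M A B 1%:M = block_mx 1%:M 0 B 1%:M *m block_mx 1%:M A 0 (1%:M - B *m A).
  by rewrite mulmx_block !mul1mx !mul0mx !mulmx1 !addr0 [B *m A + _]addrC subrK.
have := congr1 determinant (etrans (esym h1) h2).
by rewrite !det_mulmx !det_lblock !det_ublock !det1 !mul1r mulr1.
Qed.

(* [Z] has square zero, so a full-rank factorization [Z = C R] satisfies [R C = 0]. *)
Lemma det_square_zero n (Z : 'M[F]_n) : Z *m Z = 0 -> \det (1%:M + Z) = 1.
Proof.
move=> ZZ; rewrite -[Z]opprK -(mulmx_base Z) -mulNmx sylvester_det.
have h : row_base Z *m col_base Z = 0.
  have : col_base Z *m (row_base Z *m col_base Z) *m row_base Z = 0.
    by rewrite mulmxA mulmx_base -mulmxA mulmx_base.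
  rewrite -[X in _ = X](mul0mx _ (row_base Z)) => /(row_free_inj (row_base_free Z)).
  rewrite -[X in _ = X](mulmx0 _ (col_base Z)); exact: (row_full_inj (col_base_full Z)).
by rewrite mulmxN h oppr0 subr0 det1.
Qed.

(** The first hypothesis gives [1 - Y = (1 - X)(1 + (X - Y))]; with the second, [X - Y] has square
    zero, so the last factor has determinant 1. *)
Lemma det_congruent n (X Y : 'M[F]_n) : X *m (X - Y) = 0 -> Y *m (X - Y) = 0 ->
  \det (1%:M - X) = \det (1%:M - Y).
Proof.
move=> hX hY; have ZZ : (X - Y) *m (X - Y) = 0 by rewrite {1}mulmxBl hX hY subr0.
have -> : 1%:M - Y = (1%:M - X) *m (1%:M + (X - Y)).
  by rewrite mulmxDr mulmx1 mulmxBl mul1mx hX subr0 addrA subrK.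
by rewrite det_mulmx (det_square_zero ZZ) mulr1.
Qed.

End DeterminantIdentities.

Section FiniteRankDeterminant.
Variables (R : realType) (H : completeNormedModType R[i]).
Variable dot : {dot H for conjC}.
Hypothesis Hdot : dot_induces_norm dot.
Local Notation C := R[i].
Local Notation normc := (@Normc.normc R).
Implicit Types (x y z : H) (V W : set H) (T S X G K : H -> H) (s : seq (H * H)).

Definition lfun V (f : H -> C) :=
  forall a x y, V x -> V y -> f (a *: x + y) = a * f x + f y.

Lemma lfun_sum V f n (c : 'I_n -> C) (b : 'I_n -> H) : subsp V -> lfun V f ->
  (forall i, V (b i)) -> f (\sum_i c i *: b i) = \sum_i c i * f (b i).
Proof.
move=> sV lf Vb; have f0 : f 0 = 0.
  have := lf 1 0 0 (sub0 sV) (sub0 sV).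
  by rewrite scale1r addr0 mul1r => /eqP; rewrite -subr_eq subrr => /eqP.
have : V (\sum_i c i *: b i) /\ f (\sum_i c i *: b i) = \sum_i c i * f (b i).
  elim/big_rec2: _ => [|i y x _ [vx <-]]; first by split=> //; exact: sub0.
  by split; [exact: sV.2|rewrite lf].
by case.
Qed.

Definition is_rep V K n (f : 'I_n -> H -> C) (b : 'I_n -> H) :=
  [/\ forall i, lfun V (f i), forall i, V (b i)
    & forall x, V x -> K x = \sum_i f i x *: b i].

(* [det(1 - K)] for [K = sum of f_i(-) b_i], the [b_i] not being assumed independent:
   the [n x n] determinant does not depend on the representation, by Sylvester's identity. *)
Definition fdet n (f : 'I_n -> H -> C) (b : 'I_n -> H) :=
  \det (1%:M - \matrix_(i, j) f i (b j)).

Lemma lfun_rep V K n f b g x : subsp V -> @is_rep V K n f b -> lfun V g -> V x ->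
  g (K x) = \sum_i g (b i) * f i x.
Proof.
move=> sV [_ Vb KE] lg vx; rewrite KE // (lfun_sum (fun i => f i x) sV lg Vb).
by apply: eq_bigr => i _; rewrite mulrC.
Qed.

(** Both representations are read on the joint family [(b, c)]. Padded with zero rows, their
    coefficient matrices are [X] and [Y], and a column of [X - Y] holds the coefficients of
    [K v - K v = 0]; hence every [f i] and [g i] annihilates it. The identities [e1] to [e4] say
    this, each side being [f i] or [g i] applied to [K (b j)] or [K (c j)]. *)
Lemma fdet_unique V K n m (f : 'I_n -> H -> C) b (g : 'I_m -> H -> C) c : subsp V ->
  is_rep V K f b -> is_rep V K g c -> fdet f b = fdet g c.
Proof.
move=> sV rf rg; have [lf Vb _] := rf; have [lg Vc _] := rg.
pose A : 'M[C]_n := \matrix_(i, j) f i (b j).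
pose B : 'M[C]_(n, m) := \matrix_(i, j) f i (c j).
pose A' : 'M[C]_(m, n) := \matrix_(i, j) g i (b j).
pose B' : 'M[C]_m := \matrix_(i, j) g i (c j).
have e1 : A *m A = B *m A'.
  apply/matrixP => i j; rewrite !mxE.
  transitivity (f i (K (b j))).
    by rewrite (lfun_rep sV rf (lf i) (Vb j)); apply: eq_bigr => k _; rewrite !mxE.
  by rewrite (lfun_rep sV rg (lf i) (Vb j)); apply: eq_bigr => k _; rewrite !mxE.
have e2 : A *m B = B *m B'.
  apply/matrixP => i j; rewrite !mxE.
  transitivity (f i (K (c j))).
    by rewrite (lfun_rep sV rf (lf i) (Vc j)); apply: eq_bigr => k _; rewrite !mxE.
  by rewrite (lfun_rep sV rg (lf i) (Vc j)); apply: eq_bigr => k _; rewrite !mxE.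
have e3 : A' *m A = B' *m A'.
  apply/matrixP => i j; rewrite !mxE.
  transitivity (g i (K (b j))).
    by rewrite (lfun_rep sV rf (lg i) (Vb j)); apply: eq_bigr => k _; rewrite !mxE.
  by rewrite (lfun_rep sV rg (lg i) (Vb j)); apply: eq_bigr => k _; rewrite !mxE.
have e4 : A' *m B = B' *m B'.
  apply/matrixP => i j; rewrite !mxE.
  transitivity (g i (K (c j))).
    by rewrite (lfun_rep sV rf (lg i) (Vc j)); apply: eq_bigr => k _; rewrite !mxE.
  by rewrite (lfun_rep sV rg (lg i) (Vc j)); apply: eq_bigr => k _; rewrite !mxE.
have := @det_congruent _ _ (block_mx A B 0 0) (block_mx 0 0 A' B').
rewrite opp_block_mx add_block_mx !oppr0 ?addr0 ?add0r !mulmx_block.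
rewrite !mulmxN !mul0mx ?oppr0 ?addr0 ?add0r e1 e2 e3 e4 !subrr block_mx0.
move=> /(_ erefl erefl).
rewrite !scalar_mx_block !opp_block_mx !add_block_mx !oppr0 ?addr0 ?add0r.
by rewrite det_ublock det_lblock !det1 mul1r mulr1.
Qed.

Definition detval V K d := exists n (f : 'I_n -> H -> C) b, is_rep V K f b /\ d = fdet f b.

Lemma detval_unique V K d d' : subsp V -> detval V K d -> detval V K d' -> d = d'.
Proof.
by move=> sV [n [f [b [rf ->]]]] [m [g [c [rg ->]]]]; exact: (fdet_unique sV rf rg).
Qed.

(** [1 - (K + G - K G) = (1 - K)(1 - G)]. The operator is represented by the [b i] with the
    functionals [f i (1 - G)] and by the [c j] with [g j]; the resulting block matrix is a product
    of an upper and a lower triangular one. *)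
Lemma detval_mul V K G d d' : subsp V -> detval V K d -> detval V G d' ->
  detval V (fun x => K x + G x - K (G x)) (d * d').
Proof.
move=> sV [n [f [b [rf ->]]]] [m [g [c [rg ->]]]].
have [lf Vb KE] := rf; have [lg Vc GE] := rg.
have VG x : V x -> V (G x).
  by move=> vx; rewrite GE //; apply: sub_sum => // i _ _; exact: subZ.
pose h (i : 'I_(n + m)) x := match fintype.split i with inl i => f i x - f i (G x) | inr j => g j x end.
pose u (i : 'I_(n + m)) := match fintype.split i with inl i => b i | inr j => c j end.
exists (n + m)%N, h, u; split.
  split.
  - move=> i; rewrite /h; case: (fintype.split i) => j //.
    move=> a x y vx vy; rewrite lf //.
    have -> : f j (G (a *: x + y)) = a * f j (G x) + f j (G y).
      rewrite !(lfun_rep sV rg (lf j)) //; last exact: sV.2.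
      rewrite mulr_sumr -big_split /=; apply: eq_bigr => k _; rewrite lg //; ring.
    ring.
  - by move=> i; rewrite /u; case: (fintype.split i).
  - move=> x vx; rewrite big_split_ord /=.
    have -> : \sum_(i < n) h (lshift m i) x *: u (lshift m i) =
        \sum_i (f i x *: b i - f i (G x) *: b i).
      by apply: eq_bigr => i _; rewrite /h /u (unsplitK (inl i)) scalerBl.
    have -> : \sum_(i < m) h (rshift n i) x *: u (rshift n i) = \sum_i g i x *: c i.
      by apply: eq_bigr => i _; rewrite /h /u (unsplitK (inr i)).
    by rewrite sumrB -(KE _ vx) -(KE _ (VG _ vx)) -(GE _ vx) addrAC.
pose A : 'M[C]_n := \matrix_(i, j) f i (b j).
pose B : 'M[C]_(n, m) := \matrix_(i, j) f i (c j).
pose A' : 'M[C]_(m, n) := \matrix_(i, j) g i (b j).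
pose B' : 'M[C]_m := \matrix_(i, j) g i (c j).
have -> : fdet h u = \det (1%:M - block_mx (A - B *m A') (B - B *m B') A' B').
  congr (\det (_ - _)); apply/matrixP => i j.
  case: (split_ordP i) => k ->; case: (split_ordP j) => l ->.
  - rewrite block_mxEul !mxE /h /u !(unsplitK (inl _)); congr (_ - _).
    rewrite (lfun_rep sV rg (lf k) (Vb l)); apply: eq_bigr => q _; by rewrite !mxE.
  - rewrite block_mxEur !mxE /h /u (unsplitK (inl _)) (unsplitK (inr _)); congr (_ - _).
    rewrite (lfun_rep sV rg (lf k) (Vc l)); apply: eq_bigr => q _; by rewrite !mxE.
  - by rewrite block_mxEdl !mxE /h /u (unsplitK (inl _)) (unsplitK (inr _)).
  - by rewrite block_mxEdr !mxE /h /u !(unsplitK (inr _)).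
have -> : 1%:M - block_mx (A - B *m A') (B - B *m B') A' B' =
    block_mx 1%:M (- B) 0 1%:M *m block_mx (1%:M - A) 0 (- A') (1%:M - B').
  rewrite scalar_mx_block opp_block_mx add_block_mx mulmx_block.
  rewrite !mul1mx !mul0mx !add0r mulNmx mulmxN opprK opprB addrA; congr block_mx.
    by rewrite addrAC.
  by rewrite mulNmx mulmxBr mulmx1 opprB.
by rewrite det_mulmx det_ublock det_lblock !det1 !mul1r.
Qed.

Lemma detval_ext V K G d : (forall x, V x -> K x = G x) -> detval V K d -> detval V G d.
Proof.
move=> h [n [f [b [[lf Vb KE] ->]]]]; exists n, f, b; split=> //; split=> // x vx.
by rewrite -h // KE.
Qed.

Lemma lin_comb_linear n (e : 'I_n -> H) a (c d : 'rV[C]_n) :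
  lin_comb e (a *: c + d) = a *: lin_comb e c + lin_comb e d.
Proof.
rewrite /lin_comb scaler_sumr -big_split /=; apply: eq_bigr => i _.
by rewrite !mxE scalerDl scalerA.
Qed.

Lemma basis_coord W n (e : 'I_n -> H) : is_basis W e ->
  exists f : 'I_n -> H -> C, [/\ forall i, lfun W (f i),
    forall x, W x -> x = \sum_i f i x *: e i
    & forall c i, f i (\sum_j c j *: e j) = c i].
Proof.
move=> be; have [fn inj surj] := be.
have /choice[co hco] : forall x, exists c : 'rV[C]_n, W x -> lin_comb e c = x.
  move=> x; have [/surj[c _ <-]|nw] := pselect (W x); first by exists c.
  by exists 0.
have Wl c : W (lin_comb e c) by exact: fn.
have coE c : co (lin_comb e c) = c.
  by apply: inj; rewrite ?in_setT // hco.
have sumE (c : 'I_n -> C) : \sum_j c j *: e j = lin_comb e (\row_j c j).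
  by apply: eq_bigr => j _; rewrite mxE.
exists (fun i x => co x 0 i); split.
- move=> i a x y wx wy; rewrite -{1}(hco x wx) -{1}(hco y wy) -lin_comb_linear coE.
  by rewrite !mxE.
- by move=> x wx; rewrite -{1}(hco x wx).
- by move=> c i; rewrite sumE coE mxE.
Qed.

Lemma basis_in W n (e : 'I_n -> H) i : is_basis W e -> W (e i).
Proof.
move=> [fn _ _]; have -> : e i = lin_comb e (delta_mx 0 i); last exact: fn.
rewrite /lin_comb (bigD1 i) //= mxE !eqxx scale1r big1 ?addr0 // => j ji.
by rewrite mxE eqxx (negbTE ji) scale0r.
Qed.

Lemma basis_detval V W K n (e : 'I_n -> H) (M : 'M[C]_n) : subsp V -> W `<=` V ->
  linear_on V K -> (forall x, V x -> W (K x)) -> is_basis W e ->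
  (forall j, e j - K (e j) = \sum_i M i j *: e i) -> detval V K (\det M).
Proof.
move=> sV WV lK VK be hM; have [f [lf fE fc]] := basis_coord be.
exists n, (fun i x => f i (K x)), e; split.
  split.
  - by move=> i a x y vx vy; rewrite lK // lf //; exact: VK.
  - by move=> i; apply: WV; exact: basis_in be.
  - by move=> x vx; apply: fE; exact: VK.
congr (\det _); apply/matrixP => i j; rewrite !mxE.
have -> : K (e j) = \sum_k ((k == j)%:R - M k j) *: e k.
  under eq_bigr do rewrite scalerBl.
  rewrite sumrB -hM (bigD1 j) //= eqxx scale1r big1 ?addr0; last first.
    by move=> k /negbTE ->; rewrite scale0r.
  by rewrite opprB addrC subrK.
by rewrite fc opprB addrC subrK.
Qed.

(** Every basis of [W] gives a representation of [K], because [K] maps [V] into [W]; so whichever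
    basis [findim_det] selects, the value is that of [detval]. *)
Lemma findim_detE V W K d : subsp V -> W `<=` V -> linear_on V K ->
  (forall x, V x -> W (K x)) -> (exists n, has_dim W n) -> detval V K d ->
  findim_det W (fun x => x - K x) = d.
Proof.
move=> sV WV lK VK [n [e be]] hd.
have hset d' : [set d | exists n (e : 'I_n -> H) (M : 'M[R[i]]_n),
    [/\ is_basis W e, forall j, e j - K (e j) = \sum_i M i j *: e i & d = \det M]] d' -> d' = d.
  move=> [m [e' [M [be' hM ->]]]]; apply: (detval_unique sV _ hd).
  exact: (basis_detval sV WV lK VK be' hM).
apply: hset; apply: xgetPex.
have [f [lf fE fc]] := basis_coord be.
exists (\det (\matrix_(i, j) ((i == j)%:R - f i (K (e j))))), n, e.
eexists; split=> // j; under eq_bigr do rewrite mxE scalerBl.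
rewrite sumrB -fE; last by apply: VK; apply: WV; exact: basis_in be.
by rewrite (bigD1 j) //= eqxx scale1r big1 ?addr0 // => k /negbTE ->; rewrite scale0r.
Qed.

Lemma findim_det_mx W T n (e : 'I_n -> H) (M : 'M[C]_n) : subsp W -> linear_on W T ->
  (forall x, W x -> W (T x)) -> is_basis W e ->
  (forall j, T (e j) = \sum_i M i j *: e i) -> findim_det W T = \det M.
Proof.
move=> sW lT WT be hM.
have lK : linear_on W (fun x => x - T x).
  by move=> a x y wx wy; rewrite lT // opprD addrACA scalerBr.
have WK x : W x -> W (x - T x) by move=> wx; apply: subB => //; exact: WT.
have -> : T = (fun x => x - (x - T x)).
  by apply/funext => x; rewrite opprB addrC subrK.
apply: (@findim_detE W) => //; first by exists n, e.
by apply: (basis_detval sW _ lK WK be) => // j; rewrite opprB addrC subrK.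
Qed.

End FiniteRankDeterminant.

Section DetLipschitz.
Variable R : realType.
Local Notation C := R[i].
Local Notation normc := (@Normc.normc R).

Lemma prod_lip (I : Type) (r : seq I) (u v : I -> C) (B e : R) : 1 <= B -> 0 <= e ->
  (forall i, normc (u i) <= B) -> (forall i, normc (v i) <= B) ->
  (forall i, normc (u i - v i) <= e) ->
  normc (\prod_(i <- r) u i - \prod_(i <- r) v i) <= (size r)%:R * B ^+ size r * e.
Proof.
move=> B1 e0 hu hv huv; have B0 : 0 <= B by lra.
elim: r => [|i r ih].
  by rewrite !big_nil subrr normc0 mul0r mul0r.
rewrite !big_cons /=.
have -> : forall a b c d : C, a * b - c * d = a * (b - d) + (a - c) * d by move=> *; ring.
apply: le_trans (normcD _ _) _; rewrite !normcM normc_prod.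
have h1 : normc (u i) * normc (\prod_(j <- r) u j - \prod_(j <- r) v j) <=
    B * ((size r)%:R * B ^+ size r * e).
  by apply: ler_pM; rewrite ?normc_ge0 ?hu.
have h2 : \prod_(j <- r) normc (v j) <= B ^+ size r.
  elim: r {ih h1} => [|j r ih]; first by rewrite big_nil expr0.
  rewrite big_cons exprS; apply: ler_pM; rewrite ?normc_ge0 //.
  by apply: prodr_ge0 => k _; exact: normc_ge0.
have h3 : normc (u i - v i) * \prod_(j <- r) normc (v j) <= e * B ^+ size r.
  apply: ler_pM; rewrite ?normc_ge0 //.
  by apply: prodr_ge0 => k _; exact: normc_ge0.
have h4 : e * B ^+ size r <= e * B ^+ (size r).+1.
  by apply: ler_wpM2l => //; rewrite exprS ler_peMl ?exprn_ge0.
apply: le_trans (lerD h1 (le_trans h3 h4)) _.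
by rewrite exprS -natr1; lra.
Qed.

(** The point is the order of the quantifiers: the constant depends on the size and on the bound of
    the entries only. *)
Lemma det_lip n (B : R) : exists2 K : R, 0 <= K & forall (M N : 'M[C]_n) (e : R), 0 <= e ->
  (forall i j, normc (M i j) <= B) -> (forall i j, normc (N i j) <= B) ->
  (forall i j, normc (M i j - N i j) <= e) ->
  normc (\det M - \det N) <= K * e.
Proof.
pose B' := Num.max B 1.
have B'1 : 1 <= B' by rewrite le_max lexx orbT.
exists (\sum_(s : 'S_n) n%:R * B' ^+ n).
  by apply: sumr_ge0 => s _; rewrite mulr_ge0 ?exprn_ge0 ?ler0n //; lra.
move=> M N e e0 hM hN hMN; rewrite /determinant -sumrB mulr_suml.
apply: le_trans (normc_sum _ _ _) _; apply: ler_sum => s _.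
rewrite -mulrBr normcM normcX normcN1 expr1n mul1r.
have := @prod_lip _ (index_enum 'I_n) (fun i => M i (s i)) (fun i => N i (s i)) B' e B'1 e0.
have -> : size (index_enum 'I_n) = n by rewrite -[RHS]card_ord cardT enumT.
apply=> i; rewrite ?le_max; [by rewrite hM|by rewrite hN|exact: hMN].
Qed.

End DetLipschitz.

(** * Nuclear operators and their determinant *)

Section NuclearOperators.
Variables (R : realType) (H : completeNormedModType R[i]).
Variable dot : {dot H for conjC}.
Hypothesis Hdot : dot_induces_norm dot.
Local Notation C := R[i].
Local Notation normc := (@Normc.normc R).
Local Notation fr := (rank_one_sum dot).
Implicit Types (x y z : H) (V W : set H) (T S X G K : H -> H) (s t : seq (H * H)).

(** Induction on [n]: [b ord0] is added to a basis of the span of the other vectors, unless it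
    already lies in that span. *)
Lemma span_basis n (b : 'I_n -> H) : exists m (e : 'I_m -> H), is_basis (range (lin_comb b)) e.
Proof.
elim: n b => [|n ih] b.
  exists 0%N, b; split=> // c d _ _ _; first by apply/rowP => -[].
pose b' i := b (lift ord0 i); have [m [e be]] := ih b'.
have bE (c : 'rV_n.+1) : lin_comb b c = c 0 ord0 *: b ord0 + lin_comb b' (\row_i c 0 (lift ord0 i)).
  by rewrite /lin_comb big_ord_recl; congr (_ + _); apply: eq_bigr => i _; rewrite mxE.
pose mk k (c0 : C) (c : 'rV[C]_k) : 'rV[C]_k.+1 := \row_i oapp (fun j => c 0 j) c0 (unlift ord0 i).
have mk0 k c0 c : mk k c0 c 0 ord0 = c0 by rewrite mxE unlift_none.
have mkS k c0 c : \row_i mk k c0 c 0 (lift ord0 i) = c.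
  by apply/rowP => i; rewrite !mxE liftK.
have [fn inj surj] := be.
have [[c0 _ hc0]|nb] := pselect (range (lin_comb b') (b ord0)).
  exists m, e; have -> : range (lin_comb b) = range (lin_comb b'); last by [].
  apply/seteqP; split => _ [c _ <-].
    by exists (c 0 ord0 *: c0 + \row_i c 0 (lift ord0 i)); rewrite // lin_comb_linear hc0 bE.
  by exists (mk _ 0 c); rewrite // bE mk0 mkS scale0r add0r.
pose e' i := oapp e (b ord0) (unlift ord0 i).
have eE (c : 'rV_m.+1) : lin_comb e' c = c 0 ord0 *: b ord0 + lin_comb e (\row_i c 0 (lift ord0 i)).
  rewrite /lin_comb big_ord_recl /e' unlift_none; congr (_ + _).
  by apply: eq_bigr => i _; rewrite mxE liftK.
exists m.+1, e'; split.
- move=> c _; have [d _ hd] := fn (\row_i c 0 (lift ord0 i)) I.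
  by exists (mk _ (c 0 ord0) d); rewrite // bE mk0 mkS hd eE.
- move=> c d _ _; rewrite !eE => ecd.
  have [e0|n0] := eqVneq (c 0 ord0) (d 0 ord0).
    move: ecd; rewrite e0 => /addrI /inj; rewrite !in_setT => /(_ erefl erefl)/rowP ecd.
    apply/rowP => i; case: (unliftP ord0 i) => [j|] -> //.
    by have := ecd j; rewrite !mxE.
  case: nb.
  have [u _ hu] := fn (\row_i c 0 (lift ord0 i)) I.
  have [v _ hv] := fn (\row_i d 0 (lift ord0 i)) I.
  exists ((c 0 ord0 - d 0 ord0)^-1 *: (- u + v)) => //.
  have lE (a : C) w w' : lin_comb b' (a *: (- w + w')) = a *: (- lin_comb b' w + lin_comb b' w').
    rewrite -[a *: _]addr0 lin_comb_linear -scaleN1r lin_comb_linear scaleN1r.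
    by rewrite [lin_comb b' 0]big1 ?addr0 // => i _; rewrite mxE scale0r.
  rewrite lE hu hv.
  have -> : - lin_comb e (\row_i c 0 (lift ord0 i)) + lin_comb e (\row_i d 0 (lift ord0 i)) =
     (c 0 ord0 - d 0 ord0) *: b ord0.
    rewrite scalerBl.
    have -> : lin_comb e (\row_i d 0 (lift ord0 i)) =
        c 0 ord0 *: b ord0 + lin_comb e (\row_i c 0 (lift ord0 i)) - d 0 ord0 *: b ord0.
      by rewrite ecd addrC addKr.
    by rewrite [X in X - _]addrC addrA addKr.
  by rewrite scalerA mulVf ?scale1r // subr_eq0.
- move=> _ [c _ <-]; have [d _ hd] := surj (lin_comb b' (\row_i c 0 (lift ord0 i))) (imageT _ _).
  by exists (mk _ (c 0 ord0) d); rewrite // eE mk0 mkS hd bE.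
Qed.

Lemma range_lin_comb_subsp n (b : 'I_n -> H) : subsp (range (lin_comb b)).
Proof.
split; first by exists 0 => //; rewrite /lin_comb big1 // => i _; rewrite mxE scale0r.
by move=> a _ _ [c _ <-] [d _ <-]; exists (a *: c + d) => //; rewrite lin_comb_linear.
Qed.

Lemma basis_subsp W n (e : 'I_n -> H) : is_basis W e -> W = range (lin_comb e).
Proof.
move=> [fn inj surj]; apply/seteqP; split => [x /surj //|_ [c _ <-]]; exact: fn.
Qed.

(** The dual vectors come from inverting the Gram matrix of [e]. It is nonsingular because a kernel
    vector would give a combination of the [e i] that is orthogonal to itself. *)
Lemma dual_basis W n (e : 'I_n -> H) : is_basis W e ->
  exists e' : 'I_n -> H, (forall i, W (e' i)) /\ forall i j, dot (e j) (e' i) = (i == j)%:R.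
Proof.
move=> be; have sW : subsp W by rewrite (basis_subsp be); exact: range_lin_comb_subsp.
have [fn inj surj] := be.
pose A : 'M[C]_n := \matrix_(i, j) dot (e j) (e i).
have uA : A \in unitmx.
  rewrite -unitmx_tr unitmxE unitfE; apply/negP => /det0P[v v0 hv].
  have e0 : lin_comb e v = 0.
    apply: (dot_eq0 Hdot); rewrite {2}/lin_comb dot_sumr big1 // => i _.
    rewrite dotZr; have : (v *m A^T) 0 i = 0 by rewrite hv mxE.
    rewrite mxE => h; suff -> : dot (lin_comb e v) (e i) = 0 by rewrite mulr0.
    by rewrite -h /lin_comb dot_suml; apply: eq_bigr => j _; rewrite dotZl !mxE.
  case/negP: v0; apply/eqP; apply: inj; rewrite ?in_setT // e0 /lin_comb big1 // => i _.
  by rewrite mxE scale0r.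
exists (fun i => \sum_k conjC (invmx A i k) *: e k); split.
  by move=> i; apply: sub_sum => // k _ _; apply: subZ => //; exact: basis_in be.
move=> i j; rewrite dot_sumr; have -> : (i == j)%:R = (invmx A *m A) i j.
  by rewrite mulVmx // mxE.
by rewrite mxE; apply: eq_bigr => k _; rewrite dotZr conjCK mxE.
Qed.

Lemma dual_basisE W n (e e' : 'I_n -> H) x : is_basis W e ->
  (forall i j, dot (e j) (e' i) = (i == j)%:R) -> W x -> x = \sum_i dot x (e' i) *: e i.
Proof.
move=> be he; have [fn inj surj] := be => /surj[c _ <-].
apply: eq_bigr => i _; rewrite /lin_comb dot_suml (bigD1 i) //= dotZl he eqxx mulr1.
rewrite big1 ?addr0 // => j ji; rewrite dotZl he eq_sym (negbTE ji) mulr0 //.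
Qed.

(** The operator [q] built from the dual basis is bounded, has values in [W] and fixes [W]; by
    continuity it fixes every limit of points of [W]. *)
Lemma findim_csubsp W n (e : 'I_n -> H) : is_basis W e -> csubsp W.
Proof.
move=> be; have sW : subsp W by rewrite (basis_subsp be); exact: range_lin_comb_subsp.
split=> // x hx; have [e' [we' he']] := dual_basis be.
pose q x := \sum_i dot x (e' i) *: e i.
have wq y : W (q y) by apply: sub_sum => // i _ _; apply: subZ => //; exact: basis_in be.
pose M := \sum_i nm (e' i) * nm (e i).
have M0 : 0 <= M by apply: sumr_ge0 => i _; rewrite mulr_ge0 ?nm_ge0.
have bq y : nm (q y) <= M * nm y.
  apply: le_trans (nm_sum _ _ _) _; rewrite mulr_suml; apply: ler_sum => i _.
  rewrite nmZ mulrAC; apply: ler_wpM2r; first exact: nm_ge0.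
  by rewrite mulrC; exact: CS.
suff -> : x = q x by exact: wq.
apply/eqP; rewrite -subr_eq0; apply/eqP; apply: nm_eq0.
apply/eqP; rewrite eq_le nm_ge0 andbT.
have k0 : 0 <= 1 + M by rewrite addr_ge0.
apply: (ler_epsM k0) => d d0; rewrite add0r; have [y wy hy] := hx d d0.
have -> : x - q x = (x - y) - q (x - y).
  have -> : q (x - y) = q x - y.
    rewrite [y in RHS](dual_basisE be he' wy) -sumrB; apply: eq_bigr => i _.
    by rewrite dotBl scalerBl.
  by rewrite opprB addrA subrK.
apply: le_trans (nmB _ _) _; rewrite mulrDl mul1r; apply: lerD => //.
by apply: le_trans (bq _) _; exact: ler_wpM2l.
Qed.

(* The operator-norm closure of the finite-rank operators of nuclear norm at most tau. *)
Definition nuc V (tau : R) T := forall e : R, 0 < e ->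
  exists s, [/\ ins V s, wt s <= tau & opb V (fun x => T x - fr s x) e].

(* The closure of the finite-rank operators in nuclear norm. *)
Definition nucl V T := lop V T /\
  forall e : R, 0 < e -> exists2 s, ins V s & nuc V e (fun x => T x - fr s x).

Lemma nuc_ext V tau T S : (forall x, V x -> T x = S x) -> nuc V tau T -> nuc V tau S.
Proof.
move=> h nT e e0; have [s [iV ws bs]] := nT e e0; exists s; split=> // x vx.
by rewrite -h //; exact: bs.
Qed.

Lemma nuc_le V tau tau' T : tau <= tau' -> nuc V tau T -> nuc V tau' T.
Proof.
move=> h nT e e0; have [s [iV ws bs]] := nT e e0; exists s; split=> //.
exact: le_trans h.
Qed.

Lemma nuc_fr V s : ins V s -> nuc V (wt s) (fr s).
Proof.
by move=> iV e e0; exists s; split=> // x _; rewrite subrr nm0 mulr_ge0 ?nm_ge0 // ltW.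
Qed.

Lemma nucD V tau1 tau2 T S : nuc V tau1 T -> nuc V tau2 S -> nuc V (tau1 + tau2) (fun x => T x + S x).
Proof.
move=> nT nS e e0; have e20 : 0 < e / 2 by lra.
have [s [iV ws bs]] := nT _ e20; have [t [iV' wt' bt]] := nS _ e20.
exists (s ++ t); split; [exact: ins_cat|by rewrite wt_cat lerD|].
move=> x vx; rewrite fr_cat opprD addrACA; apply: le_trans (nmD _ _) _.
by have := bs x vx; have := bt x vx; lra.
Qed.

Lemma nuc_map V L M tau T : subsp V -> 0 <= M -> (forall x, V x -> V (L x)) -> linear_on V L ->
  opb V L M -> (forall x, V x -> V (T x)) -> nuc V tau T -> nuc V (M * tau) (fun x => L (T x)).
Proof.
move=> sV M0 VL lL bL VT nT e e0.
have e' : 0 < e / (M + 1) by rewrite divr_gt0 //; lra.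
have [s [iV ws bs]] := nT _ e'; exists (mapfr L s); split.
- exact: ins_map iV.
- by apply: le_trans (wt_map bL iV) _; exact: ler_wpM2l.
move=> x vx; have Vf : V (fr s x) by exact: fr_in.
have VTx := VT _ vx.
rewrite (fr_map _ _ sV lL iV) -(linB sV lL) //.
apply: le_trans (bL _ (subB sV VTx Vf)) _.
apply: le_trans (ler_wpM2l M0 (bs x vx)) _.
rewrite mulrA; apply: ler_wpM2r; first exact: nm_ge0.
rewrite mulrCA; apply: ler_piMr; first exact: ltW.
by rewrite ler_pdivrMr; lra.
Qed.

Lemma nucZ V a tau T : subsp V -> (forall x, V x -> V (T x)) -> nuc V tau T ->
  nuc V (normc a * tau) (fun x => a *: T x).
Proof.
move=> sV VT; apply: (nuc_map (L := fun x => a *: x)) => //; first exact: normc_ge0.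
- by move=> x vx; exact: subZ.
- by move=> c x y _ _; rewrite scalerDr !scalerA mulrC.
- by move=> x _; rewrite nmZ.
Qed.

Lemma nucN V tau T : subsp V -> (forall x, V x -> V (T x)) -> nuc V tau T ->
  nuc V tau (fun x => - T x).
Proof.
move=> sV VT nT; have := nucZ (-1) sV VT nT; rewrite normcN1 mul1r.
by apply: nuc_ext => x _; rewrite scaleN1r.
Qed.

Lemma nuc_opb V tau T : nuc V tau T -> opb V T tau.
Proof.
move=> nT x vx; apply: (ler_epsM (nm_ge0 x)) => e e0.
have [s [iV ws bs]] := nT e e0; rewrite -[T x](subrK (fr s x)).
apply: le_trans (nmD _ _) _; have := bs x vx; have := nm_fr Hdot s x.
have := ler_wpM2r (nm_ge0 x) ws; lra.
Qed.

Lemma nuc_ge0 V tau T : nuc V tau T -> 0 <= tau.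
Proof. by move=> /(_ 1 ltr01)[s [_ ws _]]; apply: le_trans ws; exact: wt_ge0. Qed.

Lemma nuc0 V : nuc V 0 (fun=> 0).
Proof.
move=> e e0; exists [::]; split=> //; first by rewrite /wt big_nil.
by move=> x _; rewrite /rank_one_sum big_nil subrr nm0 mulr_ge0 ?nm_ge0 // ltW.
Qed.

Lemma lopD V T S : subsp V -> lop V T -> lop V S -> lop V (fun x => T x + S x).
Proof.
move=> sV [VT lT [M M0 bT]] [VS lS [N N0 bS]]; split.
- by move=> x vx; apply: (subD sV); auto.
- by move=> a x y vx vy; rewrite lT // lS // addrACA scalerDr.
exists (M + N); first exact: addr_ge0.
move=> x vx; apply: le_trans (nmD _ _) _; rewrite mulrDl.
by apply: lerD; auto.
Qed.

Lemma lop_comp V T S : lop V T -> lop V S -> lop V (fun x => T (S x)).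
Proof.
move=> [VT lT [M M0 bT]] [VS lS [N N0 bS]]; split.
- by move=> x vx; auto.
- by move=> a x y vx vy; rewrite lS // lT //; auto.
exists (M * N); first exact: mulr_ge0.
move=> x vx; apply: le_trans (bT _ _) _; first by auto.
by rewrite -mulrA; apply: ler_wpM2l => //; exact: bS.
Qed.

Lemma lopZ V a T : subsp V -> lop V T -> lop V (fun x => a *: T x).
Proof.
move=> sV hT; apply: (@lop_comp V (fun x => a *: x) T) => //; split.
- by move=> x vx; exact: subZ.
- by move=> c x y _ _; rewrite scalerDr !scalerA mulrC.
- by exists (normc a); [exact: normc_ge0|move=> x _; rewrite nmZ].
Qed.

Lemma lop_ext V T S : subsp V -> (forall x, V x -> T x = S x) -> lop V T -> lop V S.
Proof.
move=> sV h [VT lT [M M0 bT]]; split.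
- by move=> x vx; rewrite -h //; exact: VT.
- by move=> a x y vx vy; rewrite -!h //; [exact: lT|exact: sV.2].
- by exists M => // x vx; rewrite -h //; exact: bT.
Qed.

Lemma lopN V T : subsp V -> lop V T -> lop V (fun x => - T x).
Proof.
by move=> sV /(lopZ (-1) sV); apply: lop_ext => // x _; rewrite scaleN1r.
Qed.

Lemma lopB V T S : subsp V -> lop V T -> lop V S -> lop V (fun x => T x - S x).
Proof. by move=> sV hT hS; apply: (lopD sV hT); exact: lopN. Qed.

Lemma is_inv_lop V X G M : is_inv V X G M -> lop V G.
Proof.
move=> [VG lG bG _ _]; split=> //; exists (Num.max M 0); first by rewrite le_max lexx orbT.
move=> x vx; apply: le_trans (bG _ vx) _; apply: ler_wpM2r; first exact: nm_ge0.
by rewrite le_max lexx.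
Qed.

Lemma nucl_opapprox V T : nucl V T -> opapprox dot V T.
Proof.
by move=> [_ h] e e0; have [s iV ns] := h e e0; exists s => //; exact: nuc_opb.
Qed.

Lemma nucl_nuc V T : subsp V -> nucl V T -> exists tau, nuc V tau T.
Proof.
move=> sV [_ h]; have [s iV ns] := h 1 ltr01; exists (1 + wt s).
by have := nucD ns (nuc_fr iV); apply: nuc_ext => x _; rewrite subrK.
Qed.

Lemma nucl_fr V s : subsp V -> ins V s -> nucl V (fr s).
Proof.
move=> sV iV; split; first exact: fr_lop.
move=> e e0; exists s => //; apply: nuc_le (ltW e0) _.
by apply: nuc_ext (nuc0 V) => x _; rewrite subrr.
Qed.

Lemma nucl_ext V T S : subsp V -> (forall x, V x -> T x = S x) -> nucl V T -> nucl V S.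
Proof.
move=> sV h [hl hT]; split; first exact: lop_ext hl.
move=> e e0; have [s iV ns] := hT e e0; exists s => //.
by apply: nuc_ext ns => x vx; rewrite h.
Qed.

Lemma nuclD V T S : subsp V -> nucl V T -> nucl V S -> nucl V (fun x => T x + S x).
Proof.
move=> sV [lT hT] [lS hS]; split; first exact: lopD.
move=> e e0; have e20 : 0 < e / 2 by lra.
have [s iV ns] := hT _ e20; have [t iV' nt] := hS _ e20.
exists (s ++ t); first exact: ins_cat.
have := nucD ns nt; rewrite -splitr; apply: nuc_ext => x _.
by rewrite fr_cat opprD addrACA.
Qed.

Lemma nucl_map V L T : subsp V -> lop V L -> nucl V T -> nucl V (fun x => L (T x)).
Proof.
move=> sV hL [hl hT]; split; first exact: lop_comp.
have [VL lL [M M0 bL]] := hL; have [VT lT _] := hl.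
move=> e e0; have e' : 0 < e / (M + 1) by rewrite divr_gt0 //; lra.
have [s iV ns] := hT _ e'; exists (mapfr L s); first exact: ins_map iV.
have Vf x : V (fr s x) by exact: fr_in.
have VTs x : V x -> V (T x - fr s x) by move=> vx; apply: (subB sV); auto.
have h : M * (e / (M + 1)) <= e.
  rewrite mulrCA; apply: ler_piMr; first exact: ltW.
  by rewrite ler_pdivrMr; lra.
apply: nuc_le h _; apply: nuc_ext (nuc_map sV M0 VL lL bL VTs ns) => x vx.
by rewrite (fr_map _ _ sV lL iV) -(linB sV lL); auto.
Qed.

Lemma nuclN V T : subsp V -> nucl V T -> nucl V (fun x => - T x).
Proof.
move=> sV hT; have hid : lop V (fun x : H => - x).
  split; first by move=> x vx; exact: subN.
    by move=> a x y _ _; rewrite opprD scalerN.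
  by exists 1 => // x _; rewrite nmN mul1r.
exact: (nucl_map sV hid hT).
Qed.

Lemma nuclB V T S : subsp V -> nucl V T -> nucl V S -> nucl V (fun x => T x - S x).
Proof. by move=> sV hT hS; apply: (nuclD sV hT); exact: nuclN. Qed.

End NuclearOperators.

(** * Determinants of rank-one sums and their nuclear estimates *)

Section FredholmDeterminant.
Variables (R : realType) (H : completeNormedModType R[i]).
Variable dot : {dot H for conjC}.
Hypothesis Hdot : dot_induces_norm dot.
Local Notation C := R[i].
Local Notation normc := (@Normc.normc R).
Local Notation fr := (rank_one_sum dot).
Local Notation nuc := (nuc dot).
Local Notation nucl := (nucl dot).
Implicit Types (x y z : H) (V W : set H) (T S X G K : H -> H) (s t : seq (H * H)).

(** The [fdet] of the functionals [dot _ p.1] and the vectors [p.2]. It does not mention [V]: one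
    list has the same determinant in every subspace containing its second components. *)
Definition dfr s : C :=
  \det (1%:M - \matrix_(i, j) dot (tnth (in_tuple s) j).2 (tnth (in_tuple s) i).1).

Lemma dfrP V s : subsp V -> ins V s -> detval V (fr s) (dfr s).
Proof.
move=> sV iV.
exists (size s), (fun i x => dot x (tnth (in_tuple s) i).1), (fun i => (tnth (in_tuple s) i).2).
split=> //; split.
- by move=> i a x y _ _; rewrite dotDl dotZl.
- by move=> i; apply: iV; rewrite mem_tnth.
- by move=> x _; exact: big_frE.
Qed.

Lemma dfrE V s d : subsp V -> ins V s -> detval V (fr s) d -> dfr s = d.
Proof. by move=> sV iV; exact: (detval_unique sV (dfrP sV iV)). Qed.

Lemma dfr_mul V s t u : subsp V -> ins V s -> ins V t -> ins V u ->
  (forall x, V x -> fr u x = fr s x + fr t x - fr s (fr t x)) -> dfr u = dfr s * dfr t.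
Proof.
move=> sV iV iV' iV'' h; apply: (dfrE sV iV'').
apply: detval_ext (detval_mul sV (dfrP sV iV) (dfrP sV iV')) => x vx.
by rewrite h.
Qed.

Lemma dfr_nil : dfr [::] = 1.
Proof. by rewrite /dfr det_mx00. Qed.

Lemma dfr1 p : dfr [:: p] = 1 - dot p.2 p.1.
Proof. by rewrite /dfr det_mx11 !mxE. Qed.

(** This writes the determinant of [1 - G fr s] as one of fixed size [size s] in which [G] enters
    only through the entries, so that [det_lip] applies when [G] varies. *)
Lemma dfr_mapfr V G s : subsp V -> linear_on V G -> (forall x, V x -> V (G x)) -> ins V s ->
  dfr (mapfr G s) =
  \det (1%:M - \matrix_(i, j) dot (G (tnth (in_tuple s) j).2) (tnth (in_tuple s) i).1).
Proof.
move=> sV lG VG iV; apply: (dfrE sV (ins_map VG iV)).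
exists (size s), (fun i x => dot x (tnth (in_tuple s) i).1), (fun i => G (tnth (in_tuple s) i).2).
split=> //; split.
- by move=> i a x y _ _; rewrite dotDl dotZl.
- by move=> i; apply: VG; apply: iV; rewrite mem_tnth.
- move=> x vx; rewrite (fr_map _ _ sV lG iV) big_frE (lin_sum sV lG); last first.
    by move=> i _ _; apply: subZ => //; apply: iV; rewrite mem_tnth.
  by apply: eq_bigr => i _; rewrite (linZ sV lG) //; apply: iV; rewrite mem_tnth.
Qed.

Lemma linear_on_fr V s : linear_on V (fr s).
Proof. by move=> a x y _ _; exact: fr_linear. Qed.

Lemma fr_inverse V s (tau : R) : csubsp V -> ins V s -> opb V (fr s) tau -> tau <= 1 / 2 ->
  exists G, is_inv V (fr s) G 2.
Proof.
move=> cV iV bs ht; apply: neumann => //.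
- by move=> x _; exact: fr_in cV.1 iV.
- exact: linear_on_fr.
- by move=> x vx; apply: le_trans (bs x vx) _; apply: ler_wpM2r => //; exact: nm_ge0.
Qed.

(* One rank-one factor at a time: [1 - (S + b (x) a) = (1 - S)(1 - ((1 - S)^-1 b) (x) a)]. *)
Lemma dfr_small V s : csubsp V -> ins V s -> wt s <= 1 / 4 -> normc (dfr s - 1) <= 4 * wt s.
Proof.
move=> cV; elim: s => [|p s ih] iV ws.
  by rewrite dfr_nil subrr normc0 /wt big_nil mulr0.
have sV := cV.1.
have wE : wt (p :: s) = nm p.1 * nm p.2 + wt s by rewrite /wt big_cons.
have p0 : 0 <= nm p.1 * nm p.2 by rewrite mulr_ge0 ?nm_ge0.
have s0 := wt_ge0 s.
have iVs : ins V s by move=> q qs; apply: iV; rewrite inE qs orbT.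
have Vp : V p.2 by apply: iV; rewrite mem_head.
have hs : normc (dfr s - 1) <= 4 * wt s by apply: ih => //; move: ws; rewrite wE; lra.
have [||G [VG lG bG GE EG]] := fr_inverse (tau := wt s) cV iVs.
- by move=> x _; exact: nm_fr.
- by move: ws; rewrite wE; lra.
have iq : ins V [:: (p.1, G p.2)] by move=> q; rewrite inE => /eqP -> /=; exact: VG.
rewrite (dfr_mul sV iVs iq iV); last first.
  move=> x vx; rewrite /rank_one_sum big_cons big_seq1 /= -/(fr s x) -/(fr s (dot x p.1 *: G p.2)).
  rewrite (linZ sV (@linear_on_fr V s)); last exact: VG.
  by rewrite -addrA -scalerBr EG // addrC.
rewrite dfr1 /=.
have hd : normc (dot (G p.2) p.1) <= 2 * (nm p.1 * nm p.2).
  apply: le_trans (CS Hdot _ _) _; rewrite mulrC mulrCA.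
  by apply: ler_wpM2l; [exact: nm_ge0|exact: bG].
have d2 : normc (dfr s) <= 1 + 4 * wt s.
  by rewrite -[dfr s](subrK 1) addrC; apply: le_trans (normcD _ _) _; rewrite normc1 lerD2l.
have -> : dfr s * (1 - dot (G p.2) p.1) - 1 = (dfr s - 1) - dfr s * dot (G p.2) p.1 by ring.
apply: le_trans (normcB _ _) _; rewrite normcM.
have := ler_pM (normc_ge0 _) (normc_ge0 _) d2 hd.
(* With [a] the weight of the new pair and [b] that of the others, the bound is
   [4 b + (1 + 4 b) 2 a]. It is at most [4 (a + b)] because [b <= 1/4]. *)
move: ws hs; rewrite wE; move: (nm p.1 * nm p.2) p0 (wt s) s0 => a a0 b b0 h1 h2 h3.
have : a * b <= a / 4 by apply: ler_wpM2l => //; lra.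
lra.
Qed.

Lemma dfr_basis V W n (e e' : 'I_n -> H) s : subsp V -> W `<=` V -> is_basis W e ->
  (forall i j, dot (e j) (e' i) = (i == j)%:R) -> ins V s -> (forall x, V x -> W (fr s x)) ->
  dfr s = \det (\matrix_(i, j) ((i == j)%:R - dot (fr s (e j)) (e' i))).
Proof.
move=> sV WV be he iV hW; apply: (dfrE sV iV).
apply: (basis_detval sV WV (@linear_on_fr V s) hW be) => j.
under eq_bigr do rewrite mxE scalerBl.
rewrite sumrB -(dual_basisE be he); last by apply: hW; apply: WV; exact: basis_in be.
by rewrite (bigD1 j) //= eqxx scale1r big1 ?addr0 // => k /negbTE ->; rewrite scale0r.
Qed.

(* Compressing an approximant of [fr s] to the range of [fr s] does not increase its weight. *)
Lemma dfr_nuc V s tau : csubsp V -> ins V s -> nuc V tau (fr s) -> tau <= 1 / 4 ->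
  normc (dfr s - 1) <= 4 * tau.
Proof.
move=> cV iV ns ht; have sV := cV.1.
pose b (i : 'I_(size s)) := (tnth (in_tuple s) i).2.
have [n [e be]] := span_basis b.
move: be; set W := range _ => be.
have sW : subsp W by exact: range_lin_comb_subsp.
have cW := findim_csubsp Hdot be.
have WV : W `<=` V.
  move=> _ [c _ <-]; apply: sub_sum => // i _ _; apply: subZ => //.
  by apply: iV; rewrite mem_tnth.
have hW x : W (fr s x).
  exists (\row_i dot x (tnth (in_tuple s) i).1) => //.
  by rewrite big_frE; apply: eq_bigr => i _; rewrite mxE.
have [e' [we' he']] := dual_basis Hdot be.
pose N := \sum_i \sum_j nm (e j) * nm (e' i).
have nn i j : 0 <= nm (e j) * nm (e' i) by rewrite mulr_ge0 ?nm_ge0.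
have hN i j : nm (e j) * nm (e' i) <= N.
  rewrite /N (bigD1 i) //= (bigD1 j) //= -addrA lerDl addr_ge0 //.
    by apply: sumr_ge0 => *.
  by apply: sumr_ge0 => k _; apply: sumr_ge0 => *.
have N0 : 0 <= N by apply: sumr_ge0 => i _; apply: sumr_ge0 => j _.
have t0 := nuc_ge0 ns.
have w0 := wt_ge0 s.
(* The dimension [n], the sum [N] and the bound on the entries do not involve the accuracy of the
   approximant, so [K] is fixed before [eps] is chosen. *)
have [K K0 hK] := det_lip n (1 + (wt s + tau) * N).
apply: (ler_epsM (mulr_ge0 K0 N0)) => eps eps0.
have [t [iVt wtt bt]] := ns eps eps0.
pose t' := mapfr (proj dot W) t.
have Vproj x : W (proj dot W x) by exact: proj_in.
have lproj U : linear_on U (proj dot W) by move=> a x y _ _; exact: proj_linear.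
have iWt : ins W t' by apply: (@ins_map _ _ setT) => //.
have iVt' : ins V t' by move=> p /iWt /WV.
have wt' : wt t' <= tau.
  apply: le_trans wtt; rewrite -[leRHS]mul1r.
  by apply: (wt_map (V := setT)) => // x _; rewrite mul1r; exact: nm_proj.
have frt' x : fr t' x = proj dot W (fr t x) by exact: (fr_map dot (V := setT) x).
have h1 : normc (dfr t' - 1) <= 4 * tau.
  apply: le_trans (dfr_small cV iVt' _) _; first exact: le_trans ht.
  by rewrite ler_pM2l.
have ent (q : seq (H * H)) i j : wt q <= wt s + tau ->
    normc ((i == j)%:R - dot (fr q (e j)) (e' i)) <= 1 + (wt s + tau) * N.
  move=> hq; apply: le_trans (normcB _ _) _; apply: lerD.
    by case: (i == j); rewrite ?mulr1n ?mulr0n ?normc1 ?normc0 ?ler01.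
  apply: le_trans (CS Hdot _ _) _.
  apply: le_trans (ler_wpM2r (nm_ge0 _) (nm_fr Hdot _ _)) _; rewrite -mulrA.
  by apply: ler_pM; rewrite ?wt_ge0.
have h2 : normc (dfr s - dfr t') <= K * (N * eps).
  rewrite (dfr_basis sV WV be he' iV) // (dfr_basis sV WV be he' iVt'); last first.
    by move=> x _; exact: fr_in.
  apply: hK => [|i j|i j|i j]; rewrite ?mulr_ge0 ?(ltW eps0) // !mxE.
  - by apply: ent; rewrite lerDl.
  - by apply: ent; apply: le_trans wt' _; rewrite lerDr.
  have -> : forall a b c : C, a - b - (a - c) = c - b by move=> *; ring.
  rewrite -dotBl; apply: le_trans (CS Hdot _ _) _.
  have bb : nm (fr t' (e j) - fr s (e j)) <= eps * nm (e j).
    have vej : V (e j) by apply: WV; exact: basis_in be.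
    apply: le_trans (bt _ vej); rewrite nmBC frt' -[fr s (e j) in leLHS](proj_id Hdot cW) //.
    by rewrite -(linB (@subspT R H) (lproj setT)) //; exact: nm_proj.
  apply: le_trans (ler_wpM2r (nm_ge0 _) bb) _; rewrite -mulrA mulrC.
  by apply: ler_wpM2r => //; exact: ltW.
have -> : dfr s - 1 = (dfr t' - 1) + (dfr s - dfr t') by ring.
by apply: le_trans (normcD _ _) _; apply: lerD; rewrite // -mulrA.
Qed.

Definition frN s := mapfr -%R s.

Lemma frNE s x : fr (frN s) x = - fr s x.
Proof.
rewrite (fr_map dot (V := setT) x) // => a y z _ _.
by rewrite opprD scalerN.
Qed.

Lemma ins_frN V s : subsp V -> ins V s -> ins V (frN s).
Proof. by move=> sV; apply: ins_map => x; exact: subN. Qed.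

Lemma nucB V tau1 tau2 T S : subsp V -> (forall x, V x -> V (S x)) ->
  nuc V tau1 T -> nuc V tau2 S -> nuc V (tau1 + tau2) (fun x => T x - S x).
Proof. by move=> sV VS nT nS; apply: nucD => //; exact: nucN. Qed.

(** The resolvent identity [G - G' = G (fr s - fr t) G']; the 4 is the product of the two bounds
    2. *)
Lemma inv_close V s t G G' (eta : R) x : csubsp V -> ins V s -> ins V t ->
  is_inv V (fr s) G 2 -> is_inv V (fr t) G' 2 -> 0 <= eta ->
  opb V (fun x => fr s x - fr t x) eta -> V x -> nm (G x - G' x) <= 4 * eta * nm x.
Proof.
move=> cV iV iV' [VG lG bG GE EG] [VG' lG' bG' GE' EG'] e0 be vx; have sV := cV.1.
have vg := VG _ vx; have vg' := VG' _ vx.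
have -> : G x - G' x = G (fr s (G' x) - fr t (G' x)).
  have vd : V (G x - G' x) by exact: subB.
  rewrite -[LHS]GE // (linB sV (@linear_on_fr V s)) //; congr (G _).
  have -> : G x - G' x - (fr s (G x) - fr s (G' x)) = (G x - fr s (G x)) - (G' x - fr s (G' x)).
    by rewrite !opprD !opprK addrACA.
  by rewrite EG // -{1}(EG' x vx) opprD opprK addrACA subrr add0r addrC.
apply: le_trans (bG _ _) _; first by apply: subB => //; exact: fr_in.
have := ler_wpM2l e0 (bG' _ vx); have := be _ vg'; lra.
Qed.

End FredholmDeterminant.

(** * Extension of the determinant to nuclear operators, and its multiplicativity *)

Section FredholmDeterminantExistence.
Variables (R : realType) (H : completeNormedModType R[i]).
Variable dot : {dot H for conjC}.
Hypothesis Hdot : dot_induces_norm dot.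
Local Notation C := R[i].
Local Notation normc := (@Normc.normc R).
Local Notation fr := (rank_one_sum dot).
Local Notation nuc := (nuc dot).
Local Notation nucl := (nucl dot).
Local Notation dfr := (dfr dot).
Implicit Types (x y z : H) (V W : set H) (T S X G K : H -> H) (s t : seq (H * H)).

Lemma dfr_le2 V s : csubsp V -> ins V s -> nuc V (1 / 4) (fr s) -> normc (dfr s) <= 2.
Proof.
move=> cV iV ns; have := dfr_nuc Hdot cV iV ns (lexx _).
rewrite -{2}[dfr s](subrK 1) => h; apply: le_trans (normcD _ _) _; rewrite normc1; lra.
Qed.

(** [1 - fr t = (1 - fr s)(1 - G (fr t - fr s))] with [G = (1 - fr s)^-1]. The second factor has
    nuclear bound [2 eta <= 1/4], whence [dfr_nuc] and the constant [16 = 2 * 4 * 2]. *)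
Lemma dfr_near V s t (eta : R) : csubsp V -> ins V s -> ins V t -> nuc V (1 / 4) (fr s) ->
  nuc V eta (fun x => fr t x - fr s x) -> eta <= 1 / 8 ->
  normc (dfr t - dfr s) <= 16 * eta.
Proof.
move=> cV iV iV' ns nd he; have sV := cV.1.
have [|G hG] := fr_inverse cV iV (nuc_opb Hdot ns); first by lra.
have [VG lG bG GE EG] := hG.
pose u := mapfr G (t ++ frN s).
have iu0 : ins V (t ++ frN s) by apply: ins_cat => //; exact: ins_frN.
have iu : ins V u by apply: ins_map iu0.
have fru x : fr u x = G (fr t x - fr s x).
  by rewrite (fr_map dot x sV lG iu0) fr_cat frNE.
have Vd x : V (fr t x - fr s x) by apply: subB => //; exact: fr_in.
have -> : dfr t = dfr s * dfr u.
  apply: (dfr_mul sV iV iu iV') => x vx.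
  by rewrite fru -addrA EG // addrC subrK.
have nu : nuc V (2 * eta) (fr u).
  have := nuc_map sV (ler0n _ 2) VG lG bG (fun x _ => Vd x) nd.
  by apply: nuc_ext => x vx; rewrite fru.
have h1 := dfr_le2 cV iV ns.
have h2 : normc (dfr u - 1) <= 4 * (2 * eta).
  by apply: (dfr_nuc Hdot cV iu nu); lra.
have -> : dfr s * dfr u - dfr s = dfr s * (dfr u - 1) by ring.
rewrite normcM; have := ler_pM (normc_ge0 _) (normc_ge0 _) h1 h2; lra.
Qed.

(* [1 - fr s = (1 - E)(1 - (1 - E)^-1 (fr s0))] with [E = fr s - fr s0] small: the second
   factor has a determinant of the fixed size [size s0]. *)
Lemma dfr_local_lip V s0 : csubsp V -> ins V s0 -> exists2 K : R, 0 <= K &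
  forall s t eta, ins V s -> ins V t -> eta <= 1 / 8 ->
  nuc V (1 / 4) (fun x => fr s x - fr s0 x) -> nuc V (1 / 4) (fun x => fr t x - fr s0 x) ->
  nuc V eta (fun x => fr t x - fr s x) -> normc (dfr t - dfr s) <= K * eta.
Proof.
move=> cV iV0; have sV := cV.1.
pose a i := (tnth (in_tuple s0) i).1; pose b i := (tnth (in_tuple s0) i).2.
have Vb i : V (b i) by apply: iV0; rewrite mem_tnth.
pose N := \sum_i \sum_j nm (b j) * nm (a i).
have nn i j : 0 <= nm (b j) * nm (a i) by rewrite mulr_ge0 ?nm_ge0.
have hN i j : nm (b j) * nm (a i) <= N.
  rewrite /N (bigD1 i) //= (bigD1 j) //= -addrA lerDl addr_ge0 //.
    by apply: sumr_ge0 => *.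
  by apply: sumr_ge0 => k _; apply: sumr_ge0 => *.
have N0 : 0 <= N by apply: sumr_ge0 => i _; apply: sumr_ge0 => j _.
have [K K0 hK] := det_lip (size s0) (1 + 2 * N).
(* Bounds [D G] by comparing its matrix with the identity matrix, of determinant 1. *)
pose B := 2 + K * (1 + 2 * N).
have B0 : 0 <= B by rewrite /B addr_ge0 // mulr_ge0 //; lra.
pose D G := \det (1%:M - \matrix_(i, j) dot (G (b j)) (a i)).
have ent G i j : opb V G 2 -> normc ((1%:M - \matrix_(i, j) dot (G (b j)) (a i)) i j) <= 1 + 2 * N.
  move=> bG; rewrite !mxE; apply: le_trans (normcB _ _) _; apply: lerD.
    by case: (i == j); rewrite ?mulr1n ?mulr0n ?normc1 ?normc0 ?ler01.
  apply: le_trans (CS Hdot _ _) _.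
  apply: le_trans (ler_wpM2r (nm_ge0 _) (bG _ (Vb _))) _; rewrite -mulrA.
  by rewrite ler_pM2l.
have bD G : opb V G 2 -> normc (D G) <= B.
  move=> bG; have h : normc (D G - \det (1%:M : 'M[C]_(size s0))) <= K * (1 + 2 * N).
    have : 0 <= 1 + 2 * N by lra.
    move=> /hK; apply=> i j; first exact: ent.
      rewrite mxE; case: (i == j); rewrite ?mulr1n ?mulr0n ?normc1 ?normc0; lra.
    rewrite mxE addrAC subrr add0r mxE normcN mxE; apply: le_trans (CS Hdot _ _) _.
    apply: le_trans (ler_wpM2r (nm_ge0 _) (bG _ (Vb _))) _; rewrite -mulrA.
    have := hN i j; lra.
  rewrite -[D G](subrK (\det (1%:M : 'M[C]_(size s0)))).
  by apply: le_trans (normcD _ _) _; rewrite det1 normc1 /B; move: h; rewrite det1; lra.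
have red s : ins V s -> nuc V (1 / 4) (fun x => fr s x - fr s0 x) ->
    exists G, [/\ is_inv V (fr (s ++ frN s0)) G 2, ins V (s ++ frN s0) &
      dfr s = dfr (s ++ frN s0) * D G].
  move=> iV ns.
  have iu : ins V (s ++ frN s0) by apply: ins_cat => //; exact: ins_frN.
  have nu : nuc V (1 / 4) (fr (s ++ frN s0)).
    by apply: nuc_ext ns => x _; rewrite fr_cat frNE.
  have [|G hG] := fr_inverse cV iu (nuc_opb Hdot nu); first by lra.
  have [VG lG bG GE EG] := hG.
  exists G; split=> //.
  have -> : D G = dfr (mapfr G s0) by rewrite (dfr_mapfr dot sV lG VG iV0).
  apply: (dfr_mul sV iu (ins_map VG iV0) iV) => x vx.
  rewrite (fr_map dot x sV lG iV0) -addrA EG; last exact: fr_in.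
  by rewrite fr_cat frNE subrK.
(* The first summand accounts for the change of the factor near 1 ([dfr_near]), the second for the
   change of [D G] ([inv_close]). *)
exists (16 * B + 2 * (K * (4 * N))); first by rewrite addr_ge0 ?mulr_ge0.
move=> s t eta iV iV' he ns nt nd; have e0 := nuc_ge0 nd.
have [G [hG iu ->]] := red s iV ns; have [G' [hG' iu' ->]] := red t iV' nt.
have bG : opb V G 2 by case: hG.
have bG' : opb V G' 2 by case: hG'.
have nu : nuc V (1 / 4) (fr (s ++ frN s0)).
  by apply: nuc_ext ns => x _; rewrite fr_cat frNE.
have nd' : nuc V eta (fun x => fr (t ++ frN s0) x - fr (s ++ frN s0) x).
  by apply: nuc_ext nd => x _; rewrite !fr_cat opprD addrACA subrr addr0.
have h1 := dfr_near cV iu iu' nu nd' he.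
have h2 := dfr_le2 cV iu nu.
have h3 : normc (D G' - D G) <= K * (4 * eta * N).
  have : 0 <= 4 * eta * N by rewrite !mulr_ge0.
  move=> /hK; apply=> i j; [exact: ent|exact: ent|].
  rewrite !mxE; have -> : forall a b c : C, a - b - (a - c) = c - b by move=> *; ring.
  rewrite -dotBl; apply: le_trans (CS Hdot _ _) _.
  have hc : nm (G (b j) - G' (b j)) <= 4 * eta * nm (b j).
    apply: (inv_close cV iu iu' hG hG' e0 _ (Vb j)) => x vx.
    by rewrite nmBC; exact: (nuc_opb Hdot nd').
  apply: le_trans (ler_wpM2r (nm_ge0 _) hc) _.
  have e40 : 0 <= 4 * eta by rewrite mulr_ge0.
  rewrite -[leLHS]mulrA. exact: (ler_wpM2l e40 (hN i j)).
have h4 := bD _ bG'.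
move: (dfr (t ++ frN s0)) (dfr (s ++ frN s0)) (D G) (D G') h1 h2 h3 h4 => d' d q q' h1 h2 h3 h4.
have -> : d' * q' - d * q = (d' - d) * q' + d * (q' - q) by ring.
apply: le_trans (normcD _ _) _; rewrite !normcM.
have := ler_pM (normc_ge0 _) (normc_ge0 _) h1 h4.
have := ler_pM (normc_ge0 _) (normc_ge0 _) h2 h3.
lra.
Qed.

Lemma complex_complete (u : nat -> C) :
  (forall e : R, 0 < e -> exists N, forall n m, (N <= n)%N -> (N <= m)%N -> normc (u n - u m) <= e) ->
  exists l, forall e : R, 0 < e -> exists N, forall n, (N <= n)%N -> normc (u n - l) <= e.
Proof.
move=> h.
have real (v : nat -> R) : (forall n m, `|v n - v m| <= normc (u n - u m)) ->
    exists l, forall e : R, 0 < e -> exists N, forall n, (N <= n)%N -> `|v n - l| <= e.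
  move=> hv; have cu : cauchy (v @ \oo).
    apply/cauchy_ballP => e e0; near_simpl.
    have e20 : 0 < e / 2 by lra.
    have [N hN] := h _ e20.
    exists ([set n | (N <= n)%N], [set n | (N <= n)%N]) => /=; first by split; exists N.
    move=> [n m] /= [Nn Nm]; rewrite -ball_normE /ball_ /=.
    by apply: le_lt_trans (hv _ _) _; apply: le_lt_trans (hN _ _ Nn Nm) _; lra.
  have /cvg_ex[l hl] : cvg (v @ \oo) by apply: cauchy_cvg.
  exists l => e e0; move/cvgrPdist_le: hl => /(_ e e0)[N _ hN]; exists N => n Nn.
  by have := hN n Nn; rewrite distrC.
have Im_le a : `|complex.Im a| <= normc a.
  have := normc_ge_Re ('i%C * a); rewrite normcM; case: a => x y /=.
  by rewrite !expr0n expr1n add0r sqrtr1 !mul0r !mul1r sub0r normrN.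
have [|l hl] := real (fun n => complex.Re (u n)).
  by move=> n m; rewrite -ReB normc_ge_Re.
have [|l' hl'] := real (fun n => complex.Im (u n)).
  move=> n m; have := Im_le (u n - u m).
  by case: (u n) (u m) => [? ?] [? ?].
exists (l +i* l') => e e0; have e20 : 0 < e / 2 by lra.
have [N hN] := hl _ e20; have [N' hN'] := hl' _ e20.
exists (maxn N N') => n; rewrite geq_max => /andP[/hN h1 /hN' h2].
have -> : u n - (l +i* l') =
    (complex.Re (u n) - l)%:C + 'i%C * (complex.Im (u n) - l')%:C.
  by case: (u n) => x y; congr (_ +i* _); rewrite /=; lra.
apply: le_trans (normcD _ _) _; rewrite normcM !normc_real.
have -> : normc 'i%C = 1 by rewrite /= expr0n expr1n add0r sqrtr1.
lra.
Unshelve. all: end_near.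
Qed.

(** [is_fredholm_det] with lists in place of finite-rank operators and [nuc] in place of the trace
    norm. *)
Definition isdet V T d := forall e : R, 0 < e -> exists2 delta : R, 0 < delta &
  forall s, ins V s -> nuc V delta (fun x => T x - fr s x) -> normc (dfr s - d) <= e.

Lemma nuc_diff V T s t tau1 tau2 : subsp V -> (forall x, V x -> V (T x)) -> ins V s -> ins V t ->
  nuc V tau1 (fun x => T x - fr s x) -> nuc V tau2 (fun x => T x - fr t x) ->
  nuc V (tau1 + tau2) (fun x => fr t x - fr s x).
Proof.
move=> sV VT iV iV' ns nt.
have Vd x : V x -> V (T x - fr t x).
  by move=> vx; apply: (subB sV); [exact: VT|exact: fr_in].
apply: nuc_ext (nucB sV Vd ns nt) => x _.
by rewrite opprB addrC addrA subrK.
Qed.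

Lemma isdet_exists V T : csubsp V -> nucl V T -> exists d, isdet V T d.
Proof.
move=> cV [[VT _ _] hT]; have sV := cV.1.
have e0 : 0 < 1 / 8 :> R by lra.
have [s0 iV0 ns0] := hT _ e0.
have [K K0 hK] := dfr_local_lip cV iV0.
(* Approximants within 1/16 of [T] differ by at most 1/8 and lie within [1/8 + 1/16 <= 1/4] of [s0],
   as [dfr_local_lip] demands. *)
have q0 n : 0 < 1 / 16 * 2^-1 ^+ n :> R by rewrite mulr_gt0 ?exprn_gt0 //; lra.
have q1 n : 1 / 16 * 2^-1 ^+ n <= 1 / 16 :> R.
  by rewrite ler_piMr ?exprn_ile1 //; lra.
have near s t (d1 d2 : R) : ins V s -> ins V t -> d1 <= 1 / 16 -> d2 <= 1 / 16 ->
    nuc V d1 (fun x => T x - fr s x) -> nuc V d2 (fun x => T x - fr t x) ->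
    normc (dfr s - dfr t) <= K * (d1 + d2).
  move=> iV iV' h1 h2 ns nt; rewrite [d1 + d2]addrC; apply: hK => //.
  - lra.
  - by apply: nuc_le (nuc_diff sV VT iV0 iV' ns0 nt); lra.
  - by apply: nuc_le (nuc_diff sV VT iV0 iV ns0 ns); lra.
  - exact: (nuc_diff sV VT iV' iV nt ns).
have /choice[u hu] : forall n : nat, exists s, ins V s /\
    nuc V (1 / 16 * 2^-1 ^+ n) (fun x => T x - fr s x).
  by move=> n; have [s iV ns] := hT _ (q0 n); exists s.
have [e e1|d hd] := complex_complete (u := fun n => dfr (u n)).
  have [N hN] := half_pow_small (K * (1 / 8)) e1.
  exists N => n m Nn Nm; apply: le_trans (hN _ (leqnn N)).
  have [in_ nn_] := hu n; have [im_ nm_] := hu m.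
  have mono k : (N <= k)%N -> 1 / 16 * 2^-1 ^+ k <= 1 / 16 * 2^-1 ^+ N :> R.
    move=> Nk; apply: ler_wpM2l; first lra.
    by apply: ler_wiXn2l => //; lra.
  apply: le_trans (near _ _ _ _ in_ im_ (q1 _) (q1 _) nn_ nm_) _.
  have := ler_wpM2l K0 (lerD (mono _ Nn) (mono _ Nm)); lra.
exists d => e e1.
pose delta := Num.min (1 / 16) (e / (K + 1)).
have d0 : 0 < delta by rewrite lt_min; apply/andP; split; [lra|apply: divr_gt0 => //; lra].
have hKd : K * delta <= e.
  apply: (@le_trans _ _ (K * (e / (K + 1)))).
    by apply: ler_wpM2l => //; rewrite ge_min lexx orbT.
  rewrite mulrCA; apply: ler_piMr; first exact: ltW.
  by rewrite ler_pdivrMr; lra.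
exists delta => // s iV ns.
apply: ler_eps => e' e'0; apply: le_trans (lerD hKd (lexx _)).
have e'20 : 0 < e' / 2 by lra.
have [N hN] := hd _ e'20; have [N' hN'] := half_pow_small (K * (1 / 16)) e'20.
have {}hN := hN _ (leq_maxl N N'); have {}hN' := hN' _ (leq_maxr N N').
have [in_ nn_] := hu (maxn N N').
have d1 : delta <= 1 / 16 by rewrite ge_min lexx.
have h := near _ _ _ _ iV in_ d1 (q1 _) ns nn_.
rewrite -[dfr s](subrK (dfr (u (maxn N N')))) -addrA.
by apply: le_trans (normcD _ _) _; lra.
Qed.

Lemma isdet_limit V T d : isdet V T d -> nucl V T -> forall e delta : R, 0 < e -> 0 < delta ->
  exists s, [/\ ins V s, nuc V delta (fun x => T x - fr s x) & normc (dfr s - d) <= e].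
Proof.
move=> hd [_ hT] e delta e0 d0; have [de de0 hde] := hd e e0.
have m0 : 0 < Num.min delta de by rewrite lt_min d0.
have [s iV ns] := hT _ m0; exists s; split=> //.
- by apply: nuc_le ns; rewrite ge_min lexx.
- by apply: hde => //; apply: nuc_le ns; rewrite ge_min lexx orbT.
Qed.

Lemma normc_small (a : C) : (forall e : R, 0 < e -> normc a <= e) -> a = 0.
Proof.
move=> h; apply/eqP; rewrite -normc_eq0 eq_le normc_ge0 andbT.
by apply: ler_eps => e /h; rewrite add0r.
Qed.

Lemma isdet_ext V T S d : (forall x, V x -> T x = S x) -> isdet V T d -> isdet V S d.
Proof.
move=> h hd e e0; have [delta d0 hde] := hd e e0; exists delta => // s iV ns.
by apply: hde => //; apply: nuc_ext ns => x vx; rewrite h.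
Qed.

Lemma isdet_fr V s : csubsp V -> ins V s -> isdet V (fr s) (dfr s).
Proof.
move=> cV iV; have [d hd] := isdet_exists cV (nucl_fr Hdot cV.1 iV).
suff -> : dfr s = d by [].
apply/eqP; rewrite -subr_eq0; apply/eqP; apply: normc_small => e e0.
have [delta d0 hde] := hd e e0; apply: hde => //.
by apply: nuc_le (ltW d0) _; apply: nuc_ext (nuc0 dot V) => x _; rewrite subrr.
Qed.

Lemma isdet_small V T d tau : csubsp V -> (forall x, V x -> V (T x)) -> nucl V T ->
  isdet V T d -> nuc V tau T -> tau <= 1 / 8 ->
  normc (d - 1) <= 4 * tau.
Proof.
move=> cV VT hT hd nT ht; apply: (@ler_epsM _ _ _ 5) => // e e0.
have d0 : 0 < Num.min e (1 / 8) by rewrite lt_min e0 /=; lra.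
have [s [iV ns hs]] := isdet_limit hd hT e0 d0.
have nfs : nuc V (tau + Num.min e (1 / 8)) (fr s).
  have Vd x : V x -> V (T x - fr s x).
    by move=> vx; apply: (subB cV.1); [exact: VT|exact: fr_in cV.1 iV].
  apply: nuc_ext (nucB cV.1 Vd nT ns) => x _.
  by rewrite opprB addrC subrK.
have m1 : Num.min e (1 / 8) <= e by rewrite ge_min lexx.
have m2 : Num.min e (1 / 8) <= 1 / 8 by rewrite ge_min lexx orbT.
have h : normc (dfr s - 1) <= 4 * (tau + Num.min e (1 / 8)).
  by apply: (dfr_nuc Hdot cV iV nfs); lra.
rewrite -[d](subrK (dfr s)) -addrA; apply: le_trans (normcD _ _) _.
by rewrite normcBC; lra.
Qed.

(** For approximating lists [s] and [t], the list [u] represents [fr s + fr t - fr s fr t], so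
    [dfr u = dfr s * dfr t] exactly; [u] approximates [S + T - S T]. *)
Lemma isdet_mul V S T d1 d2 d : csubsp V -> nucl V S -> nucl V T ->
  isdet V S d1 -> isdet V T d2 -> isdet V (fun x => S x + T x - S (T x)) d -> d = d1 * d2.
Proof.
move=> cV hS hT hd1 hd2 hd; have sV := cV.1.
have [[VS lS [MS MS0 bS]] _] := hS; have [lopT _] := hT; have [VT lT _] := lopT.
have [tauT nT] := nucl_nuc sV hT; have t0 := nuc_ge0 nT.
apply/eqP; rewrite -subr_eq0; apply/eqP; apply: normc_small => e0 e00.
apply: (@ler_epsM _ _ _ (1 + (1 + normc d1 + normc d2))).
  by have := normc_ge0 d1; have := normc_ge0 d2; lra.
move=> e1 e10; rewrite -[X in _ <= X]addrC; apply: ler_wpDr; first exact: ltW.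
pose e := Num.min e1 1; have ep : 0 < e by rewrite lt_min e10 ltr01.
have ee1 : e <= e1 by rewrite ge_min lexx.
have e_1 : e <= 1 by rewrite ge_min lexx orbT.
have [delta dp hde] := hd _ ep.
(* The error of [u] is [2 eta + MS eta + eta (tauT + eta)], which [eta <= 1] bounds by
   [eta (3 + MS + tauT)]. *)
pose eta := Num.min 1 (delta / (3 + MS + tauT)).
have k0 : 0 < 3 + MS + tauT by lra.
have ep' : 0 < eta by rewrite lt_min ltr01 divr_gt0.
have eta1 : eta <= 1 by rewrite ge_min lexx.
have etad : eta * (3 + MS + tauT) <= delta.
  by rewrite -ler_pdivlMr // ge_min lexx orbT.
have [s [iVs ns hs]] := isdet_limit hd1 hS ep ep'.
have [t [iVt nt ht]] := isdet_limit hd2 hT ep ep'.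
have VSs x : V x -> V (S x - fr s x) by move=> vx; apply: (subB sV); auto; exact: fr_in.
have VTt x : V x -> V (T x - fr t x) by move=> vx; apply: (subB sV); auto; exact: fr_in.
have Vft x : V x -> V (fr t x) by move=> _; exact: fr_in.
pose u := (s ++ t) ++ frN (mapfr (fr s) t).
have Vfs x : V x -> V (fr s x) by move=> _; exact: fr_in.
have iVm : ins V (mapfr (fr s) t) by apply: ins_map iVt.
have iVu : ins V u by apply: ins_cat; [exact: ins_cat|exact: ins_frN].
have fru x : fr u x = fr s x + fr t x - fr s (fr t x).
  by rewrite !fr_cat frNE (fr_map dot x sV (linear_on_fr (V := V) dot s) iVt).
have ft : nuc V (tauT + eta) (fr t).
  apply: nuc_ext (nucB sV VTt nT nt) => x _.
  by rewrite opprB addrC subrK.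
have lSs : linear_on V (fun x => S x - fr s x).
  by move=> a x y vx vy; rewrite lS // fr_linear opprD addrACA scalerBr.
have n1 := nuc_map sV MS0 VS lS bS VTt nt.
have n2 := nuc_map sV (ltW ep') VSs lSs (nuc_opb Hdot ns) Vft ft.
have n12 := nucD n1 n2.
have V12 x : V x -> V (S (T x - fr t x) + (S (fr t x) - fr s (fr t x))).
  by move=> vx; apply: (subD sV); auto.
have nu := nucB sV V12 (nucD ns nt) n12.
have {}nu : nuc V delta (fun x => S x + T x - S (T x) - fr u x).
  apply: nuc_le (nuc_ext _ nu); last first.
    move=> x vx; rewrite fru (linB sV lS) //; [|exact: VT|exact: Vft].
    rewrite [S (T x) - _ + _]addrA subrK addrACA -opprD !opprB addrACA [RHS]addrACA.
    by rewrite [- S (T x) + _]addrC.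
  have : eta * eta <= eta by rewrite ler_piMr // ltW.
  lra.
have h := hde u iVu nu.
have hm : dfr u = dfr s * dfr t by apply: (dfr_mul sV iVs iVt iVu) => x _; rewrite fru.
have -> : d - d1 * d2 = - (dfr u - d) + (dfr s - d1) * (dfr t - d2) + (dfr s - d1) * d2
    + d1 * (dfr t - d2) by rewrite hm; ring.
apply: le_trans (normcD _ _) _; rewrite normcM.
apply: le_trans (lerD (le_trans (normcD _ _) (lerD (le_trans (normcD _ _) (lexx _)) (lexx _))) (lexx _)) _.
rewrite normcN !normcM.
have := ler_pM (normc_ge0 _) (normc_ge0 _) hs ht.
have := ler_wpM2r (normc_ge0 d2) hs; have := ler_wpM2l (normc_ge0 d1) ht.
have : e * e <= e by rewrite ler_piMr // ltW.
have := ler_wpM2r (normc_ge0 d2) ee1; have := ler_wpM2l (normc_ge0 d1) ee1.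
lra.
Qed.

End FredholmDeterminantExistence.

(** * The spectral theorem and the trace norm *)

Section SpectralTheorem.
Variables (R : realType) (H : completeNormedModType R[i]).
Variable dot : {dot H for conjC}.
Hypothesis Hdot : dot_induces_norm dot.
Local Notation C := R[i].
Local Notation normc := (@Normc.normc R).
Local Notation fr := (rank_one_sum dot).
Implicit Types (x y z e f : H) (V W B : set H) (T S X G K : H -> H) (s t : seq H).

Definition osys B := forall e f, B e -> B f -> dot e f = (e == f)%:R.
Definition sub_of B s := uniq s /\ forall e, e \in s -> B e.
Definition span_proj s x := \sum_(e <- s) dot x e *: e.
Local Notation pr := span_proj.

Lemma osysP B : {in B &, forall e f, dot e f = (e == f)%:R} <-> osys B.
Proof.
by split=> h e f; [move=> Be Bf; apply: h; rewrite inE|rewrite !inE; exact: h].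
Qed.

Lemma pr_linear s a x y : pr s (a *: x + y) = a *: pr s x + pr s y.
Proof.
rewrite /pr scaler_sumr -big_split /=; apply: eq_bigr => e _.
by rewrite dotDl dotZl scalerDl scalerA.
Qed.

Lemma prB s x y : pr s (x - y) = pr s x - pr s y.
Proof. by rewrite addrC -scaleN1r pr_linear scaleN1r addrC. Qed.

Lemma dot_sum_osys B s (c : H -> C) e : osys B -> sub_of B s -> B e ->
  dot (\sum_(f <- s) c f *: f) e = if e \in s then c e else 0.
Proof.
move=> oB [us sB] Be; rewrite dot_suml; case: ifPn => es.
  rewrite (big_rem e) //= dotZl oB // eqxx mulr1 big_seq big1 ?addr0 // => f.
  rewrite mem_rem_uniq // => /andP[fe fs].
  by rewrite dotZl oB ?(negbTE fe) ?mulr0 //; exact: sB.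
rewrite big_seq big1 // => f fs; rewrite dotZl oB //; last exact: sB.
by have [fe|] := eqVneq f e; rewrite ?mulr0 //; rewrite fe (negbTE es) in fs.
Qed.

Lemma dot_pr B s x e : osys B -> sub_of B s -> e \in s -> dot (pr s x) e = dot x e.
Proof.
by move=> oB hs es; rewrite (dot_sum_osys (fun f => dot x f) oB hs) ?es //; case: hs => _; apply.
Qed.

Lemma nm_sum_osys B s (c : H -> C) : osys B -> sub_of B s ->
  nm (\sum_(f <- s) c f *: f) ^+ 2 = \sum_(f <- s) normc (c f) ^+ 2.
Proof.
move=> oB hs; rewrite -(dotxx_Re Hdot) dot_sumr Re_sum [LHS]big_seq [RHS]big_seq.
apply: eq_bigr => f fs; rewrite dotZr (dot_sum_osys _ oB hs); last by case: hs => _; apply.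
by rewrite fs mulrC mul_conjC_normc.
Qed.

Lemma nm_pr B s x : osys B -> sub_of B s -> nm (pr s x) ^+ 2 = \sum_(e <- s) normc (dot x e) ^+ 2.
Proof. by move=> oB hs; exact: (nm_sum_osys _ oB hs). Qed.

Lemma dot_pr_orth B s x (c : H -> C) : osys B -> sub_of B s ->
  dot (x - pr s x) (\sum_(f <- s) c f *: f) = 0.
Proof.
move=> oB hs; rewrite dot_sumr big_seq big1 // => e es.
by rewrite dotZr dotBl (dot_pr _ oB hs es) subrr mulr0.
Qed.

Lemma bessel_eq B s x : osys B -> sub_of B s ->
  nm x ^+ 2 = nm (x - pr s x) ^+ 2 + \sum_(e <- s) normc (dot x e) ^+ 2.
Proof.
move=> oB hs; rewrite -(nm_pr x oB hs) -(nm_pythagoras Hdot) ?subrK //.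
exact: (dot_pr_orth x (fun f => dot x f) oB hs).
Qed.

Lemma bessel B s x : osys B -> sub_of B s -> \sum_(e <- s) normc (dot x e) ^+ 2 <= nm x ^+ 2.
Proof. by move=> oB hs; rewrite (bessel_eq x oB hs) lerDr sqr_ge0. Qed.

Lemma nm_pr_le B s x : osys B -> sub_of B s -> nm (pr s x) <= nm x.
Proof.
move=> oB hs; rewrite -(@ler_pXn2r _ 2) ?nnegrE ?nm_ge0 // (nm_pr _ oB hs).
exact: bessel oB hs.
Qed.

Lemma sum_sub_seq (T : eqType) (s t : seq T) (F : T -> R) : uniq s -> {subset s <= t} ->
  (forall b, 0 <= F b) -> \sum_(b <- s) F b <= \sum_(b <- t) F b.
Proof.
move=> us st F0.
have F0s q : 0 <= \sum_(b <- q) F b by apply: sumr_ge0.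
elim: t s us st => [|a t ih] s us st.
  by case: s us st => // b s _ /(_ b); rewrite mem_head => /(_ isT).
have [as_|nas] := boolP (a \in s).
  rewrite (big_rem a) //= big_cons lerD2l; apply: ih; first exact: rem_uniq.
  move=> b; rewrite mem_rem_uniq // => /andP[ba /st].
  by rewrite inE (negbTE (ba : b != a)).
rewrite big_cons; apply: ler_wpDl => //; apply: ih => // b bs.
by have := st b bs; rewrite inE => /orP[/eqP ba|//]; rewrite -ba bs in nas.
Qed.

Lemma nm_pr_mono B s t x : osys B -> sub_of B s -> sub_of B t -> {subset s <= t} ->
  nm (x - pr t x) <= nm (x - pr s x).
Proof.
move=> oB hs ht st; rewrite -(@ler_pXn2r _ 2) ?nnegrE ?nm_ge0 //.
have := bessel_eq x oB hs; have := bessel_eq x oB ht.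
have : \sum_(e <- s) normc (dot x e) ^+ 2 <= \sum_(e <- t) normc (dot x e) ^+ 2.
  by apply: sum_sub_seq => //; [case: hs|move=> e; exact: sqr_ge0].
lra.
Qed.

Lemma sub_of_cat B s t : sub_of B s -> sub_of B t -> sub_of B (undup (s ++ t)).
Proof.
move=> [us hs] [ut ht]; split; first exact: undup_uniq.
by move=> e; rewrite mem_undup mem_cat => /orP[/hs|/ht].
Qed.

Lemma sub_undupl s t : {subset s <= undup (s ++ t)}.
Proof. by move=> e es; rewrite mem_undup mem_cat es. Qed.
Lemma sub_undupr s t : {subset t <= undup (s ++ t)}.
Proof. by move=> e es; rewrite mem_undup mem_cat es orbT. Qed.

(** An [orthonormal_basis] is only assumed to be maximal. The vectors approximable by finite sums
    form a closed subspace [W] containing [B]; the component of [x] orthogonal to [W] is orthogonal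
    to [B], hence zero. *)
Lemma onb_approx V B x (d : R) : csubsp V -> orthonormal_basis dot V B -> V x -> 0 < d ->
  exists2 s, sub_of B s & nm (x - pr s x) <= d.
Proof.
move=> cV [BV /osysP oB cB] vx d0; have sV := cV.1.
pose W := [set y | V y /\ forall d : R, 0 < d -> exists2 s, sub_of B s & nm (y - pr s y) <= d].
have cW : csubsp W.
  split; first split.
  - split; [exact: sub0|move=> d1 d10; exists [::] => //].
    by rewrite /pr big_nil subrr nm0 ltW.
  - move=> a y z [vy hy] [vz hz]; split; first exact: sV.2.
    move=> d1 d10; have n0 : 0 < normc a + 1 by have := normc_ge0 a; lra.
    have [|s hs hsd] := hy (d1 / 2 / (normc a + 1)); first by rewrite !divr_gt0.
    have [|t ht htd] := hz (d1 / 2); first by rewrite divr_gt0.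
    have hu := sub_of_cat hs ht.
    exists (undup (s ++ t)) => //; rewrite pr_linear opprD addrACA -scalerBr.
    apply: le_trans (nmD _ _) _; rewrite nmZ.
    have h1 := le_trans (nm_pr_mono y oB hs hu (@sub_undupl s t)) hsd.
    have h2 := le_trans (nm_pr_mono z oB ht hu (@sub_undupr s t)) htd.
    have h3 := ler_wpM2l (normc_ge0 a) h1.
    have : normc a * (d1 / 2 / (normc a + 1)) <= d1 / 2.
      rewrite mulrCA; apply: ler_piMr; first by rewrite divr_ge0 // ltW.
      by rewrite ler_pdivrMr; lra.
    lra.
  move=> y hy; have vy : V y.
    by apply: cV.2 => d1 d10; have [z [vz _] hz] := hy d1 d10; exists z.
  split=> // d1 d10; have d13 : 0 < d1 / 3 by rewrite divr_gt0.
  have [z [vz hz] yz] := hy _ d13; have [s hs hsd] := hz _ d13.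
  exists s => //.
  have -> : y - pr s y = (y - z) + (z - pr s z) - pr s (y - z).
    by rewrite prB opprB addrA addrA subrK subrK.
  apply: le_trans (nmB _ _) _; have := nmD (y - z) (z - pr s z).
  have := nm_pr_le (y - z) oB hs; lra.
suff : W x by case=> _; apply.
have -> : x = proj dot W x; last exact: proj_in.
apply/eqP; rewrite -subr_eq0; apply/eqP; apply: cB.
  by apply: subB => //; have [] := proj_in Hdot cW x.
move=> e /set_mem Be; apply: proj_orth => //; split; first exact: BV.
move=> d1 d10; exists [:: e]; first by split=> // f; rewrite inE => /eqP ->.
by rewrite /pr big_seq1 oB // eqxx scale1r subrr nm0 ltW.
Qed.

Lemma onb_approx_seq V B (L : seq H) (d : R) : csubsp V -> orthonormal_basis dot V B ->
  (forall x, x \in L -> V x) -> 0 < d ->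
  exists2 s, sub_of B s & forall x, x \in L -> nm (x - pr s x) <= d.
Proof.
move=> cV hB hL d0; have [_ /osysP oB _] := hB.
elim: L hL => [|x L ih] hL; first by exists [::].
have [s hs hsd] : exists2 s, sub_of B s & forall x, x \in L -> nm (x - pr s x) <= d.
  by apply: ih => y yL; apply: hL; rewrite inE yL orbT.
have [t ht htd] := onb_approx cV hB (hL x (mem_head _ _)) d0.
have hu := sub_of_cat hs ht.
exists (undup (s ++ t)) => // y; rewrite inE => /orP[/eqP->|yL].
  exact: le_trans (nm_pr_mono x oB ht hu (@sub_undupr s t)) htd.
exact: le_trans (nm_pr_mono y oB hs hu (@sub_undupl s t)) (hsd _ yL).
Qed.

Lemma opapprox_sub V W S : csubsp W -> W `<=` V -> (forall x, W x -> W (S x)) ->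
  opapprox dot V S -> opapprox dot W S.
Proof.
move=> cW WV WS aS d d0; have [s iV bs] := aS d d0.
exists (mapfr (proj dot W) s); first by apply: (@ins_map _ _ V) iV => x _; exact: proj_in.
move=> x wx; rewrite (fr_map dot (V := setT) x) //; last by move=> a y z _ _; exact: proj_linear.
rewrite -[X in X - _](proj_id Hdot cW (WS _ wx)).
have -> : proj dot W (S x) - proj dot W (fr s x) = proj dot W (S x - fr s x).
  have lp : linear_on setT (proj dot W) by move=> a y z _ _; exact: proj_linear.
  by rewrite (linB (@subspT R H) lp).
by apply: le_trans (nm_proj Hdot cW _) _; exact: bs (WV _ wx).
Qed.

Lemma positive_sub V W S : W `<=` V -> (forall x, W x -> W (S x)) ->
  positive_on dot V S -> positive_on dot W S.
Proof.
move=> WV WS [[VS lS [M bS]] pS]; split; last by move=> x /WV; exact: pS.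
split=> //; first by move=> a x y /WV vx /WV vy; exact: lS.
by exists M => x /WV; exact: bS.
Qed.

(* If the top [M] of the numerical range were not an eigenvalue, [M - S] would be bounded below
   by the Fredholm alternative, hence so would its quadratic form. *)
Lemma top_eigenvector W S : csubsp W -> positive_on dot W S -> opapprox dot W S ->
  (exists2 x, W x & S x != 0) ->
  exists u (l : R), [/\ W u, u != 0, 0 <= l & S u = l%:C *: u].
Proof.
move=> cW pS aS [x0 wx0 Sx0]; have sW := cW.1.
have [/bounded_onP[WS lS [N N0 bS]] pSx] := pS.
pose D := [set t : R | exists2 x, W x /\ nm x <= 1 & t = complex.Re (dot (S x) x)].
have q0 x : W x -> 0 <= complex.Re (dot (S x) x) by move=> wx; apply: Re_ge0; exact: pSx.
have hsD : has_sup D.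
  split; first by exists 0, 0; rewrite ?nm0 ?dot0r //; split; [exact: sub0|exact: ler01].
  exists N => _ [x [wx x1] ->]; apply: le_trans (ler_norm _) _.
  apply: le_trans (normc_ge_Re _) _; apply: le_trans (CS Hdot _ _) _.
  apply: (@le_trans _ _ (N * nm x * nm x)).
    by apply: ler_wpM2r; [exact: nm_ge0|exact: bS].
  have xx : nm x * nm x <= 1 by apply: mulr_ile1 => //; exact: nm_ge0.
  by rewrite -mulrA ler_piMr.
pose M := sup D.
have hom (t : R) x : W x -> complex.Re (dot (S (t%:C *: x)) (t%:C *: x)) = t ^+ 2 * complex.Re (dot (S x) x).
  by move=> wx; rewrite (linZ sW lS) // dotZl dotZr conjC_real !ReMl mulrA.
have hM x : W x -> complex.Re (dot (S x) x) <= M * nm x ^+ 2.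
  move=> wx; have [nx0|nx0] := eqVneq (nm x) 0.
    by rewrite (nm_eq0 nx0) dot0r nm0 expr0n mulr0.
  have nx1 : 0 < nm x by rewrite lt_def nx0 nm_ge0.
  have : (nm x)^-1 ^+ 2 * complex.Re (dot (S x) x) <= M.
    rewrite -hom //; apply: ub_le_sup; first by case: hsD.
    exists ((nm x)^-1%:C *: x) => //; split; first exact: subZ.
    by rewrite nmZ normc_real ger0_norm ?invr_ge0 ?nm_ge0 // mulVf.
  by rewrite exprVn mulrC ler_pdivrMr // exprn_gt0.
have x0pos : 0 < complex.Re (dot (S x0) x0).
  rewrite lt_def q0 // andbT; apply: contra Sx0 => /eqP h.
  have := positive_CS sW pS wx0 (WS _ wx0); rewrite h mul0r => h2.
  have /eqP : normc (dot (S x0) (S x0)) ^+ 2 = 0.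
    by apply/eqP; rewrite eq_le h2 sqr_ge0.
  by rewrite sqrf_eq0 normc_eq0 => /eqP /(dot_eq0 Hdot) ->.
have M0 : 0 < M.
  rewrite ltNge; apply/negP => M0; have := lt_le_trans x0pos (hM _ wx0).
  by rewrite ltNge mulr_le0_ge0 ?sqr_ge0.
pose T x := M^-1%:C *: S x.
have WT x : W x -> W (T x) by move=> wx; apply: subZ => //; exact: WS.
have lT : linear_on W T.
  by move=> a x y wx wy; rewrite /T lS // scalerDr !scalerA mulrC.
have Mc : normc (M^-1)%:C = M^-1 by rewrite normc_real ger0_norm // invr_ge0 ltW.
have lopT : lop W T.
  split=> //; exists (M^-1 * N); first by rewrite mulr_ge0 // invr_ge0 ltW.
  move=> x wx; rewrite nmZ Mc -mulrA; apply: ler_wpM2l; last exact: bS.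
  by rewrite invr_ge0 ltW.
have aT : opapprox dot W T.
  move=> d d0; have [s iW bs] := aS _ (mulr_gt0 d0 M0).
  exists (mapfr (fun y => M^-1%:C *: y) s).
    by apply: ins_map iW => x; exact: subZ.
  move=> x wx; rewrite (fr_map dot (V := setT) x) //; last first.
    by move=> a y z _ _; rewrite scalerDr !scalerA mulrC.
  rewrite -scalerBr nmZ Mc [leLHS]mulrC ler_pdivrMr // mulrAC.
  exact: bs.
have [hinj|hninj] := pselect (forall x, W x -> T x = x -> x = 0); last first.
  move/existsNP: hninj => [u /not_implyP[wu /not_implyP[Tu /eqP u0]]].
  exists u, M; split=> //; first exact: ltW.
  by rewrite -{2}Tu scalerA -rmorphM mulfV ?gt_eqF // scale1r.
exfalso.
have [K [G [_ _ bG GE _]]] := fredholm_alternative Hdot cW lopT aT hinj.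
pose Q x := M%:C *: (x - T x).
have QE x : Q x = M%:C *: x - S x.
  by rewrite /Q scalerBr /T scalerA -rmorphM mulfV ?gt_eqF // scale1r.
have WQ x : W x -> W (Q x) by move=> wx; apply: subZ => //; apply: subB => //; exact: WT.
have ReQ x : complex.Re (dot (Q x) x) = M * nm x ^+ 2 - complex.Re (dot (S x) x).
  by rewrite QE dotBl dotZl ReB ReMl (dotxx_Re Hdot).
have pQ : positive_on dot W Q.
  split.
    apply/bounded_onP; split=> //.
      by move=> a x y wx wy; rewrite /Q lT // opprD addrACA -scalerBr scalerDr !scalerA mulrC.
    exists (M + N); first by rewrite addr_ge0 // ltW.
    move=> x wx; rewrite QE; apply: le_trans (nmB _ _) _; rewrite mulrDl nmZ normc_real gtr0_norm //.
    by rewrite lerD2l; exact: bS.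
  move=> x wx; rewrite lecE /=; apply/andP; split.
    rewrite QE dotBl dotZl (dotxx Hdot) (ge0_Re (pSx _ wx)) /=.
    by rewrite mulr0 mul0r addr0 oppr0 addr0.
  by rewrite ReQ subr_ge0; exact: hM.
have key x : W x -> nm (Q x) ^+ 2 <= M * complex.Re (dot (Q x) x).
  move=> wx; have := positive_CS sW pQ wx (WQ _ wx).
  have -> : normc (dot (Q x) (Q x)) = nm (Q x) ^+ 2.
    by rewrite (dotxx Hdot) normc_real ger0_norm // sqr_ge0.
  have h1 : complex.Re (dot (Q (Q x)) (Q x)) <= M * nm (Q x) ^+ 2.
    by rewrite ReQ; have := q0 _ (WQ _ wx); lra.
  have h2 : 0 <= complex.Re (dot (Q x) x) by case: pQ => _ /(_ _ wx) /Re_ge0.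
  move: h1 h2; set a := nm _ ^+ 2; set b := complex.Re (dot _ x); set c := complex.Re _.
  have a0 : 0 <= a by exact: sqr_ge0.
  move=> h1 h2 h3; have h4 : a * a <= b * (M * a).
    by rewrite -expr2; apply: le_trans h3 _; exact: ler_wpM2l.
  have [->|an0] := eqVneq a 0; first by rewrite mulr_ge0 // ltW.
  have ap : 0 < a by rewrite lt_def an0.
  have : a * a <= M * b * a by lra.
  by rewrite (ler_pM2r ap).
pose K1 := Num.max K 1.
have K1p : 0 < K1 by rewrite lt_max ltr01 orbT.
have low x : W x -> M / K1 ^+ 2 * nm x ^+ 2 <= complex.Re (dot (Q x) x).
  move=> wx; have wd : W (x - T x) by apply: subB => //; exact: WT.
  have h1 : nm x <= K1 * nm (x - T x).
    rewrite -[x in leLHS]GE //; apply: le_trans (bG _ wd) _.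
    by apply: ler_wpM2r; [exact: nm_ge0|rewrite le_max lexx].
  have h2 : nm (Q x) = M * nm (x - T x) by rewrite nmZ normc_real gtr0_norm.
  have h3 : nm x ^+ 2 <= K1 ^+ 2 * nm (x - T x) ^+ 2.
    by rewrite -exprMn ler_pXn2r ?nnegrE ?nm_ge0 // mulr_ge0 ?nm_ge0 // ltW.
  have := key x wx; rewrite h2 exprMn expr2 -mulrA ler_pM2l // => h4.
  apply: le_trans h4; rewrite -mulrA; apply: ler_wpM2l; first exact: ltW.
  by rewrite mulrC ler_pdivrMr ?exprn_gt0 // mulrC.
have [d dp hd] : exists2 d : R, 0 < d & forall x, W x -> complex.Re (dot (S x) x) <= (M - d) * nm x ^+ 2.
  exists (M / K1 ^+ 2); first by rewrite divr_gt0 // exprn_gt0.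
  by move=> x wx; have := low x wx; rewrite ReQ mulrBl; lra.
(* The supremum is over the unit ball, not the sphere, so the bound is [(M - d) * nm x ^+ 2]; the
   maximum with 0 covers a negative [M - d]. *)
have : M <= Num.max (M - d) 0.
  apply: ge_sup; first by case: hsD.
  move=> _ [x [wx x1] ->]; apply: le_trans (hd x wx) _.
  have x2 : nm x ^+ 2 <= 1 by rewrite expr_le1 // nm_ge0.
  have [h|h] := leP 0 (M - d).
    by apply: le_trans (ler_piMr h x2) _.
  by rewrite mulr_le0_ge0 ?sqr_ge0 // ltW.
by rewrite le_max => /orP[|]; lra.
Qed.

Lemma spectral_theorem V S : csubsp V -> positive_on dot V S -> opapprox dot V S ->
  exists B, orthonormal_basis dot V B /\
    forall e, B e -> exists2 l : R, 0 <= l & S e = l%:C *: e.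
Proof.
move=> cV pS aS; have sV := cV.1.
have [/bounded_onP[VS lS [N N0 bS]] pSx] := pS.
pose P := [set B : set H | [/\ B `<=` V, osys B &
  forall e, B e -> exists2 l : R, 0 <= l & S e = l%:C *: e]].
have [|B [[BV oB eB] maxB]] := @Zorn_bigcup H P.
  move=> F FP tot; split.
  - by move=> e [B FB Be]; have [BV _ _] := FP _ FB; exact: BV.
  - move=> e f [B FB Be] [B' FB' Bf].
    have [_ oB _] := FP _ FB; have [_ oB' _] := FP _ FB'.
    by have [h|h] := tot _ _ FB FB'; [apply: oB' => //|apply: oB => //]; exact: h.
  - by move=> e [B FB Be]; have [_ _] := FP _ FB; apply.
exists B; split=> //; split=> //; first exact/osysP.
move=> x vx hx; apply: contrapT => /eqP x0.
have {}hx e : B e -> dot x e = 0 by move=> Be; apply: hx; rewrite inE.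
pose W := [set y | V y /\ forall e, B e -> dot y e = 0].
have WV : W `<=` V by move=> y [].
have cW : csubsp W.
  split; first split.
  - by split; [exact: sub0|move=> e _; rewrite dot0l].
  - move=> a y z [vy hy] [vz hz]; split; first exact: sV.2.
    by move=> e Be; rewrite dotDl dotZl hy // hz // mulr0 addr0.
  move=> y hy; split.
    by apply: cV.2 => d d0; have [z [vz _] hz] := hy d d0; exists z.
  move=> e Be; apply: normc_small => d d0.
  have n0 : 0 < nm e + 1 by have := nm_ge0 e; lra.
  have [z [vz hz] yz] := hy _ (divr_gt0 d0 n0).
  rewrite -[y](subrK z) dotDl (hz _ Be) addr0; apply: le_trans (CS Hdot _ _) _.
  apply: le_trans (ler_wpM2r (nm_ge0 _) yz) _.
  rewrite mulrAC ler_pdivrMr //; apply: ler_wpM2l; first exact: ltW.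
  by rewrite lerDl.
have WS y : W y -> W (S y).
  move=> [vy hy]; split; first exact: VS.
  move=> e Be; have [l l0 Se] := eB _ Be.
  by rewrite (positive_sym sV pS) // ?Se ?dotZr ?hy ?mulr0 //; exact: BV.
have wx : W x by [].
have [u [l [wu u0 l0 Su]]] : exists u (l : R), [/\ W u, u != 0, 0 <= l & S u = l%:C *: u].
  have [h|h] := pselect (exists2 y, W y & S y != 0).
    exact: (top_eigenvector cW (positive_sub WV WS pS) (opapprox_sub cW WV WS aS) h).
  exists x, 0; split=> //; rewrite scale0r; apply: contrapT => /eqP Sx.
  by apply: h; exists x.
have nu0 : nm u != 0 by apply: contra u0 => /eqP /nm_eq0 ->.
pose v := (nm u)^-1%:C *: u.
have [vu hu] := wu.
have Vv : V v by exact: subZ.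
have hv e : B e -> dot v e = 0 by move=> Be; rewrite dotZl hu // mulr0.
have vv : dot v v = 1.
  rewrite dotZl dotZr conjC_real (dotxx Hdot) -!rmorphM -[1](rmorph1 (real_complex R)).
  by congr (_%:C); field.
apply: (maxB (B `|` [set v])).
  split; first by move=> y By; left.
  move=> /(_ v (or_intror erefl)) Bv; have := hv _ Bv; rewrite vv.
  by move/eqP; rewrite oner_eq0.
split.
- by move=> y [/BV|->].
- move=> e f [Be|->] [Bf|->].
  + exact: oB.
  + rewrite dotC hv // rmorph0; case: eqP => // ev; have := hv _ Be.
    by rewrite ev vv => /eqP; rewrite oner_eq0.
  + rewrite hv //; case: eqP => // ev; have := hv _ Bf.
    by rewrite -ev vv => /eqP; rewrite oner_eq0.
  + by rewrite vv eqxx.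
- move=> e [/eB//|->]; exists l => //.
  by rewrite (linZ sV lS) // Su !scalerA mulrC.
Qed.

End SpectralTheorem.

(** * Traces of positive operators as sums of eigenvalues *)

Section TraceNorm.
Variables (R : realType) (H : completeNormedModType R[i]).
Variable dot : {dot H for conjC}.
Hypothesis Hdot : dot_induces_norm dot.
Local Notation C := R[i].
Local Notation normc := (@Normc.normc R).
Local Notation fr := (rank_one_sum dot).
Local Notation pr := (span_proj dot).
Local Notation nuc := (nuc dot).
Local Notation nucl := (nucl dot).
Implicit Types (x y z e f : H) (V W B : set H) (T S X G K : H -> H) (s t : seq H).

Lemma esum_ge_seq B s (a : H -> R) : sub_of B s ->
  ((\sum_(e <- s) a e)%:E <= \esum_(e in B) (a e)%:E)%E.
Proof.
move=> [us sB]; apply: ereal_sup_ubound; exists [set` s].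
  by split; [exact: finite_seq|move=> e /= es; exact: sB].
by rewrite -fsbig_seq // sumEFin.
Qed.

Lemma esum_le_seq B (t : R) (a : H -> R) :
  (forall s, sub_of B s -> \sum_(e <- s) a e <= t) -> (\esum_(e in B) (a e)%:E <= t%:E)%E.
Proof.
move=> h; apply: ge_ereal_sup => _ [F [finF FB] <-].
rewrite fsbig_finite //= sumEFin lee_fin; apply: h; split; first exact: finmap.fset_uniq.
by move=> e; rewrite in_fset_set // inE; exact: FB.
Qed.

(** [l] is nonnegative everywhere and not only on [B], which spares side conditions in sums over
    lists. *)
Definition eigensystem V B S (l : H -> R) :=
  [/\ orthonormal_basis dot V B, forall f, 0 <= l f & forall f, B f -> S f = (l f)%:C *: f].

Lemma eigensystem_exists V S : csubsp V -> positive_on dot V S -> opapprox dot V S ->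
  exists B l, eigensystem V B S l.
Proof.
move=> cV pS aS; have [B [oB eB]] := spectral_theorem Hdot cV pS aS.
have /choice[l hl] : forall f, exists l : R, 0 <= l /\ (B f -> S f = l%:C *: f).
  move=> f; have [/eB[l l0 hl]|nB] := pselect (B f); first by exists l.
  by exists 0.
by exists B, l; split=> // f; [case: (hl f)|move=> Bf; case: (hl f) => _; apply].
Qed.

Lemma eigen_sum_image V B S l s (c : H -> C) : subsp V -> linear_on V S ->
  eigensystem V B S l -> sub_of B s ->
  S (\sum_(f <- s) c f *: f) = \sum_(f <- s) ((l f)%:C * c f) *: f.
Proof.
move=> sV lS [[BV _ _] _ eS] [us sB].
have Vf f : f \in s -> V f by move=> /sB; exact: BV.
rewrite (lin_sum sV lS); last by move=> f fs _; apply: subZ => //; exact: Vf.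
rewrite !big_seq; apply: eq_bigr => f fs.
by rewrite (linZ sV lS) ?eS ?scalerA 1?mulrC //; [exact: sB|exact: Vf].
Qed.

Lemma dot_sums B s (c d : H -> C) : osys dot B -> sub_of B s ->
  dot (\sum_(f <- s) c f *: f) (\sum_(f <- s) d f *: f) = \sum_(f <- s) c f * conjC (d f).
Proof.
move=> oB hs; rewrite dot_sumr [LHS]big_seq [RHS]big_seq; apply: eq_bigr => f fs.
rewrite dotZr (dot_sum_osys c oB hs); last by case: hs => _; apply.
by rewrite fs mulrC.
Qed.

(** The span of the eigenvectors in [s] and its orthogonal complement do not interact under [S], and
    the complement contributes a nonnegative term. *)
Lemma positive_ge_eigen V B S l s x : csubsp V -> positive_on dot V S -> eigensystem V B S l ->
  sub_of B s -> V x ->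
  \sum_(f <- s) l f * normc (dot x f) ^+ 2 <= complex.Re (dot (S x) x).
Proof.
move=> cV pS eS hs vx; have sV := cV.1; have [[VS lS _] pSx] := pS.
have [[BV /osysP oB cB] l0 _] := eS.
have Vp : V (pr s x).
  by apply: sub_sum => // f fs _; apply: subZ => //; apply: BV; case: hs => _; apply.
have Vq : V (x - pr s x) by exact: subB.
have -> : dot (S x) x = dot (S (x - pr s x)) (x - pr s x) + dot (S (x - pr s x)) (pr s x)
    + (dot (S (pr s x)) (x - pr s x) + dot (S (pr s x)) (pr s x)).
  by rewrite -!dotDr -dotDl -(linD lS) // subrK.
have Sp : S (pr s x) = \sum_(f <- s) ((l f)%:C * dot x f) *: f by exact: eigen_sum_image eS hs.
have o1 : dot (x - pr s x) (S (pr s x)) = 0 by rewrite Sp (dot_pr_orth _ _ oB hs).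
have o2 : dot (S (x - pr s x)) (pr s x) = 0 by rewrite (positive_sym sV pS).
have o3 : dot (S (pr s x)) (x - pr s x) = 0 by rewrite dotC o1 rmorph0.
rewrite o2 o3 addr0 add0r ReD.
have -> : complex.Re (dot (S (pr s x)) (pr s x)) = \sum_(f <- s) l f * normc (dot x f) ^+ 2.
  rewrite Sp (dot_sums _ _ oB hs) Re_sum; apply: eq_bigr => f _.
  by rewrite -mulrA mul_conjC_normc ReMl.
by rewrite lerDr; apply: Re_ge0; exact: pSx.
Qed.

(** One half of the basis independence of the trace. Finitely many vectors [J] of [B'] nearly carry
    the norm 1 of each [f], so [l f (1 - d)] is at most the sum of [l f |<e, f>|^2] over [J];
    exchanging the sums bounds the total by the trace over [J]. *)
Lemma eigen_sum_le_trace V B S l B' (t : R) s : csubsp V -> positive_on dot V S ->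
  eigensystem V B S l -> orthonormal_basis dot V B' ->
  (\esum_(e in B') (complex.Re (dot (S e) e))%:E <= t%:E)%E ->
  sub_of B s -> \sum_(f <- s) l f <= t.
Proof.
move=> cV pS eS oB' ht hs; have [[BV /osysP oB cB] l0 _] := eS.
have [BV' /osysP oB1 _] := oB'.
have L0 : 0 <= \sum_(f <- s) l f by exact: sumr_ge0.
apply: (ler_epsM L0) => d d0.
pose d' := Num.min d 1; have d'0 : 0 < d' by rewrite lt_min d0 ltr01.
have sV x : x \in s -> V x by move=> xs; apply: BV; case: hs => _; apply.
have [J hJ hJd] := onb_approx_seq Hdot cV oB' sV d'0.
have d2 : d' ^+ 2 <= d.
  apply: (@le_trans _ _ d'); last by rewrite ge_min lexx.
  by rewrite expr2 ler_piMr ?(ltW d'0) // ge_min lexx orbT.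
have h1 : \sum_(f <- s) l f * (1 - d) <= \sum_(f <- s) \sum_(e <- J) l f * normc (dot e f) ^+ 2.
  rewrite big_seq [leRHS]big_seq; apply: ler_sum => f fs; rewrite -mulr_sumr.
  apply: ler_wpM2l => //; have := bessel_eq Hdot f oB1 hJ.
  have -> : nm f ^+ 2 = 1.
    by rewrite -(dotxx_Re Hdot) oB ?eqxx //; case: hs => _; apply.
  have : nm (f - pr J f) ^+ 2 <= d.
    by apply: le_trans d2; rewrite ler_pXn2r ?nnegrE ?nm_ge0 ?(ltW d'0) // hJd.
  have -> : \sum_(e <- J) normc (dot e f) ^+ 2 = \sum_(e <- J) normc (dot f e) ^+ 2.
    by apply: eq_bigr => e _; rewrite dotC normc_conj.
  lra.
have h2 : \sum_(f <- s) \sum_(e <- J) l f * normc (dot e f) ^+ 2 <= t.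
  rewrite exchange_big /= -lee_fin; apply: le_trans ht.
  apply: le_trans (esum_ge_seq _ hJ); rewrite lee_fin big_seq [leRHS]big_seq.
  apply: ler_sum => e eJ; apply: (positive_ge_eigen cV pS eS hs).
  by apply: BV'; case: hJ => _; apply.
rewrite -mulr_suml in h1; lra.
Qed.

Lemma positive_le_eigen V B S l s x (N d : R) : csubsp V -> positive_on dot V S ->
  eigensystem V B S l -> sub_of B s -> V x -> opb V S N -> 0 <= N -> nm (x - pr s x) <= d ->
  complex.Re (dot (S x) x) <= \sum_(f <- s) l f * normc (dot x f) ^+ 2 + N * nm x * d.
Proof.
move=> cV pS eS hs vx bS N0 hd; have sV := cV.1; have [[VS lS _] pSx] := pS.
have [[BV /osysP oB cB] l0 _] := eS.
have Vp : V (pr s x).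
  by apply: sub_sum => // f fs _; apply: subZ => //; apply: BV; case: hs => _; apply.
have Vq : V (x - pr s x) by exact: subB.
have -> : dot (S x) x = dot (S x) (pr s x) + dot (S x) (x - pr s x).
  by rewrite -dotDr addrC subrK.
rewrite ReD; apply: lerD.
  have -> : dot (S x) (pr s x) = dot (S (pr s x)) (pr s x).
    apply/eqP; rewrite -subr_eq0 -dotBl -(linB sV lS) //.
    rewrite (positive_sym sV pS) // [S (pr s x)](eigen_sum_image _ sV lS eS hs).
    by rewrite (dot_pr_orth _ _ oB hs).
  rewrite [S (pr s x)](eigen_sum_image _ sV lS eS hs) (dot_sums _ _ oB hs) Re_sum.
  apply: ler_sum => f _; by rewrite -mulrA mul_conjC_normc ReMl.
apply: le_trans (ler_norm _) _; apply: le_trans (normc_ge_Re _) _.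
apply: le_trans (CS Hdot _ _) _; apply: ler_pM; rewrite ?nm_ge0 //.
exact: bS.
Qed.

(** The other half: each [<S e, e>] is nearly the sum of [l f |<e, f>|^2], and Bessel's inequality
    for the system [B'] bounds the sum over [e] for fixed [f] by [l f]. *)
Lemma trace_le_eigen_sum V B S l B' (t : R) : csubsp V -> positive_on dot V S ->
  eigensystem V B S l -> orthonormal_basis dot V B' -> 
  (forall s, sub_of B s -> \sum_(f <- s) l f <= t) ->
  (\esum_(e in B') (complex.Re (dot (S e) e))%:E <= t%:E)%E.
Proof.
move=> cV pS eS oB' ht; have sV := cV.1.
have [/bounded_onP[VS lS [N N0 bS]] pSx] := pS.
have [oB0 l0 _] := eS; have [BV /osysP oB cB] := oB0.
have [BV' /osysP oB1 _] := oB'.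
apply: esum_le_seq => J hJ.
have JV x : x \in J -> V x by move=> xJ; apply: BV'; case: hJ => _; apply.
have k0 : 0 <= N * (size J)%:R by rewrite mulr_ge0.
apply: (ler_epsM k0) => d d0.
have [s hs hsd] := onb_approx_seq Hdot cV oB0 JV d0.
have h1 : \sum_(e <- J) complex.Re (dot (S e) e) <=
    \sum_(e <- J) (\sum_(f <- s) l f * normc (dot e f) ^+ 2 + N * d).
  rewrite big_seq [leRHS]big_seq; apply: ler_sum => e eJ.
  have := positive_le_eigen cV pS eS hs (JV _ eJ) bS N0 (hsd _ eJ).
  suff -> : nm e = 1 by rewrite mulr1.
  apply/eqP; rewrite -(@eqrXn2 _ 2) ?nm_ge0 // expr1n -(dotxx_Re Hdot) oB1 ?eqxx //;
    by case: hJ => _; apply.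
apply: le_trans h1 _; rewrite big_split /= exchange_big /=; apply: lerD.
  apply: le_trans (ht s hs); rewrite big_seq [leRHS]big_seq; apply: ler_sum => f fs.
  rewrite -mulr_sumr; apply: ler_piMr => //.
  have : \sum_(e <- J) normc (dot f e) ^+ 2 <= nm f ^+ 2 by exact: (bessel Hdot f oB1 hJ).
  rewrite -(dotxx_Re Hdot) oB ?eqxx /=; [|by case: hs => _; apply..].
  by apply: le_trans; apply: ler_sum => e _; rewrite dotC normc_conj.
by rewrite big_const_seq count_predT iter_addr_0 -[leLHS]mulr_natr mulrAC.
Qed.

Lemma abs_norm V X S x : is_abs dot V X S -> subsp V -> V x -> nm (X x) = nm (S x).
Proof.
move=> [pS hS] sV vx; have [[VS _ _] _] := pS.
have := hS x x vx vx; rewrite (positive_sym sV pS) //; last exact: VS.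
rewrite !(dotxx Hdot) => /complexI /eqP; rewrite eqrXn2 ?nm_ge0 // => /eqP.
by [].
Qed.

(** [B] is not an eigenbasis here: this supplies the compactness that the spectral theorem asks for.
    [S] is approximated by [span_proj s] after [S]; the remainder is controlled by
    [|<S x, e>|^2 <= <S x, x> <S e, e>] and the small tail of the trace. *)
Lemma abs_opapprox V S B (t : R) : csubsp V -> positive_on dot V S -> orthonormal_basis dot V B ->
  (\esum_(e in B) (complex.Re (dot (S e) e))%:E <= t%:E)%E -> opapprox dot V S.
Proof.
move=> cV pS oB0 ht d d0; have sV := cV.1.
have [/bounded_onP[VS lS [N N0 bS]] pSx] := pS.
have [BV /osysP oB cB] := oB0.
pose a e := complex.Re (dot (S e) e).
pose D := [set u : R | exists2 s, sub_of B s & u = \sum_(e <- s) a e].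
have hsD : has_sup D.
  split; first by exists 0, [::]; rewrite ?big_nil.
  exists t => _ [s hs ->]; rewrite -lee_fin; apply: le_trans ht.
  exact: (esum_ge_seq a hs).
(* The squared remainder is at most [N * nm x ^+ 2 * eta], to be compared with [(d * nm x) ^+ 2]. *)
pose eta := d ^+ 2 / (N + 1).
have eta0 : 0 < eta by rewrite divr_gt0 ?exprn_gt0 //; lra.
have [_ [s hs ->] hsup] := sup_adherent eta0 hsD.
have tail s' : sub_of B s' -> {subset s <= s'} ->
    \sum_(e <- s') a e - \sum_(e <- s) a e <= eta.
  move=> hs' ss'; have : \sum_(e <- s') a e <= sup D.
    by apply: ub_le_sup; [case: hsD|exists s'].
  lra.
have sV' e : e \in s -> V e by move=> es; apply: BV; case: hs => _; apply.
exists [seq (S e, e) | e <- s].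
  by move=> _ /mapP[e es ->] /=; exact: sV'.
move=> x vx.
have -> : fr [seq (S e, e) | e <- s] x = pr s (S x).
  rewrite /rank_one_sum big_map /span_proj big_seq [RHS]big_seq; apply: eq_bigr => e es /=.
  by rewrite (positive_sym sV pS) //; exact: sV'.
have VSx := VS _ vx.
apply: ler_epsM (ler01) _ => d1 d10; rewrite mul1r.
have [s1 hs1 hs1d] := onb_approx Hdot cV oB0 VSx d10.
pose u := undup (s ++ s1); have hu : sub_of B u by exact: sub_of_cat.
have h1 : nm (S x - pr u (S x)) <= d1.
  exact: le_trans (nm_pr_mono Hdot _ oB hs1 hu (@sub_undupr _ _ s s1)) hs1d.
have h2 : nm (pr u (S x) - pr s (S x)) ^+ 2 <= (d * nm x) ^+ 2.
  have := bessel_eq Hdot (S x) oB hs; have := bessel_eq Hdot (S x) oB hu.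
  have -> : nm (S x - pr s (S x)) ^+ 2 =
      nm (S x - pr u (S x)) ^+ 2 + nm (pr u (S x) - pr s (S x)) ^+ 2.
    rewrite -(nm_pythagoras Hdot) ?addrA ?subrK //.
    rewrite dotBr (dot_pr_orth _ _ oB hu) sub0r.
    rewrite dot_sumr big_seq big1 ?oppr0 // => e es.
    rewrite dotZr dotBl (dot_pr _ oB hu) ?subrr ?mulr0 //.
    exact: sub_undupl.
  have hle : \sum_(e <- u) normc (dot (S x) e) ^+ 2 - \sum_(e <- s) normc (dot (S x) e) ^+ 2 <=
      complex.Re (dot (S x) x) * (\sum_(e <- u) a e - \sum_(e <- s) a e).
    have split_ (F : H -> R) : \sum_(e <- u) F e - \sum_(e <- s) F e = \sum_(e <- u | e \notin s) F e.
      rewrite (bigID (fun e => e \in s)) /=.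
      have -> : \sum_(e <- u | e \in s) F e = \sum_(e <- s) F e.
        rewrite -big_filter; apply: perm_big; apply: uniq_perm.
        - by apply: filter_uniq; case: hu.
        - by case: hs.
        move=> e; rewrite mem_filter; case: (boolP (e \in s)) => //= es.
        by rewrite sub_undupl.
      by rewrite addrC addrK.
    rewrite !split_ mulr_sumr big_seq_cond [leRHS]big_seq_cond.
    apply: ler_sum => e /andP[eu _].
    by apply: (positive_CS sV pS) => //; apply: BV; case: hu => _; apply.
  have h3 := tail u hu (@sub_undupl _ _ s s1).
  have h4 : complex.Re (dot (S x) x) <= N * nm x ^+ 2.
    apply: le_trans (ler_norm _) _; apply: le_trans (normc_ge_Re _) _.
    apply: le_trans (CS Hdot _ _) _; rewrite expr2 mulrA.
    by apply: ler_wpM2r; [exact: nm_ge0|exact: bS].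
  have h5 : 0 <= complex.Re (dot (S x) x) by apply: Re_ge0; exact: pSx.
  have h6 : complex.Re (dot (S x) x) * (\sum_(e <- u) a e - \sum_(e <- s) a e) <= N * nm x ^+ 2 * eta.
    apply: le_trans (ler_wpM2l h5 h3) _; apply: ler_wpM2r => //; exact: ltW.
  have h7 : N * nm x ^+ 2 * eta <= (d * nm x) ^+ 2.
    rewrite exprMn mulrAC; apply: ler_wpM2r; first exact: sqr_ge0.
    rewrite /eta mulrCA; apply: ler_piMr; first exact: sqr_ge0.
    by rewrite ler_pdivrMr; lra.
  lra.
rewrite ler_pXn2r ?nnegrE ?mulr_ge0 ?nm_ge0 ?(ltW d0) // in h2.
rewrite -[S x](subrK (pr u (S x))) -addrA addrC subrK addrC; apply: le_trans (nmD _ _) _; lra.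
Qed.

End TraceNorm.

Section TraceNormNuclear.
Variables (R : realType) (H : completeNormedModType R[i]).
Variable dot : {dot H for conjC}.
Hypothesis Hdot : dot_induces_norm dot.
Local Notation C := R[i].
Local Notation normc := (@Normc.normc R).
Local Notation fr := (rank_one_sum dot).
Local Notation pr := (span_proj dot).
Local Notation nuc := (nuc dot).
Local Notation nucl := (nucl dot).
Local Notation eigensystem := (eigensystem dot).
Implicit Types (x y z e f : H) (V W B : set H) (T S X G K : H -> H) (s t : seq H).

Definition sum_le B (l : H -> R) (t : R) := forall s, sub_of B s -> \sum_(f <- s) l f <= t.

Lemma sum_tail B l (t d : R) : sum_le B l t -> 0 < d -> exists2 s, sub_of B s &
  forall s', sub_of B s' -> (forall e, e \in s' -> e \notin s) -> \sum_(f <- s') l f <= d.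
Proof.
move=> ht d0; pose D := [set u : R | exists2 s, sub_of B s & u = \sum_(e <- s) l e].
have hsD : has_sup D.
  split; first by exists 0, [::]; rewrite ?big_nil.
  by exists t => _ [s hs ->]; exact: ht.
have [_ [s hs ->] hsup] := sup_adherent d0 hsD.
exists s => // s' hs' dis.
have : \sum_(e <- s ++ s') l e <= sup D.
  apply: ub_le_sup; first by case: hsD.
  exists (s ++ s') => //; split.
    rewrite cat_uniq; case: hs => -> _; case: hs' => -> _; rewrite andbT /=.
    by apply/hasPn => e es'; exact: dis.
  by move=> e; rewrite mem_cat => /orP[]; [case: hs => _; apply|case: hs' => _; apply].
rewrite big_cat /=; lra.
Qed.

Lemma opb_onb V B T S : csubsp V -> orthonormal_basis dot V B -> lop V T -> lop V S ->
  (forall f, B f -> T f = S f) -> forall x, V x -> T x = S x.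
Proof.
move=> cV oB0 hT hS eTS x vx; have sV := cV.1; have [BV _ _] := oB0.
have [VD lD [M M0 bD]] := lopB sV hT hS.
apply/eqP; rewrite -subr_eq0; apply/eqP; apply: nm_eq0.
apply/eqP; rewrite eq_le nm_ge0 andbT; apply: (ler_epsM M0) => d d0; rewrite add0r.
have [s hs hd] := onb_approx Hdot cV oB0 vx d0.
have Vs f : f \in s -> V f by move=> fs; apply: BV; case: hs => _; apply.
have Vp : V (pr s x) by apply: sub_sum => // f fs _; apply: subZ => //; exact: Vs.
have Dp : T (pr s x) - S (pr s x) = 0.
  have := lin_sum sV lD (r := s) (P := xpredT) (F := fun f => dot x f *: f).
  rewrite -/(pr s x) => -> /=; last by move=> f fs _; apply: subZ => //; exact: Vs.
  rewrite big_seq big1 // => f fs; have := linZ sV lD (dot x f) (Vs f fs) => /= ->.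
  by rewrite eTS ?subrr ?scaler0 //; case: hs => _; apply.
have := bD _ (subB sV vx Vp); rewrite (linB sV lD) // Dp subr0.
by move=> /le_trans; apply; exact: ler_wpM2l.
Qed.

(* On the orthogonal complement of the finitely many [f] in [s], the diagonal operator [S] is
   bounded by the tail of its trace. *)
Lemma eigen_tail V B S l s (d : R) x : csubsp V -> positive_on dot V S -> eigensystem V B S l ->
  sub_of B s -> 
  (forall s', sub_of B s' -> (forall e, e \in s' -> e \notin s) -> \sum_(f <- s') l f <= d) ->
  V x -> nm (S (x - pr s x)) <= d * nm x.
Proof.
move=> cV pS eS hs ht vx; have sV := cV.1.
have [/bounded_onP[VS lS [N N0 bS]] pSx] := pS.
have [oB0 l0 eSl] := eS; have [BV /osysP oB cB] := oB0.
apply: (ler_epsM N0) => d1 d10.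
have [s1 hs1 hs1d] := onb_approx Hdot cV oB0 vx d10.
pose u := undup (s ++ s1); have hu : sub_of B u by exact: sub_of_cat.
have Vu q : sub_of B q -> V (pr q x).
  move=> hq; apply: sub_sum => // f fs _; apply: subZ => //; apply: BV.
  by case: hq => _; apply.
have -> : x - pr s x = (x - pr u x) + (pr u x - pr s x) by rewrite addrA subrK.
rewrite (linD lS); [|apply: subB => //; exact: Vu..].
rewrite addrC; apply: le_trans (nmD _ _) _; apply: lerD; last first.
  apply: le_trans (bS _ _) _; first by apply: subB => //; exact: Vu.
  apply: ler_wpM2l => //.
  exact: le_trans (nm_pr_mono Hdot _ oB hs1 hu (@sub_undupr _ _ s s1)) hs1d.
pose v := [seq f <- u | f \notin s].
have hv : sub_of B v.
  split; first by apply: filter_uniq; case: hu.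
  by move=> e; rewrite mem_filter => /andP[_]; case: hu => _; apply.
have -> : pr u x - pr s x = pr v x.
  rewrite /span_proj (bigID (fun e => e \in s)) /=.
  have -> : \sum_(e <- u | e \in s) dot x e *: e = \sum_(e <- s) dot x e *: e.
    rewrite -big_filter; apply: perm_big; apply: uniq_perm.
    - by apply: filter_uniq; case: hu.
    - by case: hs.
    move=> e; rewrite mem_filter; case: (boolP (e \in s)) => //= es.
    by rewrite sub_undupl.
  by rewrite addrC addrK big_filter.
rewrite (eigen_sum_image _ sV lS eS hv).
apply: le_trans (nm_sum _ _ _) _.
apply: (@le_trans _ _ (\sum_(f <- v) l f * nm x)).
  rewrite big_seq [leRHS]big_seq; apply: ler_sum => f fv.
  have nf : nm f = 1.
    apply/eqP; rewrite -(@eqrXn2 _ 2) ?nm_ge0 // expr1n -(dotxx_Re Hdot) oB ?eqxx //;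
      by case: hv => _; apply.
  rewrite nmZ nf mulr1 normcM normc_real ger0_norm //; apply: ler_wpM2l => //.
  by apply: le_trans (CS Hdot _ _) _; rewrite nf mulr1.
rewrite -mulr_suml; apply: ler_wpM2r; first exact: nm_ge0.
by apply: ht => // e; rewrite mem_filter => /andP[].
Qed.

(** The pairs [(f, X f)] expand [X] along the eigenvectors of [|X| = S], and their weights are
    [nm (X f) = nm (S f) = l f]. Partial sums thus have weight at most [t], and tails of the series
    have small weight. *)
Lemma abs_nuc V X S B l (t : R) : csubsp V -> lop V X -> is_abs dot V X S ->
  eigensystem V B S l -> sum_le B l t -> nuc V t X /\ nucl V X.
Proof.
move=> cV hX aX eS ht; have sV := cV.1; have [VX lX _] := hX; have [pS _] := aX.
have [oB0 l0 eSl] := eS; have [BV /osysP oB cB] := oB0.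
pose F s := [seq (f, X f) | f <- s].
have Vs s f : sub_of B s -> f \in s -> V f by move=> [_ sB] /sB; exact: BV.
have iF s : sub_of B s -> ins V (F s).
  by move=> hs _ /mapP[f fs ->] /=; apply: VX; exact: Vs fs.
have frF s x : sub_of B s -> V x -> fr (F s) x = X (pr s x).
  move=> hs vx; rewrite /rank_one_sum big_map /= /span_proj (lin_sum sV lX); last first.
    by move=> f fs _; apply: subZ => //; exact: Vs fs.
  by rewrite big_seq [RHS]big_seq; apply: eq_bigr => f fs; rewrite (linZ sV lX) //; exact: Vs fs.
have wF s : sub_of B s -> wt (F s) = \sum_(f <- s) l f.
  move=> hs; rewrite /wt big_map /= big_seq [RHS]big_seq; apply: eq_bigr => f fs.
  have Bf : B f by case: hs => _; apply.
  have nf : nm f = 1.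
    by apply/eqP; rewrite -(@eqrXn2 _ 2) ?nm_ge0 // expr1n -(dotxx_Re Hdot) oB ?eqxx.
  rewrite nf mul1r (abs_norm Hdot aX sV (Vs _ _ hs fs)) eSl // nmZ nf mulr1.
  by rewrite normc_real ger0_norm.
have close s (d : R) : sub_of B s ->
    (forall s', sub_of B s' -> (forall e, e \in s' -> e \notin s) -> \sum_(f <- s') l f <= d) ->
    opb V (fun x => X x - fr (F s) x) d.
  move=> hs hd x vx.
  have Vp : V (pr s x) by apply: sub_sum => // f fs _; apply: subZ => //; exact: Vs fs.
  rewrite frF // -(linB sV lX) // (abs_norm Hdot aX sV); last exact: subB.
  exact: eigen_tail eS hs hd vx.
split.
  move=> d d0; have [s hs hd] := sum_tail ht d0.
  by exists (F s); split; [exact: iF|rewrite wF //; exact: ht|exact: close].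
split=> // d d0; have [s hs hd] := sum_tail ht d0.
exists (F s); first exact: iF.
move=> d1 d10; have [s1 hs1 hd1] := sum_tail ht d10.
pose u := undup (s ++ s1); have hu : sub_of B u by exact: sub_of_cat.
pose v := [seq f <- u | f \notin s].
have hv : sub_of B v.
  split; first by apply: filter_uniq; case: hu.
  by move=> e; rewrite mem_filter => /andP[_]; case: hu => _; apply.
exists (F v); split; first exact: iF.
  by rewrite wF //; apply: hd => // e; rewrite mem_filter => /andP[].
have hd2 s' : sub_of B s' -> (forall e, e \in s' -> e \notin u) -> \sum_(f <- s') l f <= d1.
  move=> hs' dis; apply: hd1 => // e /dis; apply: contra; exact: sub_undupr.
move=> x vx; have := close u d1 hu hd2 x vx.
suff -> : X x - fr (F u) x = X x - fr (F s) x - fr (F v) x by [].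
rewrite -addrA -opprD; congr (_ - _).
rewrite /rank_one_sum !big_map /= big_filter (bigID (fun e => e \in s)) /=; congr (_ + _).
rewrite -big_filter; apply: perm_big; apply: uniq_perm.
- by apply: filter_uniq; case: hu.
- by case: hs.
move=> e; rewrite mem_filter; case: (boolP (e \in s)) => //= es.
by rewrite sub_undupl.
Qed.

Definition trace_norm_set V X := [set t : \bar R | exists (S : H -> H) (B : set H),
    [/\ is_abs dot V X S, orthonormal_basis dot V B
      & t = (\esum_(e in B) (complex.Re (dot (S e) e))%:E)%E]].

(** A finite value excludes the default [+oo], so it is realized by some [S] and some basis. *)
Lemma trace_norm_mem V X : (trace_norm dot V X < +oo)%E -> trace_norm_set V X (trace_norm dot V X).
Proof.
move=> h; have [[t ht]|nt] := pselect (exists t : \bar R, trace_norm_set V X t).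
  by apply: (@xgetPex _ _ (trace_norm_set V X)); exists t.
move: h; rewrite /trace_norm xgetPN ?ltxx // => t ht; apply: nt; exists t; exact: ht.
Qed.

Lemma trace_norm_nuc V X (t : R) : csubsp V -> lop V X -> (trace_norm dot V X <= t%:E)%E ->
  nuc V t X /\ nucl V X.
Proof.
move=> cV hX ht.
have [S [B [aX oB tE]]] := trace_norm_mem (le_lt_trans ht (ltry t)).
have [pS _] := aX; rewrite tE in ht.
have aS := abs_opapprox Hdot cV pS oB ht.
have [B' [l eS]] := eigensystem_exists Hdot cV pS aS.
apply: (abs_nuc cV hX aX eS) => s hs.
exact: (eigen_sum_le_trace Hdot cV pS eS oB ht hs).
Qed.

(** Used to build [|X|] from its would-be eigenvalues. [S] is the limit of the finite sums
    [D (I n)], where [I n] leaves a tail of at most [2^-n]. *)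
Lemma diagonal_operator V B l (t : R) : csubsp V -> orthonormal_basis dot V B ->
  (forall f, 0 <= l f) -> sum_le B l t -> exists2 S, positive_on dot V S &
  forall f, B f -> S f = (l f)%:C *: f.
Proof.
move=> cV oB0 l0 ht; have sV := cV.1; have [BV /osysP oB cB] := oB0.
have p0 n : 0 < 2^-1 ^+ n :> R by rewrite exprn_gt0.
have /choice[I hI] : forall n : nat, exists s, sub_of B s /\ forall s', sub_of B s' ->
    (forall e, e \in s' -> e \notin s) -> \sum_(f <- s') l f <= 2^-1 ^+ n.
  by move=> n; have [s hs hd] := sum_tail ht (p0 n); exists s.
pose D s x := \sum_(f <- s) ((l f)%:C * dot x f) *: f.
have nf f : B f -> nm f = 1.
  by move=> Bf; apply/eqP; rewrite -(@eqrXn2 _ 2) ?nm_ge0 // expr1n -(dotxx_Re Hdot) oB ?eqxx.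
have bD s x : sub_of B s -> nm (D s x) <= (\sum_(f <- s) l f) * nm x.
  move=> hs; apply: le_trans (nm_sum _ _ _) _; rewrite mulr_suml big_seq [leRHS]big_seq.
  apply: ler_sum => f fs; have n1 : nm f = 1 by apply: nf; case: hs => _; apply.
  rewrite nmZ n1 mulr1 normcM normc_real ger0_norm //; apply: ler_wpM2l => //.
  by apply: le_trans (CS Hdot _ _) _; rewrite n1 mulr1.
(* The common part cancels, and what remains of each list is disjoint from the other, hence a tail
   for it. *)
have diff s u : sub_of B s -> sub_of B u -> exists v w, [/\ sub_of B v, sub_of B w,
   forall e, e \in v -> e \notin u, forall e, e \in w -> e \notin s &
   forall x, D s x - D u x = D v x - D w x].
  move=> hs hu; exists [seq f <- s | f \notin u], [seq f <- u | f \notin s]; split.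
  - split; first by apply: filter_uniq; case: hs.
    by move=> e; rewrite mem_filter => /andP[_]; case: hs => _; apply.
  - split; first by apply: filter_uniq; case: hu.
    by move=> e; rewrite mem_filter => /andP[_]; case: hu => _; apply.
  - by move=> e; rewrite mem_filter => /andP[].
  - by move=> e; rewrite mem_filter => /andP[].
  move=> x; rewrite /D !big_filter (bigID (fun e => e \in u)) /=.
  rewrite [X in _ - X = _](bigID (fun e => e \in s)) /=.
  have -> : \sum_(e <- s | e \in u) ((l e)%:C * dot x e) *: e =
      \sum_(e <- u | e \in s) ((l e)%:C * dot x e) *: e.
    rewrite -[LHS]big_filter -[RHS]big_filter; apply: perm_big; apply: uniq_perm.
    - by apply: filter_uniq; case: hs.
    - by apply: filter_uniq; case: hu.
    by move=> e; rewrite !mem_filter andbC.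
  by rewrite opprD addrACA subrr add0r.
have cau x n m : (n <= m)%N -> nm (D (I n) x - D (I m) x) <= 2 * nm x * 2^-1 ^+ n.
  move=> nm_; have [hn tn] := hI n; have [hm tm] := hI m.
  have [v [w [hv hw dv dw ->]]] := diff _ _ hn hm.
  apply: le_trans (nmB _ _) _.
  have h1 := le_trans (bD v x hv) (ler_wpM2r (nm_ge0 x) (tm v hv dv)).
  have h2 := le_trans (bD w x hw) (ler_wpM2r (nm_ge0 x) (tn w hw dw)).
  have h3 : 2^-1 ^+ m <= 2^-1 ^+ n :> R by apply: ler_wiXn2l => //; lra.
  have := ler_wpM2r (nm_ge0 x) h3; lra.
have /choice[S hS] : forall x, exists y, forall e : R, 0 < e ->
    exists N, forall n, (N <= n)%N -> nm (D (I n) x - y) <= e.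
  move=> x; apply: nm_complete => e e0.
  have [N hN] := half_pow_small (2 * (2 * nm x)) e0.
  exists N => n m Nn Nm; apply: le_trans (nm_tri (D (I N) x) _ _) _.
  rewrite (nmBC (D (I n) x)); have := cau x N n Nn; have := cau x N m Nm.
  have := hN N (leqnn _); lra.
have approx (L : seq H) (e : R) : 0 < e ->
    exists n, forall x, x \in L -> nm (D (I n) x - S x) <= e.
  move=> e0; suff [N hN] : exists N, forall n, (N <= n)%N -> forall x, x \in L -> nm (D (I n) x - S x) <= e.
    by exists N; exact: hN.
  elim: L => [|x L [N ih]]; first by exists 0%N.
  have [N' hN'] := hS x e e0; exists (maxn N N') => n; rewrite geq_max => /andP[h1 h2] y.
  by rewrite inE => /orP[/eqP->|]; [exact: hN'|exact: ih].
have lD s a x y : D s (a *: x + y) = a *: D s x + D s y.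
  rewrite /D scaler_sumr -big_split /=; apply: eq_bigr => f _.
  by rewrite dotDl dotZl scalerA -scalerDl; congr (_ *: _); ring.
have VD s x : sub_of B s -> V (D s x).
  by move=> hs; apply: sub_sum => // f fs _; apply: subZ => //; apply: BV; case: hs => _; apply.
have hIn n : sub_of B (I n) by case: (hI n).
have t0 : 0 <= t by have := ht [::]; rewrite big_nil; apply.
have bS x : nm (S x) <= t * nm x.
  apply: ler_epsM ler01 _ => e e0; have [n hn] := approx [:: x] e e0.
  have := hn x (mem_head _ _); rewrite nmBC => h.
  rewrite -[S x](subrK (D (I n) x)) addrC mul1r; apply: le_trans (nmD _ _) _.
  have := bD _ x (hIn n); have := ler_wpM2r (nm_ge0 x) (ht _ (hIn n)); lra.
exists S.
  split.
    apply/bounded_onP; split.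
    - move=> x vx; apply: cV.2 => e e0; have [n hn] := approx [:: x] e e0.
      exists (D (I n) x); first exact: VD.
      by rewrite nmBC; apply: hn; rewrite mem_head.
    - move=> a x y vx vy; apply/eqP; rewrite -subr_eq0; apply/eqP; apply: nm_eq0.
      apply/eqP; rewrite eq_le nm_ge0 andbT.
      have k0 : 0 <= 2 + normc a by rewrite addr_ge0 ?normc_ge0.
      apply: (ler_epsM k0) => e e0; rewrite add0r.
      have [n hn] := approx [:: a *: x + y; x; y] e e0.
      have h1 := hn (a *: x + y); have h2 := hn x; have h3 := hn y.
      rewrite !inE !eqxx ?orbT in h1 h2 h3.
      have {}h1 := h1 isT; have {}h2 := h2 isT; have {}h3 := h3 isT.
      have -> : S (a *: x + y) - (a *: S x + S y) =
          a *: (D (I n) x - S x) + (D (I n) y - S y) - (D (I n) (a *: x + y) - S (a *: x + y)).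
        by rewrite lD scalerBr addrACA -opprD opprB [RHS]addrC addrA subrK.
      apply: le_trans (nmB _ _) _; have := nmD (a *: (D (I n) x - S x)) (D (I n) y - S y).
      rewrite nmZ; have := ler_wpM2l (normc_ge0 a) h2; lra.
    - by exists t.
  move=> x vx; have Dp n : 0 <= dot (D (I n) x) x.
    rewrite dot_suml; apply: sumr_ge0 => f _.
    rewrite dotZl [dot f x]dotC -mulrA mul_conjC_normc -rmorphM ler0c.
    by rewrite mulr_ge0 // sqr_ge0.
  have lim (e : R) : 0 < e -> exists n, normc (dot (D (I n) x) x - dot (S x) x) <= e.
    move=> e0; have n0 : 0 < nm x + 1 by have := nm_ge0 x; lra.
    have [n hn] := approx [:: x] _ (divr_gt0 e0 n0); exists n.
    rewrite -dotBl; apply: le_trans (CS Hdot _ _) _.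
    apply: le_trans (ler_wpM2r (nm_ge0 _) (hn x (mem_head _ _))) _.
    rewrite mulrAC ler_pdivrMr //; apply: ler_wpM2l; first exact: ltW.
    by rewrite lerDl.
  rewrite lecE /=; apply/andP; split.
    rewrite -normr_eq0 eq_le normr_ge0 andbT; apply: ler_eps => e e0; rewrite add0r.
    have [n hn] := lim e e0; apply: le_trans hn; rewrite (ge0_Re (Dp n)).
    case: (dot (S x) x) => p q /=; rewrite sub0r sqrrN.
    by rewrite -[`|q|]sqrtr_sqr ler_wsqrtr // lerDr sqr_ge0.
  apply: ler_eps => e e0; have [n hn] := lim e e0.
  have := le_trans (normc_ge_Re _) hn; rewrite ReB ler_norml => /andP[_].
  have := Re_ge0 (Dp n); lra.
move=> f Bf; apply/eqP; rewrite -subr_eq0; apply/eqP; apply: nm_eq0.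
apply/eqP; rewrite eq_le nm_ge0 andbT; apply: (@ler_epsM _ _ _ 2) => // e e0; rewrite add0r.
have [N hN] := half_pow_small 1 e0; have [N' hN'] := hS f e e0.
have {}hN := hN _ (leq_maxl N N'); have {}hN' := hN' _ (leq_maxr N N').
move: (maxn N N') hN hN' => n hN hN'.
rewrite nmBC -[(l f)%:C *: f](subrK (D (I n) f)) -addrA; apply: le_trans (nmD _ _) _.
suff : nm ((l f)%:C *: f - D (I n) f) <= 2^-1 ^+ n by lra.
(* If [f] occurs in [I n], the finite sum is exact at [f]; otherwise [[:: f]] is itself a tail, so
   [l f <= 2^-1 ^+ n]. *)
have [hn tn] := hI n; have [fI|nfI] := boolP (f \in I n).
  have -> : D (I n) f = (l f)%:C *: f.
    rewrite /D (big_rem f) //= oB // eqxx mulr1 big_seq big1 ?addr0 // => g.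
    rewrite mem_rem_uniq; last by case: hn.
    move=> /andP[gf gI]; rewrite oB //; last by case: hn => _; apply.
    by rewrite eq_sym (negbTE gf) mulr0 scale0r.
  by rewrite subrr nm0 ltW.
have -> : D (I n) f = 0.
  rewrite /D big_seq big1 // => g gI; rewrite oB //; last by case: hn => _; apply.
  have [fg|_] := eqVneq f g; first by rewrite fg gI in nfI.
  by rewrite mulr0 scale0r.
rewrite subr0 nmZ nf // mulr1 normc_real ger0_norm //.
have := tn [:: f]; rewrite big_seq1; apply.
  by split=> // e1; rewrite inE => /eqP ->.
by move=> e1; rewrite inE => /eqP ->.
Qed.

End TraceNormNuclear.

(** * The trace norm is bounded by the nuclear norm *)

Section NuclearTraceNorm.
Variables (R : realType) (H : completeNormedModType R[i]).
Variable dot : {dot H for conjC}.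
Hypothesis Hdot : dot_induces_norm dot.
Local Notation C := R[i].
Local Notation normc := (@Normc.normc R).
Local Notation fr := (rank_one_sum dot).
Local Notation pr := (span_proj dot).
Local Notation nuc := (nuc dot).
Local Notation nucl := (nucl dot).
Local Notation isdet := (isdet dot).
Local Notation eigensystem := (eigensystem dot).
Implicit Types (x y z e f : H) (V W B : set H) (T S X G K : H -> H) (s t : seq H).

(* AM-GM with the weights [nm b / nm a], so that Bessel's inequality applies to both factors. *)
Lemma bessel_pair B s (g : H -> H) a b : osys dot B -> sub_of B s ->
  {in s &, forall e f, dot (g e) (g f) = (e == f)%:R} ->
  \sum_(f <- s) normc (dot f a) * normc (dot b (g f)) <= nm a * nm b.
Proof.
move=> oB hs og.
have [us sB] := hs.
have h1 : \sum_(f <- s) normc (dot f a) ^+ 2 <= nm a ^+ 2.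
  apply: le_trans (bessel Hdot a oB hs).
  by apply: ler_sum => f _; rewrite dotC normc_conj.
have h2 : \sum_(f <- s) normc (dot b (g f)) ^+ 2 <= nm b ^+ 2.
  have oG : osys dot [set g f | f in [set` s]].
    move=> _ _ [e /= es <-] [f /= fs <-]; rewrite og //.
    have [->|ef] := eqVneq e f; first by rewrite eqxx.
    case: eqP => // gef; have := og e f es fs; rewrite gef (og f f) // eqxx (negbTE ef).
    by move/eqP; rewrite oner_eq0.
  have hG : sub_of [set g f | f in [set` s]] (map g s).
    split; last by move=> _ /mapP[f fs ->]; exists f.
    rewrite map_inj_in_uniq // => e f es fs gef; apply/eqP; apply: contraT => ef.
    have := og e f es fs; rewrite gef (og f f) // eqxx (negbTE ef).
    by move/eqP; rewrite oner_eq0.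
  by have := bessel Hdot b oG hG; rewrite big_map.
have [a0|aN] := eqVneq (nm a) 0.
  rewrite a0 mul0r big1 // => f _.
  by rewrite (nm_eq0 a0) dot0r normc0 mul0r.
have [b0|bN] := eqVneq (nm b) 0.
  rewrite b0 mulr0 big1 // => f _.
  by rewrite (nm_eq0 b0) dot0l normc0 mulr0.
have ap : 0 < nm a by rewrite lt_def aN nm_ge0.
have bp : 0 < nm b by rewrite lt_def bN nm_ge0.
pose c := nm b / nm a; have cp : 0 < c by rewrite divr_gt0.
have amgm (u v : R) : u * v <= c / 2 * u ^+ 2 + c^-1 / 2 * v ^+ 2.
  have := sqr_ge0 (c * u - v).
  have -> : (c * u - v) ^+ 2 = 2 * c * (c / 2 * u ^+ 2 + c^-1 / 2 * v ^+ 2 - u * v).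
    by field; rewrite gt_eqF.
  by rewrite pmulr_rge0 ?subr_ge0 // mulr_gt0.
apply: (@le_trans _ _ (\sum_(f <- s) (c / 2 * normc (dot f a) ^+ 2 + c^-1 / 2 * normc (dot b (g f)) ^+ 2))).
  by apply: ler_sum => f _; exact: amgm.
rewrite big_split /= -!mulr_sumr.
have c2 : 0 <= c / 2 by rewrite divr_ge0 // ltW.
have c3 : 0 <= c^-1 / 2 by rewrite divr_ge0 // invr_ge0 ltW.
apply: le_trans (lerD (ler_wpM2l c2 h1) (ler_wpM2l c3 h2)) _.
rewrite le_eqVlt; apply/orP; left; apply/eqP; rewrite /c; field.
by rewrite aN bN.
Qed.

(** [hX] says that the [f] in [B] are singular vectors with singular values [l f]. Then
    [g f = X f / l f] is orthonormal and [l f = <X f, g f>]; replacing [X] by an approximating list,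
    [bessel_pair] bounds the sum pair by pair. *)
Lemma nuc_eigen_sum V X B (l : H -> R) s (tau : R) : nuc V tau X -> osys dot B -> B `<=` V ->
  sub_of B s -> (forall f, 0 <= l f) ->
  (forall e f, B e -> B f -> dot (X e) (X f) = (l f ^+ 2)%:C * dot e f) ->
  \sum_(f <- s) l f <= tau.
Proof.
move=> nX oB BV hs l0 hX.
(* Zero singular values contribute nothing, and [g] is not normalized there. *)
pose s1 := [seq f <- s | l f != 0].
have -> : \sum_(f <- s) l f = \sum_(f <- s1) l f.
  rewrite big_filter (bigID (fun f => l f != 0)) /= [X in _ + X]big1 ?addr0 //.
  by move=> f; rewrite negbK => /eqP.
have hs1 : sub_of B s1.
  split; first by apply: filter_uniq; case: hs.
  by move=> e; rewrite mem_filter => /andP[_]; case: hs => _; apply.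
have ln0 f : f \in s1 -> l f != 0 by rewrite mem_filter => /andP[].
have Bs f : f \in s1 -> B f by case: hs1 => _; apply.
pose g f := (l f)^-1%:C *: X f.
have og : {in s1 &, forall e f, dot (g e) (g f) = (e == f)%:R}.
  move=> e f es fs; rewrite dotZl dotZr conjC_real hX ?oB; [|exact: Bs..].
  have [<-|] := eqVneq e f; last by rewrite !mulr0.
  rewrite mulr1 -!rmorphM -[1%:R](rmorph1 (real_complex R)); congr (_%:C).
  by field; exact: ln0.
have lE f : f \in s1 -> l f = complex.Re (dot (X f) (g f)).
  move=> fs; rewrite dotZr conjC_real ReMl hX ?oB ?eqxx; [|exact: Bs..].
  by rewrite mulr1 /=; field; exact: ln0.
have k0 : 0 <= (size s1)%:R :> R by [].
apply: (ler_epsM k0) => d d0; have [q [iV wq bq]] := nX d d0.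
have ng f : f \in s1 -> nm (g f) = 1.
  by move=> fs; apply/eqP; rewrite -(@eqrXn2 _ 2) ?nm_ge0 // expr1n -(dotxx_Re Hdot) og ?eqxx.
have nf f : f \in s1 -> nm f = 1.
  move=> fs; apply/eqP; rewrite -(@eqrXn2 _ 2) ?nm_ge0 // expr1n -(dotxx_Re Hdot).
  by rewrite oB ?eqxx //; exact: Bs.
apply: (@le_trans _ _ (\sum_(f <- s1) (normc (dot (fr q f) (g f)) + d))).
  rewrite big_seq [leRHS]big_seq; apply: ler_sum => f fs; rewrite lE //.
  apply: le_trans (ler_norm _) _; apply: le_trans (normc_ge_Re _) _.
  rewrite -[X f](subrK (fr q f)) dotDl; apply: le_trans (normcD _ _) _.
  rewrite [leLHS]addrC lerD2l; apply: le_trans (CS Hdot _ _) _; rewrite ng // mulr1.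
  by apply: le_trans (bq _ (BV _ (Bs _ fs))) _; rewrite nf // mulr1.
rewrite big_split /= big_const_seq count_predT iter_addr_0 -[d *+ _]mulr_natl lerD2r.
apply: le_trans wq; rewrite /wt.
apply: (@le_trans _ _ (\sum_(f <- s1) \sum_(p <- q) normc (dot f p.1) * normc (dot p.2 (g f)))).
  apply: ler_sum => f _; rewrite /rank_one_sum dot_suml; apply: le_trans (normc_sum _ _ _) _.
  by apply: ler_sum => p _; rewrite dotZl normcM.
rewrite exchange_big /=; apply: ler_sum => p _.
exact: (bessel_pair _ _ oB hs1 og).
Qed.

(** [X^* X] is diagonalized first, and [l] is the square root of its eigenvalues. Since [trace_norm]
    may select any admissible [S] and basis, every [S] with [S^2 = X^* X] must be shown to be
    diagonal with entries [l]; [diagonal_operator] shows that one exists, so the default [+oo] is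
    not taken. *)
Lemma nuc_trace_norm V X (tau : R) : csubsp V -> lop V X -> nuc V tau X ->
  (trace_norm dot V X <= tau%:E)%E.
Proof.
move=> cV hX nX; have sV := cV.1; have [VX lX [M M0 bX]] := hX.
have [Xs [VXs aXs lXs bXs]] := adjoint_exists Hdot cV M0 lX bX.
pose Q x := Xs (X x).
have QE x y : V x -> V y -> dot (Q x) y = dot (X x) (X y).
  by move=> vx vy; rewrite dotC -aXs // -dotC.
have pQ : positive_on dot V Q.
  split; last by move=> x vx; rewrite QE // (dotxx Hdot) ler0c sqr_ge0.
  apply/bounded_onP; split.
  - by move=> x vx; exact: VXs.
  - by move=> a x y vx vy; rewrite /Q lX // lXs.
  exists (M * M); first exact: mulr_ge0.
  move=> x vx; apply: le_trans (bXs _) _; rewrite -mulrA; apply: ler_wpM2l => //; exact: bX.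
have lXs' : linear_on setT Xs by move=> a x y _ _; exact: lXs.
have aQ : opapprox dot V Q.
  move=> d d0; have d'0 : 0 < d / (M + 1) by rewrite divr_gt0 //; lra.
  have [s [iV ws bs]] := nX _ d'0; exists (mapfr Xs s).
    by apply: (@ins_map _ _ setT) => // x _; exact: VXs.
  move=> x vx; rewrite (fr_map dot (V := setT) x) // -(linB (@subspT R H) lXs') //.
  apply: le_trans (bXs _) _; apply: le_trans (ler_wpM2l M0 (bs _ vx)) _.
  rewrite mulrA; apply: ler_wpM2r; first exact: nm_ge0.
  rewrite mulrCA; apply: ler_piMr; first exact: ltW.
  by rewrite ler_pdivrMr; lra.
have [B [m eQ]] := eigensystem_exists Hdot cV pQ aQ.
have [oB0 m0 eQm] := eQ; have [BV /osysP oB cB] := oB0.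
pose l f := Num.sqrt (m f).
have l0 f : 0 <= l f by exact: sqrtr_ge0.
have l2 f : l f ^+ 2 = m f by rewrite sqr_sqrtr.
have hsum : sum_le B l tau.
  move=> s hs; apply: (nuc_eigen_sum nX oB BV hs l0) => e f Be Bf.
  rewrite l2 -QE; [|exact: BV..].
  by rewrite (positive_sym sV pQ) ?eQm ?dotZr ?conjC_real //; exact: BV.
(* Uniqueness of the positive square root: [y = S f - l f f] satisfies [S y = - l f y], and
   positivity of [S] forces [y = 0] when [l f > 0]. When [l f = 0],
   [<S f, S f> = <S (S f), f> = 0]. *)
have absE S : is_abs dot V X S -> forall f, B f -> S f = (l f)%:C *: f.
  move=> [pS hS] f Bf; have [[VS lS bS] pSx] := pS; have vf := BV _ Bf.
  have SS : S (S f) = (m f)%:C *: f.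
    apply/eqP; rewrite -subr_eq0; apply/eqP; apply: (dot_eq0 Hdot).
    have vd : V (S (S f) - (m f)%:C *: f).
      by apply: (subB sV); [exact: (VS _ (VS _ vf))|exact: subZ].
    move: vd; set u := _ - _ in |- * => vd.
    by rewrite {1}/u dotBl hS // -eQm // QE // subrr.
  have vS := VS _ vf.
  have [lf0|lfn0] := eqVneq (l f) 0.
    rewrite lf0 scale0r; apply: (dot_eq0 Hdot).
    by rewrite -(positive_sym sV pS) // SS -l2 lf0 expr0n scale0r dot0l.
  apply/eqP; rewrite -subr_eq0; apply/eqP; apply: (dot_eq0 Hdot).
  set y := _ - _; have vy : V y by apply: subB => //; exact: subZ.
  have Sy : S y = - (l f)%:C *: y.
    rewrite /y (linB sV lS) //; last exact: subZ.
    rewrite (linZ sV lS) // SS -l2 rmorphXn /= scaleNr scalerBr opprB.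
    by rewrite scalerA -expr2.
  have := pSx _ vy; rewrite Sy dotZl (dotxx Hdot) -rmorphN -rmorphM ler0c.
  rewrite mulNr oppr_ge0 pmulr_rle0; last by rewrite lt_def lfn0 l0.
  by move=> h; congr (_%:C); apply/eqP; rewrite eq_le h sqr_ge0.
have [S pS eS] := diagonal_operator Hdot cV oB0 l0 hsum.
have [/bounded_onP lopS _] := pS; have [VS lS _] := lopS.
have aS : is_abs dot V X S.
  split=> // x y vx vy; rewrite -QE //; congr (dot _ y).
  have [/bounded_onP lopQ _] := pQ.
  apply: (opb_onb Hdot cV oB0 (lop_comp lopS lopS) lopQ) => // f Bf.
  by rewrite (eS _ Bf) (linZ sV lS _ (BV _ Bf)) (eS _ Bf) scalerA -rmorphM -expr2 l2 eQm.
have : trace_norm_set dot V X (trace_norm dot V X).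
  by apply: (@xgetPex _ _ (trace_norm_set dot V X)); exists (\esum_(e in B) (complex.Re (dot (S e) e))%:E)%E, S, B.
move=> [S' [B' [aS' oB' ->]]].
have pS' := aS'.1.
apply: (trace_le_eigen_sum Hdot cV pS' _ oB' hsum).
by split=> // f Bf; exact: absE.
Qed.

(** The coefficients of [F x] along the dual basis of the range are inner products of [x] with
    images under the adjoint of [F]. *)
Lemma finite_rank_fr V F : csubsp V -> finite_rank V F ->
  exists2 s, ins V s & forall x, V x -> F x = fr s x.
Proof.
move=> cV [/bounded_onP[VF lF [M M0 bF]] [n [e be]]]; have sV := cV.1.
have [e' [We he]] := dual_basis Hdot be.
have WV x : (F @` V) x -> V x by move=> [y vy <-]; exact: VF.
have [Fs [VFs aFs lFs _]] := adjoint_exists Hdot cV M0 lF bF.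
exists [seq (Fs (e' i), e i) | i <- enum 'I_n].
  by move=> _ /mapP[i _ ->] /=; apply: WV; exact: basis_in be.
move=> x vx; have wx : (F @` V) (F x) by exists x.
rewrite (dual_basisE be he wx) /rank_one_sum big_map big_enum /=.
by apply: eq_bigr => i _; rewrite aFs.
Qed.

Lemma findim_det_fr V (F : H -> H) (s : seq (H * H)) : csubsp V -> finite_rank V F -> ins V s ->
  (forall x, V x -> F x = fr s x) -> findim_det (F @` V) (fun x => x - F x) = dfr dot s.
Proof.
move=> cV [/bounded_onP[VF lF _] hdim] iV h; have sV := cV.1.
apply: (findim_detE sV) => //; first by move=> _ [x vx <-]; exact: VF.
have h' x : V x -> fr s x = F x by move=> vx; rewrite h.
exact: (detval_ext h' (dfrP dot sV iV)).
Qed.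

Lemma isdet_fredholm V T d : csubsp V -> lop V T -> isdet V T d -> is_fredholm_det dot V T d.
Proof.
move=> cV hT hd eps eps0; have e20 : 0 < eps / 2 by lra.
have [delta d0 hde] := hd _ e20; exists delta => // F frF htn.
have [s iV hs] := finite_rank_fr cV frF.
rewrite (findim_det_fr cV frF iV hs) normcE ltcR.
apply: le_lt_trans (hde s iV _) _; last lra.
have [hF _] := frF; move/bounded_onP: hF => lopF.
have [nT _] := trace_norm_nuc Hdot cV (lopB cV.1 hT lopF) (ltW htn).
by apply: nuc_ext nT => x vx; rewrite hs.
Qed.

End NuclearTraceNorm.

(** * Multiplicativity and block decomposition *)

Section FredholmDeterminantValue.
Variables (R : realType) (H : completeNormedModType R[i]).
Variable dot : {dot H for conjC}.
Hypothesis Hdot : dot_induces_norm dot.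
Local Notation C := R[i].
Local Notation normc := (@Normc.normc R).
Local Notation fr := (rank_one_sum dot).
Local Notation nuc := (nuc dot).
Local Notation nucl := (nucl dot).
Local Notation isdet := (isdet dot).
Local Notation dfr := (dfr dot).
Implicit Types (x y z : H) (V W U : set H) (T S X G K Q A : H -> H) (s t : seq (H * H)).

Definition free_family n (u : 'I_n -> H) := injective (lin_comb u).

Lemma free_extend n (u : 'I_n -> H) x : free_family u -> ~ range (lin_comb u) x ->
  free_family (fun i : 'I_n.+1 => oapp u x (unlift ord0 i)).
Proof.
move=> fu nx; pose u' := fun i : 'I_n.+1 => oapp u x (unlift ord0 i).
have uE (c : 'rV_n.+1) : lin_comb u' c = c 0 ord0 *: x + lin_comb u (\row_i c 0 (lift ord0 i)).
  rewrite /lin_comb big_ord_recl /u' unlift_none; congr (_ + _).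
  by apply: eq_bigr => i _; rewrite mxE liftK.
move=> c d; rewrite -/u' !uE => ecd.
have [e0|n0] := eqVneq (c 0 ord0) (d 0 ord0).
  move: ecd; rewrite e0 => /addrI /fu /rowP ecd.
  apply/rowP => i; case: (unliftP ord0 i) => [j|] -> //.
  by have := ecd j; rewrite !mxE.
case: nx.
exists ((c 0 ord0 - d 0 ord0)^-1 *: (-1 *: (\row_i c 0 (lift ord0 i)) + \row_i d 0 (lift ord0 i))) => //.
rewrite -[_^-1 *: _]addr0 lin_comb_linear [lin_comb u 0]big1 ?addr0; last first.
  by move=> i _; rewrite mxE scale0r.
rewrite lin_comb_linear scaleN1r.
have -> : - lin_comb u (\row_i c 0 (lift ord0 i)) + lin_comb u (\row_i d 0 (lift ord0 i)) =
   (c 0 ord0 - d 0 ord0) *: x.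
  rewrite scalerBl.
  have -> : lin_comb u (\row_i d 0 (lift ord0 i)) =
      c 0 ord0 *: x + lin_comb u (\row_i c 0 (lift ord0 i)) - d 0 ord0 *: x.
    by rewrite ecd addrC addKr.
  by rewrite [X in X - _]addrC addrA addKr.
by rewrite scalerA mulVf ?scale1r // subr_eq0.
Qed.

Lemma free_family_le n m (b : 'I_n -> H) (u : 'I_m -> H) : free_family u ->
  (forall i, range (lin_comb b) (u i)) -> (m <= n)%N.
Proof.
move=> fu hu; have /choice[M hM] : forall i, exists c, lin_comb b c = u i.
  by move=> i; have [c _ <-] := hu i; exists c.
pose A : 'M[C]_(m, n) := \matrix_i M i.
have lA (c : 'rV_m) : lin_comb b (c *m A) = lin_comb u c.
  have ls (I : Type) (r : seq I) (F : I -> 'rV[C]_n) :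
      lin_comb b (\sum_(i <- r) F i) = \sum_(i <- r) lin_comb b (F i).
    elim: r => [|i r ih].
      by rewrite !big_nil /lin_comb big1 // => i _; rewrite mxE scale0r.
    by rewrite !big_cons -[F i in LHS]scale1r lin_comb_linear scale1r ih.
  rewrite mulmx_sum_row ls; apply: eq_bigr => i _.
  rewrite -[_ *: row i A]addr0 lin_comb_linear [lin_comb b 0]big1 ?addr0; last first.
    by move=> j _; rewrite mxE scale0r.
  by rewrite rowK hM.
have : row_free A.
  apply/inj_row_free => v hv; apply: fu; rewrite -!lA hv mul0mx //.
by move=> /eqP <-; exact: rank_leq_col.
Qed.

(** A free family in [U] of maximal size is a basis: its size is bounded by [n], and a vector
    outside its span would extend it. This provides the dimension demanded by [finite_rank]. *)
Lemma subspace_dim n (b : 'I_n -> H) U : subsp U -> U `<=` range (lin_comb b) ->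
  exists m, has_dim U m.
Proof.
move=> sU Ub.
pose P m := `[< exists u : 'I_m -> H, free_family u /\ forall i, U (u i) >].
have P0 : exists m, P m.
  exists 0%N; apply/asboolP; exists (fun=> 0); split; last by case.
  by move=> c d _; apply/rowP => -[].
have Pn m : P m -> (m <= n)%N.
  move=> /asboolP[u [fu hu]]; apply: (free_family_le (b := b) fu) => i.
  exact: Ub.
case: (ex_maxnP P0 Pn) => m /asboolP[u [fu hu]] hmax.
exists m, u; split.
- by move=> c _; apply: sub_sum => // i _ _; exact: subZ.
- by move=> c d _ _; exact: fu.
move=> x Ux; apply: contrapT => nx.
have : P m.+1.
  apply/asboolP; exists (fun i : 'I_m.+1 => oapp u x (unlift ord0 i)); split.
    by apply: free_extend => // -[c _ hc]; apply: nx; exists c.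
  by move=> i; case: (unliftP ord0 i) => [j|] _ /=.
by move=> /hmax; rewrite ltnn.
Qed.

Lemma fr_finite_rank V s : subsp V -> ins V s -> finite_rank V (fr s).
Proof.
move=> sV iV; split; first exact/bounded_onP/(fr_lop Hdot).
apply: (@subspace_dim _ (fun i => (tnth (in_tuple s) i).2)).
  split; first by exists 0; [exact: sub0|rewrite (lin0 sV (@linear_on_fr _ _ dot V s))].
  by move=> a _ _ [x vx <-] [y vy <-]; exists (a *: x + y); [exact: sV.2|rewrite fr_linear].
move=> _ [x vx <-]; exists (\row_i dot x (tnth (in_tuple s) i).1) => //.
by rewrite big_frE; apply: eq_bigr => i _; rewrite mxE.
Qed.

(** Two values satisfying [is_fredholm_det] agree as soon as one finite-rank operator is close to
    [T] in trace norm for both; [nuc_trace_norm] turns a nuclear approximant into such an operator.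
    The non-strict bound it gives is why [m] is half the minimum. *)
Lemma fredholm_detE V T d : csubsp V -> nucl V T -> isdet V T d -> fredholm_det dot V T = d.
Proof.
move=> cV hT hd; have sV := cV.1; have [lopT aT] := hT.
have h0 := isdet_fredholm Hdot cV lopT hd.
have h1 : is_fredholm_det dot V T (fredholm_det dot V T).
  by apply: (@xgetPex _ _ [set d | is_fredholm_det dot V T d]); exists d.
apply/eqP; rewrite -subr_eq0; apply/eqP; apply: normc_small => e e0.
have e20 : 0 < e / 2 by lra.
have [d1 d10 hd1] := h0 _ e20; have [d2 d20 hd2] := h1 _ e20.
pose m := Num.min d1 d2 / 2; have m0 : 0 < m by rewrite divr_gt0 // lt_min d10.
have [s iV ns] := aT _ m0.
have lopd : lop V (fun x => T x - fr s x) by apply: lopB => //; exact: fr_lop.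
have tn := nuc_trace_norm Hdot cV lopd ns.
have mm : m < Num.min d1 d2 by rewrite /m ltr_pdivrMr // ltr_pMr ?lt_min ?d10 //; lra.
have frs := fr_finite_rank sV iV.
have md1 : m < d1 by apply: lt_le_trans mm _; rewrite ge_min lexx.
have md2 : m < d2 by apply: lt_le_trans mm _; rewrite ge_min lexx orbT.
have := hd1 _ frs (le_lt_trans tn (_ : m%:E < d1%:E)%E).
rewrite lte_fin => /(_ md1).
have := hd2 _ frs (le_lt_trans tn (_ : m%:E < d2%:E)%E).
rewrite lte_fin => /(_ md2).
rewrite !normcE !ltcR; set q := findim_det _ _ => h2 h3.
have -> : fredholm_det dot V T - d = (q - d) - (q - fredholm_det dot V T) by ring.
by apply: le_trans (normcB _ _) _; lra.
Qed.

Lemma fredholm_det_isdet V T : csubsp V -> nucl V T -> isdet V T (fredholm_det dot V T).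
Proof.
by move=> cV hT; have [d hd] := isdet_exists Hdot cV hT; rewrite (fredholm_detE cV hT hd).
Qed.

Lemma nucl_mulB V S T : subsp V -> nucl V S -> nucl V T -> nucl V (fun x => S x + T x - S (T x)).
Proof.
move=> sV hS hT.
exact: (nuclB sV (nuclD sV hS hT) (nucl_map sV hS.1 hT)).
Qed.

Lemma fredholm_det_mul V S T : csubsp V -> nucl V S -> nucl V T ->
  fredholm_det dot V (fun x => S x + T x - S (T x)) =
  fredholm_det dot V S * fredholm_det dot V T.
Proof.
move=> cV hS hT; apply: (isdet_mul Hdot cV hS hT); try exact: fredholm_det_isdet.
apply: fredholm_det_isdet => //; exact: nucl_mulB cV.1 hS hT.
Qed.

Lemma fredholm_det_ext V S T : csubsp V -> nucl V S -> (forall x, V x -> S x = T x) ->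
  fredholm_det dot V S = fredholm_det dot V T.
Proof.
move=> cV hS h; apply/esym/fredholm_detE => //; first exact: nucl_ext cV.1 h hS.
by apply: isdet_ext h _; exact: fredholm_det_isdet.
Qed.

Lemma fredholm_det_fr V s d : csubsp V -> ins V s -> detval V (fr s) d ->
  fredholm_det dot V (fr s) = d.
Proof.
move=> cV iV hd; rewrite (fredholm_detE cV (nucl_fr Hdot cV.1 iV) (isdet_fr Hdot cV iV)).
exact: dfrE cV.1 iV hd.
Qed.

Lemma fredholm_det_small V T (tau : R) : csubsp V -> nucl V T -> nuc V tau T -> tau <= 1 / 8 ->
  normc (fredholm_det dot V T - 1) <= 4 * tau.
Proof.
move=> cV hT nT ht; apply: (isdet_small Hdot cV _ hT (fredholm_det_isdet cV hT) nT ht).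
by have [[]] := hT.
Qed.

Lemma trace_class_nucl V T : csubsp V -> trace_class dot V T -> nucl V T.
Proof.
move=> cV [/bounded_onP lopT htn].
have [t ht] : exists t : R, (trace_norm dot V T <= t%:E)%E.
  case: (trace_norm dot V T) htn => [t _|//|_]; first by exists t.
  by exists 0; exact: leNye.
by have [] := trace_norm_nuc Hdot cV lopT ht.
Qed.

Lemma nuc_map_to W L (M tau : R) T : subsp W -> 0 <= M -> (forall x, W (L x)) ->
  linear_on setT L -> opb setT L M -> nuc setT tau T -> nuc W (M * tau) (fun x => L (T x)).
Proof.
move=> sW M0 WL lL bL nT e e0.
have e' : 0 < e / (M + 1) by rewrite divr_gt0 //; lra.
have [s [iV ws bs]] := nT _ e'; exists (mapfr L s); split.
- by apply: (@ins_map _ _ setT).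
- by apply: le_trans (wt_map bL iV) _; exact: ler_wpM2l.
move=> x wx; rewrite (fr_map dot (V := setT) x) // -(linB (@subspT R H) lL) //.
apply: le_trans (bL _ I) _; apply: le_trans (ler_wpM2l M0 (bs x I)) _.
rewrite mulrA; apply: ler_wpM2r; first exact: nm_ge0.
rewrite mulrCA; apply: ler_piMr; first exact: ltW.
by rewrite ler_pdivrMr; lra.
Qed.

Definition premap T s := [seq (T p.1, p.2) | p <- s].

Lemma fr_premap T Ts s x : (forall y z, dot (T y) z = dot y (Ts z)) ->
  fr (premap Ts s) x = fr s (T x).
Proof. by move=> hT; rewrite /rank_one_sum big_map; apply: eq_bigr => p _; rewrite hT. Qed.

Lemma wt_premap T M s : (forall x, nm (T x) <= M * nm x) -> wt (premap T s) <= M * wt s.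
Proof.
move=> bT; rewrite /wt big_map mulr_sumr; apply: ler_sum => p _.
by rewrite mulrA; apply: ler_wpM2r; [exact: nm_ge0|exact: bT].
Qed.

Lemma nuc_comp_r T Q (M tau : R) : 0 <= M -> linear_on setT Q -> opb setT Q M ->
  nuc setT tau T -> nuc setT (M * tau) (fun x => T (Q x)).
Proof.
move=> M0 lQ bQ nT e e0.
have [Qs [_ aQs _ bQs]] := adjoint_exists Hdot (csubspT H) M0 lQ bQ.
have e' : 0 < e / (M + 1) by rewrite divr_gt0 //; lra.
have [s [iV ws bs]] := nT _ e'; exists (premap Qs s); split=> //.
- by apply: le_trans (wt_premap _ bQs) _; exact: ler_wpM2l.
move=> x _; rewrite (fr_premap (T := Q)); last by move=> y z; exact: aQs.
apply: le_trans (bs _ I) _; apply: le_trans (ler_wpM2l (ltW e') (bQ x I)) _.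
rewrite mulrA; apply: ler_wpM2r; first exact: nm_ge0.
rewrite mulrC mulrCA; apply: ler_piMr; first exact: ltW.
by rewrite ler_pdivrMr; lra.
Qed.

Section Compression.
Variables (Q : H -> H).
Hypotheses (lopQ : lop setT Q) (QQ : forall x, Q (Q x) = Q x).

Lemma proj_range_csubsp : csubsp (range Q).
Proof.
have [_ lQ [M M0 bQ]] := lopQ; split; first split.
- by exists 0 => //; rewrite (lin0 (@subspT R H) lQ).
- by move=> a _ _ [x _ <-] [y _ <-]; exists (a *: x + y) => //; exact: lQ.
move=> x hx; exists x => //; apply/eqP; rewrite -subr_eq0; apply/eqP; apply: nm_eq0.
apply/eqP; rewrite eq_le nm_ge0 andbT.
have k0 : 0 <= 1 + M by rewrite addr_ge0.
apply: (ler_epsM k0) => e e0; rewrite add0r; have [_ [y _ <-] hy] := hx e e0.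
have -> : Q x - x = Q (x - Q y) - (x - Q y).
  by rewrite (linB (@subspT R H) lQ) // QQ opprB addrA subrK.
apply: le_trans (nmB _ _) _; rewrite mulrDl mul1r addrC; apply: lerD => //.
by apply: le_trans (bQ _ I) _; exact: ler_wpM2l.
Qed.

Lemma proj_range_id x : range Q x -> Q x = x.
Proof. by move=> [y _ <-]. Qed.

Lemma nucl_compress T : nucl setT T -> nucl (range Q) (fun x => Q (T x)).
Proof.
move=> [[_ lT [N N0 bT]] hT]; have [_ lQ [M M0 bQ]] := lopQ; split.
  split.
  - by move=> x _; exists (T x).
  - by move=> a x y _ _; rewrite lT // lQ.
  exists (M * N); first exact: mulr_ge0.
  move=> x _; apply: le_trans (bQ _ I) _; rewrite -mulrA; apply: ler_wpM2l => //.
  exact: bT.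
move=> e e0; have e' : 0 < e / (M + 1) by rewrite divr_gt0 //; lra.
have [s iV ns] := hT _ e'; exists (mapfr Q s).
  by apply: (@ins_map _ _ setT) => // x _; exists x.
have h : M * (e / (M + 1)) <= e.
  rewrite mulrCA; apply: ler_piMr; first exact: ltW.
  by rewrite ler_pdivrMr; lra.
have QR x : range Q (Q x) by exists x.
apply: nuc_le h _; apply: nuc_ext (nuc_map_to proj_range_csubsp.1 M0 QR lQ bQ ns) => x _.
by rewrite (fr_map dot (V := setT) x) // -(linB (@subspT R H) lQ).
Qed.

Lemma nucl_comp_r T : nucl setT T -> nucl setT (fun x => T (Q x)).
Proof.
move=> [lopT hT]; have [_ lQ [M M0 bQ]] := lopQ; split; first exact: lop_comp.
have [Qs [_ aQs _ bQs]] := adjoint_exists Hdot (csubspT H) M0 lQ bQ.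
move=> e e0; have e' : 0 < e / (M + 1) by rewrite divr_gt0 //; lra.
have [s iV ns] := hT _ e'; exists (premap Qs s) => //.
have h : M * (e / (M + 1)) <= e.
  rewrite mulrCA; apply: ler_piMr; first exact: ltW.
  by rewrite ler_pdivrMr; lra.
apply: nuc_le h _; apply: nuc_ext (nuc_comp_r M0 lQ bQ ns) => x _.
by rewrite (fr_premap (T := Q)) // => y z; exact: aQs.
Qed.

(** A list [s2] approximating the operator on [range Q], precomposed with [Q], gives a list [s1]
    approximating it on [H]. Both have the same matrix, because [Q] fixes the second components of
    [s2]. *)
Lemma fredholm_det_compress T : nucl setT T ->
  fredholm_det dot setT (fun x => Q (T (Q x))) =
  fredholm_det dot (range Q) (fun x => Q (T (Q x))).
Proof.
move=> hT; have [_ lQ [M M0 bQ]] := lopQ.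
have [Qs [_ aQs _ bQs]] := adjoint_exists Hdot (csubspT H) M0 lQ bQ.
have aQ y z : dot (Q y) z = dot y (Qs z) by exact: aQs.
have n1 : nucl setT (fun x => Q (T (Q x))).
  by apply: (nucl_map (@subspT R H) lopQ); exact: nucl_comp_r.
have n2 : nucl (range Q) (fun x => Q (T (Q x))).
  exact: (nucl_compress (nucl_comp_r hT)).
have h1 := fredholm_det_isdet (csubspT H) n1.
have h2 := fredholm_det_isdet proj_range_csubsp n2.
apply/eqP; rewrite -subr_eq0; apply/eqP; apply: normc_small => e e0.
have e20 : 0 < e / 2 by lra.
have [d1 d10 hd1] := h1 _ e20; have [d2 d20 hd2] := h2 _ e20.
(* [k] dominates both [M] and [M * M], the factors lost by composing with [Q] on one side and on
   both sides. *)
pose k := M * (M + 1) + 1; have k0 : 0 < k by rewrite ltr_wpDl // mulr_ge0 // addr_ge0.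
pose m := Num.min d1 d2 / k; have m0 : 0 < m by rewrite divr_gt0 // lt_min d10.
have [s _ ns] := hT.2 _ m0.
have QR x : range Q (Q x) by exists x.
pose s1 := premap Qs (mapfr Q s); pose s2 := mapfr Q s.
have mk : m * k = Num.min d1 d2 by rewrite /m divfK // gt_eqF.
have km : M * (M * m) <= Num.min d1 d2.
  rewrite mulrA -mk [leRHS]mulrC ler_pM2r // /k; lra.
have km' : M * m <= Num.min d1 d2.
  rewrite -mk [leRHS]mulrC ler_pM2r // /k.
  by have := sqr_ge0 (M - 1); have := mulr_ge0 M0 M0; lra.
have frm x : fr (mapfr Q s) x = Q (fr s x) by exact: (fr_map dot (V := setT) x).
have hd1' : normc (dfr s1 - fredholm_det dot setT (fun x => Q (T (Q x)))) <= e / 2.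
  apply: hd1 => //; have n3 := nuc_map_to (@subspT R H) M0 (fun x : H => I : setT (Q x)) lQ bQ ns.
  have n4 := nuc_comp_r M0 lQ bQ n3.
  have le1 : M * (M * m) <= d1 by apply: le_trans km _; rewrite ge_min lexx.
  apply: nuc_le le1 _; apply: nuc_ext n4 => x _.
  by rewrite (fr_premap (T := Q)) // frm -(linB (@subspT R H) lQ).
have iV2 : ins (range Q) s2 by apply: (@ins_map _ _ setT) => // x _; exact: QR.
have hd2' : normc (dfr s2 - fredholm_det dot (range Q) (fun x => Q (T (Q x)))) <= e / 2.
  apply: hd2 => //; have n3 := nuc_map_to proj_range_csubsp.1 M0 QR lQ bQ ns.
  have le2 : M * m <= d2 by apply: le_trans km' _; rewrite ge_min lexx orbT.
  apply: nuc_le le2 _; apply: nuc_ext n3 => x wx.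
  by rewrite frm -(linB (@subspT R H) lQ) // (proj_range_id wx).
have e12 : dfr s1 = dfr s2.
  apply: (dfrE (V := setT) (@subspT R H)) => //.
  exists (size s2), (fun i x => dot (Q x) (tnth (in_tuple s2) i).1), (fun i => (tnth (in_tuple s2) i).2).
  split.
    split=> //.
      by move=> i a x y _ _; rewrite lQ // dotDl dotZl.
    by move=> x _; rewrite (fr_premap (T := Q)) // big_frE.
  congr (\det (_ - _)); apply/matrixP => i j; rewrite !mxE.
  have hj : range Q (tnth (in_tuple s2) j).2 by apply: iV2; rewrite mem_tnth.
  by rewrite (proj_range_id hj).
move: hd1' hd2'; rewrite e12; set a := fredholm_det _ _ _; set b := fredholm_det _ _ _ => ha hb.
have -> : a - b = (dfr s2 - b) - (dfr s2 - a) by ring.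
by apply: le_trans (normcB _ _) _; lra.
Qed.

End Compression.

End FredholmDeterminantValue.

(** * Reduction to the range of a finite-rank projection *)

Section BlockDeterminant.
Variables (R : realType) (H : completeNormedModType R[i]).
Variable dot : {dot H for conjC}.
Hypothesis Hdot : dot_induces_norm dot.
Local Notation C := R[i].
Local Notation normc := (@Normc.normc R).
Local Notation fr := (rank_one_sum dot).
Local Notation nucl := (nucl dot).
Variables (P : H -> H) (n : nat) (e : 'I_n -> H).
Hypotheses (lopP : lop setT P) (PP : forall x, P (P x) = P x) (be : is_basis (range P) e).
Implicit Types (x y z : H) (A K T : H -> H).

Let Q x := x - P x.

Lemma compl_lop : lop setT Q.
Proof.
have lid : lop setT (fun x : H => x).
  by split=> //; exists 1 => // x _; rewrite mul1r.
exact: (lopB (@subspT R H) lid lopP).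
Qed.

Lemma compl_projPQ x : P (Q x) = 0.
Proof. by have [_ lP _] := lopP; rewrite /Q (linB (@subspT R H) lP) // PP subrr. Qed.

Lemma compl_projQP x : Q (P x) = 0.
Proof. by rewrite /Q PP subrr. Qed.

Lemma compl_projQQ x : Q (Q x) = Q x.
Proof. by rewrite {1}/Q compl_projPQ subr0. Qed.

Lemma range_compl x : range Q x -> P x = 0.
Proof. by move=> [y _ <-]; exact: compl_projPQ. Qed.

(* [1 - A = (1 - Q A Q)(1 - L)] with [L = P A + K Q A P] of rank at most [2 n], where [K] is the
   inverse of [1 - Q A Q] on [range Q]. *)
Lemma block_det A K M : nucl setT A ->
  is_inv (range Q) (fun x => Q (A (Q x))) K M ->
  fredholm_det dot setT A = fredholm_det dot (range Q) (fun x => Q (A (Q x))) *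
    findim_det (range P) (fun x => x - P (A x) - P (A (K (Q (A x))))).
Proof.
move=> nA hK; have [QK lK bK KE EK] := hK.
have [_ lP [MP MP0 bP]] := lopP; have [[_ lA [MA MA0 bA]] _] := nA.
have sT := @subspT R H; have cT := @csubspT R H.
have lQ : linear_on setT Q by have [] := compl_lop.
have QR x : range Q (Q x) by exists x.
have QKE y : range Q y -> Q (K y) = K y.
  by move=> /QK [w _ <-]; exact: compl_projQQ.
pose L x := P (A x) + K (Q (A (P x))).
pose G x := Q (A (Q x)).
have PK y : range Q y -> P (K y) = 0 by move=> /QK; exact: range_compl.
(* Since [G P = 0] and [(1 - G) K = 1] on [range Q], [(1 - G) L = P A + Q A P = A - G]. *)
have AE x : A x = G x + L x - G (L x).
  have -> : G (L x) = K (Q (A (P x))) - Q (A (P x)).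
    have -> : G (L x) = G (K (Q (A (P x)))).
      by rewrite /G /L (linD lQ) // compl_projQP add0r.
    have := EK _ (QR (A (P x))); rewrite -/(G _) => h.
    by rewrite -[X in _ - X]h opprB addrC subrK.
  rewrite /G /L opprB addrACA addrK -(linD lQ) // -(linD lA) //.
  by rewrite /Q !subrK.
have [e' [We he]] := dual_basis Hdot be.
have Pe i : P (e i) = e i by apply: (@proj_range_id _ _ P PP); exact: basis_in be.
pose c i := K (Q (A (e i))).
have Pc i : P (c i) = 0 by exact: PK.
have lopA := nA.1.
have [Ps [_ aPs _ _]] := adjoint_exists Hdot cT MP0 lP bP.
have [_ lPA [MPA MPA0 bPA]] := lop_comp lopP lopA.
have [PAs [_ aPAs _ _]] := adjoint_exists Hdot cT MPA0 lPA bPA.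
pose s := [seq (PAs (e' i), e i) | i <- index_enum 'I_n] ++ [seq (Ps (e' i), c i) | i <- index_enum 'I_n].
have PE x : P x = \sum_i dot (P x) (e' i) *: e i.
  by apply: (dual_basisE be he); exists x.
have LE2 x : K (Q (A (P x))) = \sum_i dot (P x) (e' i) *: c i.
  rewrite {1}(PE x) (lin_sum sT lA) // (lin_sum sT lQ) // (lin_sum (proj_range_csubsp compl_lop compl_projQQ).1 lK).
    apply: eq_bigr => i _; rewrite (linZ sT lA) // (linZ sT lQ) //.
    by rewrite (linZ (proj_range_csubsp compl_lop compl_projQQ).1 lK).
  by move=> i _ _; exists (A (dot (P x) (e' i) *: e i)).
have sE x : fr s x = L x.
  rewrite fr_cat /rank_one_sum !big_map.
  congr (_ + _).
    rewrite [RHS](PE (A x)) -?PE /=.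
    by rewrite -[P (A x)]PP PE; apply: eq_bigr => i _; rewrite -aPAs // PP.
  by rewrite LE2; apply: eq_bigr => i _; rewrite -aPs.
pose T x := x - P (A x) - P (A (K (Q (A x)))).
pose MM : 'M[C]_n := \matrix_(i, j) dot (P (A (e j))) (e' i).
pose NN : 'M[C]_n := \matrix_(i, j) dot (P (A (c j))) (e' i).
have hL : fredholm_det dot setT L = \det (1%:M - MM - NN).
  rewrite -(fredholm_det_ext Hdot cT (nucl_fr Hdot sT (fun _ _ => I)) (fun x _ => sE x)).
  apply: (fredholm_det_fr Hdot cT) => //.
  pose h (i : 'I_(n + n)) x := match fintype.split i with
    inl i => dot (P (A x)) (e' i) | inr i => dot (P x) (e' i) end.
  pose u (i : 'I_(n + n)) := match fintype.split i with inl i => e i | inr i => c i end.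
  exists (n + n)%N, h, u; split.
    split=> //.
    - move=> i a x y _ _; rewrite /h; case: (fintype.split i) => j.
        by rewrite lA // lP // dotDl dotZl.
      by rewrite lP // dotDl dotZl.
    - move=> x _; rewrite sE big_split_ord /=; congr (_ + _).
        rewrite -[P (A x)]PP PE; apply: eq_bigr => i _.
        by rewrite /h /u (unsplitK (inl i)) PP.
      by rewrite LE2; apply: eq_bigr => i _; rewrite /h /u (unsplitK (inr i)).
  have -> : fdet h u = \det (1%:M - block_mx MM NN 1%:M 0).
    congr (\det (_ - _)); apply/matrixP => i j.
    case: (split_ordP i) => k ->; case: (split_ordP j) => l ->.
    - by rewrite block_mxEul !mxE /h /u !(unsplitK (inl _)).
    - by rewrite block_mxEur !mxE /h /u (unsplitK (inl _)) (unsplitK (inr _)).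
    - by rewrite block_mxEdl !mxE /h /u (unsplitK (inl _)) (unsplitK (inr _)) Pe he.
    - by rewrite block_mxEdr !mxE /h /u !(unsplitK (inr _)) Pc dot0l.
  (* Adding the second block column to the first clears the lower left block and halves the size of
     the determinant. *)
  have hm : (1%:M - block_mx MM NN 1%:M 0) *m block_mx 1%:M 0 1%:M 1%:M =
      block_mx (1%:M - MM - NN) (- NN) 0 1%:M.
    rewrite scalar_mx_block opp_block_mx add_block_mx mulmx_block.
    rewrite !mulmx1 !mulmx0 !add0r oppr0 addr0; congr block_mx.
    by rewrite addNr.
  have := congr1 determinant hm.
  by rewrite det_mulmx det_lblock det_ublock !det1 !mulr1.
have nG : nucl setT G by apply: (nucl_map sT compl_lop); exact: (nucl_comp_r Hdot compl_lop).
have nL : nucl setT L by apply: nucl_ext (nucl_fr Hdot sT (fun _ _ => I)) => // x _; exact: sE.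
have -> : fredholm_det dot setT A = fredholm_det dot setT G * fredholm_det dot setT L.
  rewrite -(fredholm_det_mul Hdot cT nG nL).
  by apply: (fredholm_det_ext Hdot cT nA) => x _; exact: AE.
rewrite (fredholm_det_compress Hdot compl_lop compl_projQQ nA) hL; congr (_ * _).
apply/esym; apply: (findim_det_mx (e := e)) => //.
- exact: (proj_range_csubsp lopP PP).1.
- move=> a x y _ _.
  have l1 u v : P (A (a *: u + v)) = a *: P (A u) + P (A v) by rewrite lA // lP.
  have l2 : K (Q (A (a *: x + y))) = a *: K (Q (A x)) + K (Q (A y)).
    by rewrite lA // lQ // lK.
  by rewrite l2 !l1 !scalerBr !opprD [RHS]addrACA [X in _ = X + _]addrACA.
- move=> x wx; apply: (subB (proj_range_csubsp lopP PP).1); last by exists (A (K (Q (A x)))).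
  by apply: (subB (proj_range_csubsp lopP PP).1) => //; exists (A x).
- move=> j; under eq_bigr do rewrite !mxE !scalerBl.
  rewrite !sumrB.
  have -> : \sum_i (i == j)%:R *: e i = e j.
    rewrite (bigD1 j) //= eqxx scale1r big1 ?addr0 // => k /negbTE ->.
    by rewrite scale0r.
  by congr (_ - _ - _); exact: PE.
Qed.

End BlockDeterminant.

(** * The Riesz projection *)

Section RiemannSums.
Variable R : realType.
Local Notation mu := (@lebesgue_measure R).
Implicit Types (u : R -> R) (a b t K : R).

Lemma locally_lipschitz_continuous u :
  (forall t0, exists K d : R, [/\ 0 <= K, 0 < d &
     forall t, `|t - t0| < d -> `|u t - u t0| <= K * `|t - t0|]) -> continuous u.
Proof.
move=> h t0; have [K [d [K0 d0 hK]]] := h t0.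
apply/cvgrPdist_le => e e0; near=> t.
rewrite distrC; apply: le_trans (hK t _) _.
  by rewrite distrC; near: t; exists d.
apply: (@le_trans _ _ (K * (e / (K + 1)))).
  apply: ler_wpM2l => //; rewrite ltW // distrC; near: t; exists (e / (K + 1)) => //=.
  by rewrite divr_gt0 //; lra.
rewrite mulrCA; apply: ler_piMr; first exact: ltW.
by rewrite ler_pdivrMr; lra.
Unshelve. all: end_near. Qed.

Lemma continuous_integrable_itv u (i : interval R) a b : continuous u -> [set` i] `<=` `[a, b] ->
  mu.-integrable [set` i] (EFin \o u).
Proof.
move=> cu sub; apply: (@integrableS _ _ _ mu `[a, b]%classic) => //.
apply: continuous_compact_integrable; first exact: segment_compact.
exact: continuous_subspaceT.
Qed.

Lemma Rintegral_cell u a b t K : continuous u -> a < b -> a <= t <= b -> 0 <= K ->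
  (forall s, a <= s <= b -> `|u s - u t| <= K * `|s - t|) ->
  `|(\int[mu]_(s in `]a, b]) u s) - (b - a) * u t| <= K * (b - a) ^+ 2.
Proof.
move=> cu ab /andP[at_ tb] K0 hK.
have sub : [set` `]a, b]] `<=` `[a, b].
  by move=> x /=; rewrite !in_itv /= => /andP[/ltW -> ->].
have ic v : continuous v -> mu.-integrable `]a, b] (EFin \o v).
  by move=> cv; exact: continuous_integrable_itv cv sub.
have mab : fine (mu `]a, b]) = b - a.
  by rewrite lebesgue_measure_itv /= lte_fin ab -EFinD.
have cst (k : R) : (\int[mu]_(s in `]a, b]) k) = (b - a) * k.
  by rewrite Rintegral_cst // mab mulrC.
have cc (k : R) : continuous (fun _ : R => k) by exact: cst_continuous.
rewrite -cst -RintegralB //; [|exact: ic|exact: ic].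
have cuk : continuous (fun s => u s - u t) by move=> x; apply: cvgB; [exact: cu|exact: cc].
apply: le_trans (le_normr_Rintegral _ (ic _ cuk)) _ => //.
have -> : K * (b - a) ^+ 2 = \int[mu]_(s in `]a, b]) (K * (b - a)).
  by rewrite cst; ring.
apply: le_Rintegral => //.
- by apply: ic => x; apply: cvg_norm; exact: cuk.
- exact: ic.
move=> s; rewrite /= in_itv /= => /andP[/ltW as_ sb].
apply: le_trans (hK s _) _; first by rewrite as_.
apply: ler_wpM2l => //; rewrite ler_norml; apply/andP; split; lra.
Qed.

(** The tags may lie anywhere in their cells: the sample angles below are shifted by [theta / N]. *)
Lemma riemann_sum u b K N (tau : nat -> R) : continuous u -> 0 < b -> (0 < N)%N -> 0 <= K ->
  (forall s t, 0 <= s <= b -> 0 <= t <= b -> `|u s - u t| <= K * `|s - t|) ->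
  (forall k, (k < N)%N -> b / N%:R * k%:R <= tau k <= b / N%:R * k.+1%:R) ->
  `|(\int[mu]_(s in `[0, b]) u s) - b / N%:R * \sum_(0 <= k < N) u (tau k)| <= K * b ^+ 2 / N%:R.
Proof.
move=> cu b0 N0 K0 hK htau.
have N0' : 0 < N%:R :> R by rewrite ltr0n.
pose h := b / N%:R; have h0 : 0 < h by rewrite divr_gt0.
suff main m : (m <= N)%N -> `|(\int[mu]_(s in `[0, h * m%:R]) u s) - h * \sum_(0 <= k < m) u (tau k)|
    <= K * h ^+ 2 * m%:R.
  have := main N (leqnn N).
  have -> : h * N%:R = b by rewrite /h; field; rewrite gt_eqF.
  have -> : K * h ^+ 2 * N%:R = K * b ^+ 2 / N%:R by rewrite /h; field; rewrite gt_eqF.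
  by [].
elim: m => [|m ih] mN.
  by rewrite big_nil !mulr0 set_itv1 Rintegral_set1 subrr normr0.
have hb k : (k <= N)%N -> h * k%:R <= b.
  by move=> kN; rewrite /h mulrAC ler_pdivrMr // ler_pM2l // ler_nat.
have hm0 : 0 <= h * m%:R by rewrite mulr_ge0 // ltW.
have hmm : h * m%:R < h * m.+1%:R by rewrite ltr_pM2l // ltr_nat.
have hmb := hb _ mN.
rewrite big_nat_recr //= mulrDr.
have := @Rintegral_itvB R u (BLeft 0) (BRight (h * m.+1%:R)) (h * m%:R).
have int0 : mu.-integrable [set` Interval (BLeft 0) (BRight (h * m.+1%:R))] (EFin \o u).
  exact: (continuous_integrable_itv (a := 0) (b := h * m.+1%:R) cu).
move=> /(_ int0); rewrite !bnd_simp => /(_ hm0 (ltW hmm)) /eqP.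
rewrite subr_eq => /eqP ->.
have [t1 t2] : h * m%:R <= tau m /\ tau m <= h * m.+1%:R by apply/andP; exact: htau.
have cell := @Rintegral_cell u (h * m%:R) (h * m.+1%:R) (tau m) K cu hmm.
have {cell} : `|(\int[mu]_(s in `](h * m%:R), (h * m.+1%:R)]) u s) - h * u (tau m)| <= K * h ^+ 2.
  have hd : h * m.+1%:R - h * m%:R = h by rewrite -mulrBr -natrB // subSnn mulr1.
  move: cell; rewrite hd; apply=> //; first by rewrite t1.
  by move=> s /andP[s1 s2]; apply: hK; apply/andP; split; lra.
have {}ih := ih (ltnW mN).
have -> : forall x y z w : R, x + y - (z + w) = (y - z) + (x - w) by move=> *; ring.
have -> : K * h ^+ 2 * m.+1%:R = K * h ^+ 2 * m%:R + K * h ^+ 2 by rewrite -natr1; ring.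
move=> cell.
by apply: le_trans (ler_normD _ _) _; exact: lerD.
Qed.

End RiemannSums.

Section UnitCircle.
Variable R : realType.
Local Notation C := R[i].
Local Notation normc := (@Normc.normc R).
Implicit Types (s t : R).

Definition cis t : C := cos t +i* sin t.

Lemma normc_cis t : normc (cis t) = 1.
Proof. by rewrite /= cos2Dsin2 sqrtr1. Qed.

Lemma cis_neq0 t : cis t != 0.
Proof. by rewrite -normc_eq0 normc_cis oner_eq0. Qed.

Lemma cisD s t : cis (s + t) = cis s * cis t.
Proof.
rewrite /cis sinD cosD -[RHS]/(_ +i* _); congr (_ +i* _).
by rewrite addrC.
Qed.

Lemma cis0 : cis 0 = 1. Proof. by rewrite /cis cos0 sin0. Qed.

Lemma cisM n t : cis (n%:R * t) = cis t ^+ n.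
Proof.
elim: n => [|n ih]; first by rewrite mul0r cis0.
by rewrite -natr1 mulrDl mul1r cisD ih exprSr.
Qed.

Lemma cis_2pi : cis (2 * pi) = 1.
Proof.
have -> : 2 * pi = pi *+ 2 :> R by rewrite mulr_natl.
by rewrite /cis cos2pi sin2pi. Qed.

Lemma cis_pi : cis pi = -1.
Proof. by rewrite /cis cospi sinpi; congr (_ +i* _); rewrite oppr0. Qed.

Lemma lipschitz1 (f df : R -> R) s t : (forall x : R, is_derive x (1 : R) f (df x)) ->
  (forall x, `|df x| <= 1) -> `|f s - f t| <= `|s - t|.
Proof.
move=> hd bd; wlog st : s t / s < t.
  move=> hw; have [|ts|->] := ltgtP s t; [exact: hw|by rewrite distrC (distrC s); exact: hw|].
  by rewrite !subrr.
have [|c _ hc] := @MVT R f df s t st (fun x _ => hd x).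
  apply: derivable_within_continuous => x _; exact: ex_derive.
by rewrite distrC hc normrM (distrC s) ler_piMl.
Qed.

Lemma cis_lipschitz s t : normc (cis s - cis t) <= 2 * `|s - t|.
Proof.
have bc x : `|cos x : R| <= 1.
  by rewrite ler_norml cos_geN1 cos_le1.
have bs x : `|sin x : R| <= 1.
  by rewrite ler_norml sin_geN1 sin_le1.
have h1 : `|cos s - cos t| <= `|s - t|.
  by apply: (lipschitz1 (df := fun x => - sin x)) => x; rewrite normrN.
have h2 : `|sin s - sin t| <= `|s - t|.
  exact: (lipschitz1 (df := cos)).
have -> : cis s - cis t = (cos s - cos t)%:C + 'i%C * (sin s - sin t)%:C.
  by rewrite /cis; congr (_ +i* _); rewrite /=; ring.
apply: le_trans (normcD _ _) _; rewrite normcM !normc_real.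
have -> : normc 'i%C = 1 by rewrite /= expr0n expr1n add0r sqrtr1.
lra.
Qed.

Lemma cis_neq1 t : 0 < t < 2 * pi -> cis t != 1.
Proof.
move=> /andP[t0 tp]; apply/eqP => -[c1 _].
have t2 : t = (t / 2) *+ 2 by rewrite -mulr_natr divfK.
have s0 : 0 < sin (t / 2).
  by apply: sin_gt0_pi; rewrite divr_gt0 //= ltr_pdivrMr // mulrC.
have := cos2Dsin2 (t / 2); move: c1; rewrite {1}t2 cos_mulr2n => c1.
have := mulr_gt0 s0 s0; lra.
Qed.

End UnitCircle.

Lemma Im_sum (R : realType) (I : Type) (q : seq I) (F : I -> R[i]) :
  complex.Im (\sum_(i <- q) F i) = \sum_(i <- q) complex.Im (F i).
Proof.
elim: q => [|i q ih]; first by rewrite !big_nil.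
by rewrite !big_cons -ih; case: (F i) (\sum_(j <- q) F j) => [? ?] [? ?].
Qed.

(** * Riemann sums of the resolvent integral *)

Section RieszProjection.
Variables (R : realType) (H : completeNormedModType R[i]).
Variable dot : {dot H for conjC}.
Hypothesis Hdot : dot_induces_norm dot.
Local Notation C := R[i].
Local Notation normc := (@Normc.normc R).
Local Notation mu := (@lebesgue_measure R).
Variables (T P : H -> H) (lambda : C) (r : R).
Hypotheses (lopT : lop setT T) (hr : isolating_radius T lambda r)
  (hP : is_riesz_projection dot T lambda r P).
Implicit Types (x y z : H) (s t : R).

Let sT := @subspT R H.
Let ze t : C := lambda + r%:C * cis t.
Let Rs t := resolvent T (ze t).
Let r0 : 0 < r. Proof. by case: hr. Qed.
Let lT : linear_on setT T. Proof. by case: lopT. Qed.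

(** A spectral point on the circle is at distance [r] from [lambda], so isolation would make it
    equal to [lambda], against [0 < r]. *)
Lemma resolvent_circle t : exists B : H -> H, [/\ lop setT B,
  forall x, B (T x - ze t *: x) = x & forall x, T (B x) - ze t *: B x = x].
Proof.
apply: contrapT => h; have [_ iso] := hr.
have : ze t = lambda.
  apply: iso; first by move=> [B [bB B1 B2]]; apply: h; exists B; split=> //; apply/bounded_onP.
  by rewrite normcE lecR /ze addrC addKr normcM normc_cis mulr1 normc_real gtr0_norm.
move/eqP; rewrite /ze -subr_eq0 addrC addKr mulf_eq0 (negbTE (cis_neq0 t)) orbF.
by move=> /eqP /(congr1 (@complex.Re R)) /= r00; move: r0; rewrite r00 ltxx.
Qed.

Lemma resolventP t : [/\ lop setT (Rs t), forall x, Rs t (T x - ze t *: x) = x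
  & forall x, T (Rs t x) - ze t *: Rs t x = x].
Proof.
have [B [lB B1 B2]] := resolvent_circle t.
suff -> : Rs t = B by [].
apply/funext => x; have h : T (Rs t x) - ze t *: Rs t x = x.
  by apply: (@xgetPex _ _ [set u | T u - ze t *: u = x]); exists (B x); exact: B2.
by rewrite -{2}h B1.
Qed.

Lemma ze_sub s t : normc (ze s - ze t) <= 2 * r * `|s - t|.
Proof.
have -> : ze s - ze t = r%:C * (cis s - cis t) by rewrite /ze; ring.
rewrite normcM normc_real gtr0_norm //.
have := ler_wpM2l (ltW r0) (cis_lipschitz s t); lra.
Qed.

Lemma Rs_sub s t x : Rs t x - Rs s x = (ze t - ze s) *: Rs t (Rs s x).
Proof.
have [[_ lRt _] Rt1 Rt2] := resolventP t; have [_ _ Rs2] := resolventP s.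
have h : Rs s x = Rs t x - (ze t - ze s) *: Rs t (Rs s x).
  rewrite -{1}(Rt1 (Rs s x)).
  have -> : T (Rs s x) - ze t *: Rs s x = x - (ze t - ze s) *: Rs s x.
    have -> : T (Rs s x) = x + ze s *: Rs s x by rewrite -[X in _ = X + _](Rs2 x) subrK.
    by rewrite scalerBl opprB addrA.
  by rewrite (linB sT lRt) // (linZ sT lRt).
by rewrite {1}h opprB addrC subrK.
Qed.

Lemma Rs_local t0 : exists M d : R, [/\ 0 <= M, 0 < d &
  forall t, `|t - t0| < d -> forall x, nm (Rs t x) <= M * nm x].
Proof.
have [[_ lR0 [M M0 bM]] h1 h2] := resolventP t0.
(* As [ze] is [2 r]-Lipschitz, this radius gives [|ze t - ze t0| * (M + 1) <= 1/2], and the term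
   with [Rs t x] on the right of the resolvent identity is absorbed. *)
exists (2 * (M + 1)), ((4 * r * (M + 1))^-1).
have m1 : 0 < M + 1 by lra.
have k0 : 0 < 4 * r * (M + 1) by rewrite !mulr_gt0.
split; [by rewrite mulr_ge0 // ltW|by rewrite invr_gt0|].
move=> t ht x.
have hz : normc (ze t - ze t0) * (M + 1) <= 1 / 2.
  apply: (@le_trans _ _ (2 * r * (4 * r * (M + 1))^-1 * (M + 1))).
    apply: ler_wpM2r; first exact: ltW.
    apply: le_trans (ze_sub _ _) _; apply: ler_wpM2l; last exact: ltW.
    by rewrite mulr_ge0 // ltW.
  rewrite le_eqVlt; apply/orP; left; apply/eqP; field.
  by rewrite !gt_eqF.
have e : Rs t x = Rs t0 x + (ze t - ze t0) *: Rs t0 (Rs t x).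
  have := Rs_sub t t0 x.
  move=> h; rewrite -[Rs t0 x](subrK (Rs t x)) h addrC addrA.
  by rewrite -scalerDl -[ze t0 - ze t]opprB addrN scale0r add0r.
have h3 : nm (Rs t x) <= M * nm x + normc (ze t - ze t0) * (M * nm (Rs t x)).
  rewrite {1}e; apply: le_trans (nmD _ _) _; apply: lerD; first exact: bM.
  by rewrite nmZ; apply: ler_wpM2l; [exact: normc_ge0|exact: bM].
have h4 : normc (ze t - ze t0) * (M * nm (Rs t x)) <= 1 / 2 * nm (Rs t x).
  rewrite mulrA; apply: ler_wpM2r; first exact: nm_ge0.
  apply: le_trans hz; apply: ler_wpM2l; first exact: normc_ge0.
  lra.
have := nm_ge0 x; lra.
Qed.

Lemma Rs_bound : exists2 M : R, 0 <= M &
  forall t, 0 <= t <= 2 * pi -> forall x, nm (Rs t x) <= M * nm x.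
Proof.
have /compact_near_coveringP cov := @segment_compact R 0 (2 * pi).
have h : forall t, `[0, 2 * pi]%classic t ->
    \forall t' \near t & M \near +oo, forall x, nm (Rs t' x) <= M * nm x.
  move=> t0 _; have [M [d [M0 d0 hM]]] := Rs_local t0.
  exists ([set t | `|t - t0| < d], [set M' | M <= M']); last first.
    move=> [t M'] /= [ht hM'] x; apply: le_trans (hM t ht x) _.
    by apply: ler_wpM2r => //; exact: nm_ge0.
  split; last by apply: nbhs_pinfty_ge; rewrite num_real.
  by exists d => // t /=; rewrite distrC.
have hcov : \forall M \near (pinfty_nbhs R), `[0, 2 * pi]%classic `<=` (fun t => forall x, nm (Rs t x) <= M * nm x).
  by apply: cov.
have [M [M0 hM]] : exists M : R, 0 <= M /\ forall t, `[0, 2 * pi]%classic t -> forall x, nm (Rs t x) <= M * nm x.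
  have [M hM] := @filter_ex _ (pinfty_nbhs R) _ _ (filterI hcov (nbhs_pinfty_ge (num_real (0 : R)))).
  by exists M; case: hM.
by exists M => // t ht; apply: hM; rewrite /= in_itv.
Qed.

Let g x y t : C := dot (Rs t x) y * ('i * (r%:C * cis t)).

Lemma g_lip s t (M : R) x y : 0 <= M -> (forall z, nm (Rs s z) <= M * nm z) ->
  (forall z, nm (Rs t z) <= M * nm z) ->
  normc (g x y s - g x y t) <= r * (2 * r * M ^+ 2 + 2 * M) * nm x * nm y * `|s - t|.
Proof.
move=> M0 bs bt.
have -> : g x y s - g x y t = 'i * (r%:C) * ((dot (Rs s x - Rs t x) y) * cis s + dot (Rs t x) y * (cis s - cis t)).
  by rewrite /g dotBl; ring.
rewrite !normcM normc_real gtr0_norm //.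
have -> : normc ('i : C) = 1 by rewrite /= expr0n expr1n add0r sqrtr1.
rewrite mul1r.
have h1 : normc (dot (Rs s x - Rs t x) y * cis s) <= 2 * r * `|s - t| * (M * (M * nm x)) * nm y.
  rewrite normcM normc_cis mulr1; apply: le_trans (CS Hdot _ _) _.
  apply: ler_wpM2r; first exact: nm_ge0.
  rewrite Rs_sub nmZ; apply: ler_pM; rewrite ?normc_ge0 ?nm_ge0 ?ze_sub //.
  by apply: le_trans (bs _) _; apply: ler_wpM2l.
have h2 : normc (dot (Rs t x) y * (cis s - cis t)) <= M * nm x * nm y * (2 * `|s - t|).
  rewrite normcM; apply: ler_pM; rewrite ?normc_ge0 ?cis_lipschitz //.
  by apply: le_trans (CS Hdot _ _) _; apply: ler_wpM2r; [exact: nm_ge0|exact: bt].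
have := ler_wpM2l (ltW r0) (le_trans (normcD _ _) (lerD h1 h2)).
by move/le_trans; apply; rewrite le_eqVlt; apply/orP; left; apply/eqP; ring.
Qed.

(** [p] will be the real or the imaginary part, which [circle_integral] integrates separately. *)
Lemma g_continuous (p : C -> R) x y : (forall a b, `|p a - p b| <= normc (a - b)) ->
  continuous (fun t => p (g x y t)).
Proof.
move=> hp; apply: locally_lipschitz_continuous => t0.
have [M [d [M0 d0 hM]]] := Rs_local t0.
exists (r * (2 * r * M ^+ 2 + 2 * M) * nm x * nm y), d; split=> //.
  by rewrite !mulr_ge0 ?nm_ge0 ?addr_ge0 ?mulr_ge0 ?sqr_ge0 ?(ltW r0).
move=> t ht; apply: le_trans (hp _ _) _; apply: g_lip => //; first exact: hM.
by apply: hM; rewrite subrr normr0.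
Qed.

(** The arguments of the [N]-th roots of [cis theta]. *)
Definition sample (N : nat) (theta : R) (k : nat) : R := (2 * pi * k%:R + theta) / N%:R.

(** The Riemann sum of the contour integral at these angles; the step [2 pi / N] and the factor ['i]
    of the parametrization cancel against [(2 pi i)^-1], leaving [1 / N]. *)
Definition riemann_proj N theta x : H :=
  (N%:R)^-1%:C *: \sum_(0 <= k < N) (- (r%:C * cis (sample N theta k))) *: Rs (sample N theta k) x.

Lemma sample_in N theta k : (0 < N)%N -> 0 <= theta <= 2 * pi -> (k < N)%N ->
  2 * pi / N%:R * k%:R <= sample N theta k <= 2 * pi / N%:R * k.+1%:R.
Proof.
move=> N0 /andP[t0 t1] kN; have n0 : 0 < N%:R :> R by rewrite ltr0n.
have -> : 2 * pi / N%:R * k%:R = (2 * pi * k%:R) / N%:R :> R by rewrite mulrAC.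
have -> : 2 * pi / N%:R * k.+1%:R = (2 * pi * k.+1%:R) / N%:R :> R by rewrite mulrAC.
rewrite /sample !ler_pM2r ?invr_gt0 // lerDl t0 /=.
have -> : k.+1%:R = k%:R + 1 :> R by rewrite -natr1.
by rewrite [2 * pi * (_ + 1)]mulrDr mulr1 lerD2l.
Qed.

Lemma riemann_proj_close : exists2 D : R, 0 <= D & forall N theta x, (0 < N)%N ->
  0 <= theta <= 2 * pi -> nm (riemann_proj N theta x - P x) <= D / N%:R * nm x.
Proof.
have [M M0 hM] := Rs_bound; have [_ hPf] := hP.
pose L := r * (2 * r * M ^+ 2 + 2 * M).
have L0 : 0 <= L by rewrite !mulr_ge0 ?addr_ge0 ?mulr_ge0 ?sqr_ge0 ?(ltW r0).
have p0 : 0 < pi :> R by exact: pi_gt0.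
have pp : 0 < 2 * pi :> R by apply: mulr_gt0.
have pL : 0 <= 4 * pi * L by apply: mulr_ge0 => //; apply: mulr_ge0 => //; exact: ltW.
exists (4 * pi * L) => //.
move=> N theta x N0 ht; have n0 : 0 < N%:R :> R by rewrite ltr0n.
(* The integral is given weakly. The weak estimate is uniform in [y], so taking for [y] the error
   vector itself yields an estimate in norm. *)
suff main y : normc (dot (riemann_proj N theta x - P x) y) <= 4 * pi * L / N%:R * nm x * nm y.
  set z := _ - P x; have := main z; rewrite -/z (dotxx Hdot) normc_real ger0_norm ?sqr_ge0 //.
  have [z0|zn] := eqVneq (nm z) 0.
    by rewrite z0 mulr_ge0 ?nm_ge0 // divr_ge0 ?(ltW n0).
  have zp : 0 < nm z by rewrite lt_def zn nm_ge0.
  by rewrite expr2 (ler_pM2r zp).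
pose K := L * nm x * nm y.
have K0 : 0 <= K by apply: mulr_ge0 (nm_ge0 y); exact: mulr_ge0 L0 (nm_ge0 x).
have lip s t : 0 <= s <= 2 * pi -> 0 <= t <= 2 * pi -> normc (g x y s - g x y t) <= K * `|s - t|.
  by move=> hs' ht'; apply: g_lip => //; exact: hM.
pose S : C := (2 * pi / N%:R)%:C * \sum_(0 <= k < N) g x y (sample N theta k).
pose I1 := \int[mu]_(t in `[0, 2 * pi]) complex.Re (g x y t).
pose I2 := \int[mu]_(t in `[0, 2 * pi]) complex.Im (g x y t).
have Re_lip (a b : C) : `|complex.Re a - complex.Re b| <= normc (a - b).
  by rewrite -ReB normc_ge_Re.
have Im_lip (a b : C) : `|complex.Im a - complex.Im b| <= normc (a - b).
  case: a b => a1 a2 [b1 b2]; have := normc_ge_Re (('i%C : C) * ((a1 +i* a2) - (b1 +i* b2))).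
  rewrite normcM /= expr0n expr1n add0r sqrtr1 !mul0r !mul1r sub0r normrN.
  by [].
have h1 := @riemann_sum R _ _ K N (sample N theta) (g_continuous (x := x) (y := y) Re_lip) pp N0 K0.
have {}h1 : `|I1 - complex.Re S| <= K * (2 * pi) ^+ 2 / N%:R.
  rewrite /S ReMl Re_sum; apply: h1.
  - by move=> s t hs' ht'; apply: le_trans (Re_lip _ _) _; exact: lip.
  - by move=> k kN; exact: sample_in.
have h2 := @riemann_sum R _ _ K N (sample N theta) (g_continuous (x := x) (y := y) Im_lip) pp N0 K0.
have {}h2 : `|I2 - complex.Im S| <= K * (2 * pi) ^+ 2 / N%:R.
  have -> : complex.Im S = 2 * pi / N%:R * \sum_(0 <= k < N) complex.Im (g x y (sample N theta k)).
    rewrite /S; have -> : forall (a : R) (b : C), complex.Im (a%:C * b) = a * complex.Im b.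
      by move=> a [b1 b2] /=; rewrite mul0r addr0.
    by rewrite Im_sum.
  apply: h2.
  - by move=> s t hs' ht'; apply: le_trans (Im_lip _ _) _; exact: lip.
  - by move=> k kN; exact: sample_in.
have Pxy : dot (P x) y = - (2 * pi%:C * 'i)^-1 * (I1 +i* I2) by exact: hPf.
have i2 : ('i : C) * 'i = -1 by rewrite -expr2 sqr_i.
have i0 : ('i : C) != 0 by apply/eqP => i00; move/eqP: i2; rewrite i00 mul0r eq_sym oppr_eq0 oner_eq0.
have pc : (pi%:C : C) != 0 by rewrite -normc_eq0 normc_real gtr0_norm // gt_eqF.
have nc : ((N%:R)%:C : C) != 0 by rewrite -normc_eq0 normc_real gtr0_norm // gt_eqF.
have PNxy : dot (riemann_proj N theta x) y = - (2 * pi%:C * 'i)^-1 * S.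
  rewrite /riemann_proj dotZl dot_suml /S !mulr_sumr; apply: eq_bigr => k _.
  rewrite dotZl /g; have -> : ((2 * pi / N%:R)%:C : C) = 2 * pi%:C / (N%:R)%:C.
    by rewrite !rmorphM /= fmorphV rmorph_nat.
  have -> : ((N%:R)^-1%:C : C) = (N%:R%:C)^-1 by rewrite fmorphV.
  move: (pi%:C) pc (N%:R%:C) nc => p pc q nc; field.
  by rewrite i0 pc nc.
rewrite dotBl Pxy PNxy -mulrBr normcM normcN normcV.
have -> : normc (2 * pi%:C * 'i : C) = 2 * pi.
  rewrite !normcM normc_real gtr0_norm // -(rmorph_nat (real_complex R)) normc_real normr_nat.
  by rewrite /= expr0n expr1n add0r sqrtr1 mulr1.
rewrite mulrC ler_pdivrMr //.
have hS : normc (S - (I1 +i* I2)) <= 2 * (K * (2 * pi) ^+ 2 / N%:R).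
  have -> : S - (I1 +i* I2) = (complex.Re S - I1)%:C + 'i * (complex.Im S - I2)%:C.
    by case: (S) => a b; congr (_ +i* _); rewrite /=; ring.
  apply: le_trans (normcD _ _) _; rewrite normcM !normc_real.
  have -> : normc ('i : C) = 1 by rewrite /= expr0n expr1n add0r sqrtr1.
  rewrite distrC (distrC (complex.Im S)); lra.
apply: le_trans hS _; rewrite le_eqVlt; apply/orP; left; apply/eqP; rewrite /K; field.
by rewrite gt_eqF.
Qed.

Let h0 : (0 : R) <= 0 <= 2 * @pi R.
Proof. by rewrite lexx; apply: mulr_ge0 => //; exact: pi_ge0. Qed.
Let hpi : (0 : R) <= @pi R <= 2 * @pi R.
Proof. by have := pi_ge0 R; move: (@pi R) => p p0; rewrite p0 /=; lra. Qed.
Let lP : linear_on setT P. Proof. by case: hP => -[]. Qed.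

Lemma small_all (z : H) (D : R) : 0 <= D -> (forall N, (0 < N)%N -> nm z <= D / N%:R) -> z = 0.
Proof.
move=> D0 h; apply: nm_eq0; apply/eqP; rewrite eq_le nm_ge0 andbT.
apply: ler_eps => e e0; rewrite add0r.
have := h (Num.truncn (D / e)).+1 isT => /le_trans; apply.
rewrite ler_pdivrMr ?ltr0n // mulrC -ler_pdivrMr //.
exact: ltW (truncnS_gt _).
Qed.

Lemma Rs_comm t x : Rs t (T x) = T (Rs t x).
Proof.
have [[_ lR _] h1 h2] := resolventP t.
have := h1 x; rewrite (linB sT lR) // (linZ sT lR) // => /eqP; rewrite subr_eq => /eqP ->.
by have := h2 x => /eqP; rewrite subr_eq => /eqP ->.
Qed.

(** With [X = T - lambda] and [c = r cis t], this is [(1 - X / c)^-1], as [u_eq] verifies;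
    [riemann_proj] is its average over the samples. *)
Let u t x := (- (r%:C * cis t)) *: Rs t x.

Lemma u_linear t : linear_on setT (u t).
Proof.
by have [[_ lR _] _ _] := resolventP t; move=> a x y _ _; rewrite /u lR // scalerDr !scalerA mulrC.
Qed.

Lemma riemann_proj_linear N theta : linear_on setT (riemann_proj N theta).
Proof.
move=> a x y _ _; rewrite /riemann_proj !scaler_sumr -big_split /=.
by apply: eq_bigr => k _; have := u_linear (sample N theta k) a (x := x) (y := y) I I;
  rewrite /u => ->; rewrite scalerDr; congr (_ + _); rewrite !scalerA; congr (_ *: _); ring.
Qed.

Lemma riemann_proj_comm N theta x : riemann_proj N theta (T x) = T (riemann_proj N theta x).
Proof.
rewrite /riemann_proj (linZ sT lT) // (lin_sum sT lT) //; congr (_ *: _).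
by apply: eq_bigr => k _; rewrite (linZ sT lT) // Rs_comm.
Qed.

Lemma riemann_proj_fix N theta x : (0 < N)%N -> T x = lambda *: x -> riemann_proj N theta x = x.
Proof.
move=> N0 hx; rewrite /riemann_proj.
have hu t : (- (r%:C * cis t)) *: Rs t x = x.
  have [[_ lR _] h1 _] := resolventP t.
  rewrite -(linZ sT lR) // -{2}(h1 x); congr (Rs t _).
  by rewrite hx /ze -scalerBl; congr (_ *: _); ring.
under eq_bigr do rewrite hu.
rewrite big_const_nat subn0 iter_addr_0 -[x *+ N]scaler_nat scalerA fmorphV rmorph_nat mulVf ?scale1r //.
by rewrite pnatr_eq0 -lt0n.
Qed.

Lemma riesz_fix x : T x = lambda *: x -> P x = x.
Proof.
move=> hx; have [D D0 hD] := riemann_proj_close.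
apply/eqP; rewrite eq_sym -subr_eq0; apply/eqP.
apply: (@small_all _ (D * nm x)) => [|N N0]; first by rewrite mulr_ge0 // nm_ge0.
by have := hD N 0 x N0 h0; rewrite riemann_proj_fix // mulrAC.
Qed.

Lemma riesz_comm x : P (T x) = T (P x).
Proof.
have [D D0 hD] := riemann_proj_close; have [_ _ [M M0 bT]] := lopT.
apply/eqP; rewrite -subr_eq0; apply/eqP.
apply: (@small_all _ (M * (D * nm x) + D * nm (T x))) => [|N N0].
  by rewrite addr_ge0 ?mulr_ge0 ?nm_ge0.
have -> : P (T x) - T (P x) = T (riemann_proj N 0 x - P x) - (riemann_proj N 0 (T x) - P (T x)).
  by rewrite riemann_proj_comm (linB sT lT) // opprB [RHS]addrC addrA subrK.
apply: le_trans (nmB _ _) _; rewrite mulrDl; apply: lerD.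
  apply: le_trans (bT _ I) _; rewrite -mulrA; apply: ler_wpM2l => //.
  by apply: le_trans (hD _ _ _ N0 h0) _; rewrite mulrAC.
by apply: le_trans (hD _ _ _ N0 h0) _; rewrite mulrAC.
Qed.

Let X x := T x - lambda *: x.

Lemma X_linear : linear_on setT X.
Proof.
move=> a x y _ _; rewrite /X lT // scalerBr scalerDr opprD addrACA; congr (_ - _ + _).
by rewrite !scalerA mulrC.
Qed.

Lemma iter_X_linear N : linear_on setT (iter N X).
Proof.
elim: N => [//|N ih] a x y _ _ /=.
by rewrite ih // X_linear.
Qed.

Lemma u_eq t x : u t x - (r%:C * cis t)^-1 *: X (u t x) = x.
Proof.
have [[_ lR _] _ h2] := resolventP t.
have c0 : r%:C * cis t != 0.
  by rewrite mulf_neq0 ?cis_neq0 // -normc_eq0 normc_real gtr0_norm // gt_eqF.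
rewrite /u (linZ sT X_linear) // scalerA mulrN mulVf // scaleN1r opprK.
rewrite -[in RHS](h2 x) /X /ze scalerDl opprD addrA scaleNr.
by rewrite -addrA addrC addrA.
Qed.

(** The truncated geometric series of [(1 - X / c)^-1], multiplied out so that no convergence is
    involved. *)
Lemma u_pow t x N : u t x - (r%:C * cis t) ^- N *: iter N X (u t x) =
  \sum_(0 <= j < N) (r%:C * cis t) ^- j *: iter j X x.
Proof.
elim: N => [|N ih]; first by rewrite big_nil expr0 invr1 scale1r subrr.
rewrite big_nat_recr //= -ih.
have lN := iter_X_linear N; pose c := r%:C * cis t; rewrite -/c.
have hx : iter N X x = iter N X (u t x) - c^-1 *: iter N X (X (u t x)).
  by rewrite -[in LHS](u_eq t x) -/c; move: (u t x) => v; rewrite (linB sT lN) // (linZ sT lN).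
rewrite hx -iterSr iterS; move: (X (iter N X (u t x))) => a; move: (iter N X (u t x)) => b; move: (u t x) => v.
rewrite scalerBr scalerA addrA subrK; congr (_ - _ *: _).
by rewrite exprS invfM mulrC.
Qed.

(** A full geometric sum in [q = w ^- j], with [w] the first [N]-th root of 1; [0 < j < N] ensures
    [q != 1], while [q ^+ N = 1]. *)
Lemma cis_sum N theta j : (0 < j < N)%N ->
  \sum_(0 <= k < N) cis (sample N theta k) ^- j = 0.
Proof.
move=> /andP[j0 jN]; have N0 : (0 < N)%N by exact: leq_trans jN.
have n0 : 0 < N%:R :> R by rewrite ltr0n.
have p0 : 0 < pi :> R by exact: pi_gt0.
pose w := @cis R (2 * pi / N%:R).
have sE k : cis (sample N theta k) = cis (theta / N%:R) * w ^+ k.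
  rewrite -cisM -cisD; congr cis; rewrite /sample.
  by move: (pi : R) => p; field; rewrite gt_eqF.
have wN : w ^+ N = 1.
  rewrite -cisM -cis_2pi; congr cis.
  by move: (pi : R) => p; field; rewrite gt_eqF.
have wj : w ^+ j != 1.
  rewrite -cisM; apply: cis_neq1; apply/andP; split.
    by apply: mulr_gt0; rewrite ?ltr0n //; apply: divr_gt0 => //; apply: mulr_gt0.
  rewrite mulrA ltr_pdivrMr // mulrC.
  have pp : 0 < 2 * pi :> R by apply: mulr_gt0.
  by rewrite (ltr_pM2l pp) ltr_nat.
pose q := w ^- j.
have q1 : q - 1 != 0 by rewrite subr_eq0 /q invr_eq1.
have qN : q ^+ N = 1 by rewrite /q exprVn exprAC wN expr1n invr1.
have geo : \sum_(0 <= k < N) q ^+ k = 0.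
  by apply: (mulfI q1); rewrite big_mkord -subrX1 qN subrr mulr0.
have hk k : cis (sample N theta k) ^- j = cis (theta / N%:R) ^- j * q ^+ k.
  by rewrite sE exprMn invfM (exprAC w) /q exprVn.
by under eq_bigr do rewrite hk; rewrite -mulr_sumr geo mulr0.
Qed.

(** Average [u_pow] over the samples. Their [N]-th powers all equal [cis theta], so the term with
    [iter N X] keeps a common coefficient, and [cis_sum] removes every power of [X] on the right
    except [j = 0]. Hence the average is a right inverse of [1 - X^N / (r^N cis theta)]. *)
Lemma riemann_proj_pow N theta x : (0 < N)%N ->
  riemann_proj N theta x - (r%:C ^+ N * cis theta)^-1 *: iter N X (riemann_proj N theta x) = x.
Proof.
move=> N0; have n0 : (N%:R : C) != 0 by rewrite pnatr_eq0 -lt0n.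
have nr0 : N%:R != 0 :> R by rewrite pnatr_eq0 -lt0n.
have cN k : cis (sample N theta k) ^+ N = cis theta.
  rewrite -cisM; have -> : N%:R * sample N theta k = theta + k%:R * (2 * pi).
    by rewrite /sample; move: (pi : R) => p; field.
  by rewrite cisD cisM cis_2pi expr1n mulr1.
have lX := iter_X_linear N.
rewrite /riemann_proj (linZ sT lX) // (lin_sum sT lX) //.
rewrite scalerA mulrC -scalerA -scalerBr scaler_sumr -sumrB.
have -> : \sum_(0 <= k < N) ((- (r%:C * cis (sample N theta k))) *: Rs (sample N theta k) x -
     (r%:C ^+ N * cis theta)^-1 *: iter N X ((- (r%:C * cis (sample N theta k))) *: Rs (sample N theta k) x)) =
   \sum_(0 <= k < N) \sum_(0 <= j < N) (r%:C * cis (sample N theta k)) ^- j *: iter j X x.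
  by apply: eq_bigr => k _; rewrite -u_pow exprMn cN.
rewrite exchange_big /= -[N in \sum_(0 <= j < N) _]prednK // big_nat_recl //=.
have -> : \sum_(0 <= k < N) (r%:C * cis (sample N theta k)) ^- 0 *: x = N%:R *: x.
  under eq_bigr do rewrite expr0 invr1 scale1r.
  by rewrite big_const_nat subn0 iter_addr_0 scaler_nat.
rewrite big1_seq ?addr0; last first.
  move=> j /=; rewrite mem_index_iota => /andP[_ jN].
  under eq_bigr do rewrite exprMn invfM -scalerA.
  rewrite -scaler_sumr -scaler_suml cis_sum ?scale0r ?scaler0 //.
  by move: jN; rewrite -ltnS prednK.
by rewrite scalerA fmorphV rmorph_nat mulVf // scale1r.
Qed.

Lemma riemann_proj_iter N theta m x :
  riemann_proj N theta (iter m X x) = iter m X (riemann_proj N theta x).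
Proof.
elim: m => [//|m ih] /=; rewrite -ih; move: (iter m X x) => y.
have lR := riemann_proj_linear N theta.
by rewrite /X (linB sT lR) // (linZ sT lR) // riemann_proj_comm.
Qed.

(* The averages over the [N]-th roots of [1] and of [-1] are [(1 - X^N)^-1] and [(1 + X^N)^-1]
   (for [r = 1]); their product is the average [(1 - X^2N)^-1] over the [2 N]-th roots of [1]. *)
Lemma riemann_proj_double N x : (0 < N)%N ->
  riemann_proj (N * 2) 0 x = riemann_proj N 0 (riemann_proj N pi x).
Proof.
move=> N0; have N20 : (0 < N * 2)%N by rewrite muln_gt0 N0.
pose c := (r%:C ^+ N)^-1.
have A y : riemann_proj N 0 y - c *: iter N X (riemann_proj N 0 y) = y.
  by rewrite -{3}(riemann_proj_pow 0 y N0) cis0 mulr1.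
have B y : riemann_proj N pi y + c *: iter N X (riemann_proj N pi y) = y.
  by rewrite -{3}(riemann_proj_pow pi y N0) cis_pi mulrN1 invrN scaleNr opprK.
have D y : riemann_proj (N * 2) 0 y - (c * c) *: iter N X (iter N X (riemann_proj (N * 2) 0 y)) = y.
  rewrite -{3}(riemann_proj_pow 0 y N20) cis0 mulr1 exprM expr2 invfM -iterD.
  by rewrite addnn -muln2.
have lN := iter_X_linear N.
have E y : y - (c * c) *: iter N X (iter N X y) = (y - c *: iter N X y) + c *: iter N X (y - c *: iter N X y).
  rewrite (linB sT lN) // (linZ sT lN) // scalerBr scalerA addrA subrK //.
pose v := riemann_proj (N * 2) 0 x - riemann_proj N 0 (riemann_proj N pi x).
have hv : v - (c * c) *: iter N X (iter N X v) = 0.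
  have -> : v - (c * c) *: iter N X (iter N X v) =
     (riemann_proj (N * 2) 0 x - (c * c) *: iter N X (iter N X (riemann_proj (N * 2) 0 x))) -
     (riemann_proj N 0 (riemann_proj N pi x) - (c * c) *: iter N X (iter N X (riemann_proj N 0 (riemann_proj N pi x)))).
    by rewrite /v !(linB sT lN) // scalerBr !opprD !opprK addrACA.
  by rewrite D E A B subrr.
(* [D] makes the average over [2 N] roots a right inverse of [1 - c^2 X^(2N)]. It commutes with [X],
   so it is a left inverse too, and [v], which this operator kills, is zero. *)
apply/eqP; rewrite -subr_eq0 -/v -(D v) -!riemann_proj_iter.
have lR := riemann_proj_linear (N * 2) 0.
by rewrite -(linZ sT lR) // -(linB sT lR) // hv (lin0 sT lR).
Qed.

Theorem riesz_idem x : P (P x) = P x.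
Proof.
have [D D0 hD] := riemann_proj_close; have [/bounded_onP[_ _ [M M0 bP]] _] := hP.
apply/eqP; rewrite -subr_eq0; apply/eqP.
apply: (@small_all _ (M * (D * nm x) + D * ((M + D) * nm x) + D * nm x)) => [|N N0].
  by rewrite !addr_ge0 ?mulr_ge0 ?nm_ge0 ?addr_ge0.
have N20 : (0 < N * 2)%N by rewrite muln_gt0 N0.
have n0 : 0 < N%:R :> R by rewrite ltr0n.
have n1 : 1 <= N%:R :> R by rewrite ler1n.
pose A := riemann_proj N 0; pose B := riemann_proj N pi.
(* Each of the three terms contains one error of order [1 / N], since [A (B x)] is the average over
   the [2 N] roots. *)
have -> : P (P x) - P x = - P (B x - P x) - (A (B x) - P (B x)) + (riemann_proj (N * 2) 0 x - P x).
  rewrite riemann_proj_double // -/(A (B x)) (linB sT lP) //.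
  by move: (P (P x)) (P (B x)) (A (B x)) (P x) => a b c d; rewrite !opprB !addrA !subrK.
apply: le_trans (nmD _ _) _; rewrite !mulrDl; apply: lerD; last first.
  apply: le_trans (hD _ _ _ N20 h0) _; rewrite -[leRHS]mulrAC; apply: ler_wpM2r; first exact: nm_ge0.
  apply: ler_wpM2l => //; rewrite lef_pV2 ?posrE ?ltr0n // ler_nat.
  by rewrite leq_pmulr.
apply: le_trans (nmB _ _) _; rewrite nmN; apply: lerD.
  apply: le_trans (bP _ I) _; rewrite -mulrA; apply: ler_wpM2l => //.
  by apply: le_trans (hD _ _ _ N0 hpi) _; rewrite mulrAC.
apply: le_trans (hD _ _ _ N0 h0) _; rewrite mulrAC; apply: ler_wpM2r; first by rewrite invr_ge0 ltW.
apply: ler_wpM2l => //.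
rewrite -[B x](subrK (P x)); apply: le_trans (nmD _ _) _; rewrite addrC.
apply: lerD; first exact: bP.
apply: le_trans (hD _ _ _ N0 hpi) _; apply: ler_wpM2r; first exact: nm_ge0.
by rewrite ler_pdivrMr //; apply: ler_peMr.
Qed.

End RieszProjection.

(** * Perturbed Jordan matrices *)

Section JordanMatrix.
Variable F : fieldType.
Local Notation kept_row J i := [forall j, J i j != 1].
Local Notation kept_col J j := [forall i, J i j != 1].

Lemma jordan_entry n (J : 'M[F]_n) (hJ : nilpotent_jordan_form J) i j :
  J i j != 0 -> j = i.+1 :> nat /\ J i j = 1.
Proof. by have := hJ i j; case: eqP => [ji [->|->]|_ ->] //; rewrite eqxx. Qed.

(** Striking row [i] and column [i.+1] maps the superdiagonal to the superdiagonal. The reduced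
    matrix is again in Jordan form with one entry 1 less, which allows induction on [num_ones]. *)
Lemma row_col_bump n (i j : 'I_n.+1) (a b : 'I_n) : j = i.+1 :> nat ->
  (lift j b == (lift i a).+1 :> nat) = (b == a.+1 :> nat).
Proof.
move=> ji; rewrite /= /bump ji; case: (leqP i a) => h1; case: (leqP i.+1 b) => h2; apply/eqP/eqP; lia.
Qed.

Section Reduce.
Variables (n : nat) (J M : 'M[F]_n.+1) (i j : 'I_n.+1).
Hypotheses (hJ : nilpotent_jordan_form J) (ji : j = i.+1 :> nat) (Jij : J i j = 1).
Let J' := row' i (col' j J).

Lemma jordan_row_one b : J i (lift j b) = 0.
Proof.
apply/eqP/negP => /negP /(jordan_entry hJ)[h _].
by have /eqP := neq_lift j b; apply; apply: ord_inj; rewrite h ji.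
Qed.

Lemma jordan_col_one a : J (lift i a) j = 0.
Proof.
apply/eqP/negP => /negP /(jordan_entry hJ)[h _].
by have /eqP := neq_lift i a; apply; apply: ord_inj; move: h; rewrite ji => -[].
Qed.

Lemma jordan_reduce : nilpotent_jordan_form J'.
Proof.
by move=> a b; have := hJ (lift i a) (lift j b); rewrite row_col_bump // !mxE.
Qed.

Lemma kept_row_reduce a : kept_row J' a = kept_row J (lift i a).
Proof.
apply/forallP/forallP => h b; last by rewrite !mxE.
case: (unliftP j b) => [b' ->|->]; first by have := h b'; rewrite !mxE.
by rewrite jordan_col_one eq_sym oner_eq0.
Qed.

Lemma kept_col_reduce b : kept_col J' b = kept_col J (lift j b).
Proof.
apply/forallP/forallP => h a; last by rewrite !mxE.
case: (unliftP i a) => [a' ->|->]; first by have := h a'; rewrite !mxE.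
by rewrite jordan_row_one eq_sym oner_eq0.
Qed.

(** Both sides are increasing enumerations of the same set. Equality as lists is required because
    the order determines the sign of the struck determinant. *)
Lemma filter_enum_lift (k : 'I_n.+1) (p : pred 'I_n.+1) : p k = false ->
  [seq x <- enum 'I_n.+1 | p x] = [seq lift k x | x <- [seq x <- enum 'I_n | p (lift k x)]].
Proof.
move=> pk; apply: (inj_map val_inj).
have so m : sorted (fun x y : 'I_m => (x < y)%N) (enum 'I_m).
  by have := iota_ltn_sorted 0 m; rewrite -val_enum_ord sorted_map.
have tr m : transitive (fun x y : 'I_m => (x < y)%N) by move=> y x z; exact: ltn_trans.
apply: (irr_sorted_eq ltn_trans ltnn).
- by rewrite sorted_map; apply: (sorted_filter (tr _)) (so _).
- rewrite -map_comp sorted_map; apply: (@sub_sorted _ (fun x y : 'I_n => (x < y)%N)).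
    by move=> x y /= h; rewrite /relpre /= /bump; case: leqP; case: leqP; lia.
  exact: (sorted_filter (tr _)) (so _).
- move=> v; apply/mapP/mapP => -[x].
    rewrite mem_filter => /andP[px _] ->.
    case: (unliftP k x) px => [y ->|->]; last by rewrite pk.
    move=> py; exists (lift k y) => //; apply: map_f.
    by rewrite mem_filter py mem_enum.
  move=> /mapP[y]; rewrite mem_filter => /andP[py _] -> ->.
  by exists (lift k y) => //; rewrite mem_filter py mem_enum.
Qed.

Lemma kept_rows_reduce : kept_rows J = [seq lift i a | a <- kept_rows J'].
Proof.
rewrite /kept_rows (filter_enum_lift (k := i)); last by apply/forallP => /(_ j); rewrite Jij eqxx.
by congr map; apply: eq_filter => a; rewrite kept_row_reduce.
Qed.

Lemma kept_cols_reduce : kept_cols J = [seq lift j b | b <- kept_cols J'].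
Proof.
rewrite /kept_cols (filter_enum_lift (k := j)); last by apply/forallP => /(_ i); rewrite Jij eqxx.
by congr map; apply: eq_filter => a; rewrite kept_col_reduce.
Qed.

Lemma num_onesE m (K : 'M[F]_m) : num_ones K = (\sum_a \sum_b (K a b == 1%R))%N.
Proof.
rewrite /num_ones -sum1_card pair_big_dep /= big_mkcond /=.
by apply: eq_bigr => -[a b] _; rewrite inE /=; case: eqP.
Qed.

Lemma num_ones_reduce : num_ones J = (num_ones J').+1.
Proof.
rewrite !num_onesE (bigD1_ord i) //= (bigD1_ord j) //= Jij eqxx big1 => [|b _]; last first.
  by rewrite jordan_row_one eq_sym oner_eq0.
rewrite addn0 add1n; congr S; apply: eq_bigr => a _.
rewrite (bigD1_ord j) //= jordan_col_one eq_sym oner_eq0 add0n.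
by apply: eq_bigr => b _; rewrite !mxE.
Qed.

End Reduce.

(** The value of [rescaled J M z] at [z = 0]. *)
Definition merge_rows n (J M : 'M[F]_n) : 'M[F]_n :=
  \matrix_(i, j) if kept_row J i then M i j else J i j.

Lemma num_ones_gt0 n (J : 'M[F]_n) (hJ : nilpotent_jordan_form J) :
  (0 < num_ones J)%N -> exists i j : 'I_n, j = i.+1 :> nat /\ J i j = 1.
Proof.
move=> /card_gt0P[[i j]] /=; rewrite inE /= => /eqP Jij; exists i, j; split=> //.
by have [] := @jordan_entry _ _ hJ i j _; rewrite ?Jij ?oner_neq0.
Qed.

Lemma num_ones0 n (J : 'M[F]_n) : num_ones J = 0%N -> forall i j, J i j != 1.
Proof. by move=> /card0_eq h i j; have := h (i, j); rewrite inE /= => ->. Qed.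

Lemma size_kept n (J : 'M[F]_n) (hJ : nilpotent_jordan_form J) :
  [/\ (num_ones J <= n)%N, size (kept_rows J) = (n - num_ones J)%N
    & size (kept_cols J) = (n - num_ones J)%N].
Proof.
move e : (num_ones J) => nu; elim: nu n J hJ e => [|nu ih] n J hJ e.
  have h := num_ones0 e; split=> //.
    rewrite /kept_rows (eq_in_filter (a2 := predT)) ?filter_predT ?size_enum_ord ?subn0 //.
    by move=> i _; apply/forallP.
  rewrite /kept_cols (eq_in_filter (a2 := predT)) ?filter_predT ?size_enum_ord ?subn0 //.
  by move=> i _; apply/forallP.
have [|i [j [ji Jij]]] := num_ones_gt0 hJ; first by rewrite e.
case: n J hJ e i j ji Jij => [J _ _ []//|n J hJ e i j ji Jij].
have [|h1 h2 h3] := ih _ _ (jordan_reduce hJ ji); first by apply: succn_inj; rewrite -num_ones_reduce.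
by rewrite (kept_rows_reduce hJ ji Jij) (kept_cols_reduce hJ ji Jij) !size_map h2 h3 subSS.
Qed.

(** The size of [strike J M] involves [num_ones J]; entries indexed by [nat] allow struck matrices
    of provably equal sizes to be compared without casts. *)
Definition submx_det k (G : nat -> nat -> F) := \det (\matrix_(a < k, b < k) G a b).

Lemma strikeE n (J M : 'M[F]_n) (hJ : nilpotent_jordan_form J) (x0 y0 : 'I_n) :
  \det (strike J M) = submx_det (size (kept_rows J))
    (fun a b => M (nth x0 (kept_rows J) a) (nth y0 (kept_cols J) b)).
Proof.
have [_ h1 h2] := size_kept hJ; rewrite /submx_det h1; congr (\det _); apply/matrixP => a b.
by rewrite !mxE; congr (M _ _); apply: set_nth_default; rewrite ?h1 ?h2; exact: ltn_ord.
Qed.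

Lemma strike_empty n (J M : 'M[F]_n) (hJ : nilpotent_jordan_form J) :
  size (kept_rows J) = 0%N -> \det (strike J M) = 1.
Proof.
have [_ h1 _] := size_kept hJ; rewrite h1.
by rewrite /strike; move: (n - num_ones J)%N (leq_subr _ _) => k hk k0; subst k; rewrite det_mx00.
Qed.

Lemma det_merge_rows n (J M : 'M[F]_n) (hJ : nilpotent_jordan_form J) :
  \det (merge_rows J M) = (-1) ^+ num_ones J * \det (strike J M).
Proof.
suff main nu : num_ones J = nu -> \det (merge_rows J M) = (-1) ^+ nu * \det (strike J M).
  exact: main.
move=> e; elim: nu n J M hJ e => [|nu ih] n J M hJ e.
  have h := num_ones0 e; rewrite expr0 mul1r.
  have -> : merge_rows J M = M.
    by apply/matrixP => i j; rewrite mxE (_ : kept_row J i = true) //; apply/forallP.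
  have hr : kept_rows J = enum 'I_n.
    by rewrite /kept_rows (eq_in_filter (a2 := predT)) ?filter_predT // => i _; apply/forallP.
  have hc : kept_cols J = enum 'I_n.
    by rewrite /kept_cols (eq_in_filter (a2 := predT)) ?filter_predT // => i _; apply/forallP.
  case: n J M hJ e h hr hc => [|n] J M hJ e h hr hc.
    by rewrite strike_empty ?det_mx00 // hr size_enum_ord.
  rewrite (strikeE M hJ ord0 ord0) hr hc /submx_det size_enum_ord; congr (\det _).
  by apply/matrixP => i j; rewrite mxE !nth_ord_enum.
have [|i [j [ji Jij]]] := num_ones_gt0 hJ; first by rewrite e.
case: n J M hJ e i j ji Jij => [J M _ _ []//|n J M hJ e i j ji Jij].
have hJ' := jordan_reduce hJ ji; pose J' := row' i (col' j J); pose M' := row' i (col' j M).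
have e' : num_ones J' = nu by apply: succn_inj; rewrite -num_ones_reduce.
have hi : kept_row J i = false by apply/forallP => /(_ j); rewrite Jij eqxx.
rewrite (expand_det_row _ i) (bigD1_ord j) //= big1 => [|b _]; last first.
  by rewrite mxE hi (jordan_row_one hJ ji) mul0r.
rewrite addr0 mxE hi Jij mul1r /cofactor.
have -> : row' i (col' j (merge_rows J M)) = merge_rows J' M'.
  by apply/matrixP => a b; rewrite !mxE kept_row_reduce.
(* The cofactor sign is [(-1) ^+ (i + i.+1) = -1]: one sign for each entry 1. *)
rewrite (ih _ _ M' hJ' e') ji addnS exprS -signr_odd oddD addbb expr0 mulr1 mulrA exprS.
congr (_ * _).
(* A matrix of size 1 has no superdiagonal; otherwise the reduced index type is inhabited and [ord0]
   can serve as default of [nth]. *)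
case: n J M hJ e i j ji Jij hJ' @J' @M' e' hi => [|n] J M hJ e i j ji Jij hJ' J' M' e' hi.
  by have := ltn_ord j; have := ltn_ord i; rewrite ji; case: (nat_of_ord i).
rewrite (strikeE M hJ (lift i ord0) (lift j ord0)) (strikeE M' hJ' ord0 ord0).
rewrite (kept_rows_reduce hJ ji Jij) (kept_cols_reduce hJ ji Jij) size_map /submx_det.
have [_ h1 h2] := size_kept hJ'.
congr (\det _); apply/matrixP => a b; rewrite !mxE.
rewrite (nth_map ord0); last exact: ltn_ord.
by rewrite (nth_map ord0) // h2 -h1; exact: ltn_ord.
Qed.

Lemma kept_row0 n (J : 'M[F]_n) (hJ : nilpotent_jordan_form J) i j : kept_row J i -> J i j = 0.
Proof.
move=> /forallP /(_ j) h; apply/eqP/negP => /negP /(jordan_entry hJ)[_ h1].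
by rewrite h1 eqxx in h.
Qed.

Definition rescaled n (J M : 'M[F]_n) (z : F) : 'M[F]_n :=
  \matrix_(i, j) if kept_row J i then M i j else J i j + z * M i j.

Lemma det_rescaled n (J M : 'M[F]_n) (z : F) (hJ : nilpotent_jordan_form J) :
  \det (J + z *: M) = z ^+ (n - num_ones J) * \det (rescaled J M z).
Proof.
have [_ <- _] := size_kept hJ.
have -> : J + z *: M = diag_mx (\row_i if kept_row J i then z else 1) *m rescaled J M z.
  apply/matrixP => i j; rewrite mul_diag_mx !mxE.
  by case: ifP => h; rewrite ?mul1r // (kept_row0 hJ) // add0r.
rewrite det_mulmx det_diag; congr (_ * _).
under eq_bigr do rewrite mxE.
rewrite -big_mkcond /=.
transitivity (\prod_(i <- kept_rows J) z); first by rewrite big_filter big_enum_cond.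
by elim: (kept_rows J) => [|a s ih]; rewrite ?big_nil // big_cons ih exprS.
Qed.

(** A row of [J] has at most one nonzero entry, so each equation of [J v = 0] is void or says that a
    single coordinate vanishes. *)
Lemma jordan_kernel n (J : 'M[F]_n) (hJ : nilpotent_jordan_form J) (v : 'cV[F]_n) :
  J *m v = 0 <-> forall j, ~~ kept_col J j -> v j 0 = 0.
Proof.
split=> [h j /forallPn[i /negPn/eqP Jij]|h].
  have [ji _] : j = i.+1 :> nat /\ J i j = 1 by apply: jordan_entry; rewrite // Jij oner_neq0.
  have := congr1 (fun w : 'cV_n => w i 0) h; rewrite !mxE (bigD1 j) //= Jij mul1r big1 ?addr0 //.
  move=> k kj; have [->|/(jordan_entry hJ)[ki _]] := eqVneq (J i k) 0; first by rewrite mul0r.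
  by case/eqP: kj; apply: val_inj; rewrite /= ki ji.
apply/matrixP => i k; rewrite !mxE big1 // => j _; rewrite (ord1 k).
have [->|h1] := eqVneq (J i j) 0; first by rewrite mul0r.
have [_ Jij] := jordan_entry hJ h1.
by rewrite h ?mulr0 //; apply/forallPn; exists i; rewrite Jij negbK.
Qed.

End JordanMatrix.

Section JordanExpansion.
Variable R : realType.
Local Notation C := R[i].
Local Notation normc := (@Normc.normc R).

Lemma entry_le_sum n (M : 'M[C]_n) i j : normc (M i j) <= \sum_a \sum_b normc (M a b).
Proof.
rewrite (bigD1 i) //= (bigD1 j) //= -addrA lerDl.
by apply: addr_ge0; apply: sumr_ge0 => k _; [|apply: sumr_ge0 => l _]; exact: normc_ge0.
Qed.

(* The rows of [J + z (M + E)] without an entry 1 of [J] are divisible by [z]. *)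
Lemma det_jordan_expansion n (J M : 'M[C]_n) (B : R) (hJ : nilpotent_jordan_form J) :
  0 <= B -> exists2 K : R, 0 <= K & forall z (E : 'M[C]_n), normc z <= 1 ->
  (forall i j, normc (E i j) <= B * normc z) ->
  normc (\det (J + z *: (M + E)) - (-1) ^+ num_ones J * \det (strike J M) * z ^+ (n - num_ones J))
    <= K * normc z ^+ (n - num_ones J).+1.
Proof.
move=> B0; pose m (X : 'M[C]_n) := \sum_a \sum_b normc (X a b).
have m0 X : 0 <= m X by do 2 (apply: sumr_ge0 => ? _); exact: normc_ge0.
have [K K0 hK] := det_lip n (m J + m M + B); exists (K * (m M + B)).
  by rewrite mulr_ge0 ?addr_ge0.
move=> z E z1 hE; rewrite (det_rescaled _ _ hJ) -(det_merge_rows _ hJ) [\det _ * _]mulrC -mulrBr.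
rewrite normcM normcX exprS mulrA mulrC; apply: ler_wpM2r; first by rewrite exprn_ge0 ?normc_ge0.
have z0 := normc_ge0 z.
have zB : B * normc z <= B by rewrite ler_piMr.
have hME i j : normc (M i j + E i j) <= m M + B.
  apply: le_trans (normcD _ _) _; apply: lerD; first exact: entry_le_sum.
  exact: le_trans (hE i j) zB.
rewrite -mulrA; apply: hK => [|i j|i j|i j]; first by rewrite mulr_ge0 ?addr_ge0.
- rewrite !mxE; have := hME i j; have := entry_le_sum J i j; rewrite -/(m J) => h1 h2.
  case: ifP => _; first by have := m0 J; lra.
  apply: le_trans (normcD _ _) _; rewrite normcM.
  have := normc_ge0 (M i j + E i j) => h3.
  have : normc z * normc (M i j + E i j) <= normc (M i j + E i j) by rewrite ler_piMl.
  lra.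
- rewrite !mxE; case: ifP => _.
    have := entry_le_sum M i j; rewrite -/(m M); have := m0 J; lra.
  have := entry_le_sum J i j; rewrite -/(m J); have := m0 M; lra.
- rewrite !mxE; case: ifP => _.
    rewrite addrAC subrr add0r; apply: le_trans (hE i j) _; apply: ler_wpM2r => //.
    by rewrite lerDr.
  rewrite addrAC subrr add0r normcM mulrC; exact: ler_wpM2r.
Qed.

End JordanExpansion.

(** * The expansion *)

Section Coordinates.
Variables (R : realType) (H : completeNormedModType R[i]).
Variable dot : {dot H for conjC}.
Hypothesis Hdot : dot_induces_norm dot.
Local Notation C := R[i].
Local Notation normc := (@Normc.normc R).

Lemma basis_coordinates (W : set H) n (e : 'I_n -> H) : is_basis W e ->
  exists S : H -> 'cV[C]_n, is_coordinates W S.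
Proof.
move=> be; have [f [lf fE fc]] := basis_coord be.
exists (fun x => \col_i f i x); split.
  by move=> a x y wx wy; apply/matrixP => i j; rewrite !mxE lf.
split=> //.
  move=> x y; rewrite !inE => wx wy h; rewrite (fE x wx) (fE y wy).
  by apply: eq_bigr => i _; have := congr1 (fun v : 'cV_n => v i 0) h; rewrite !mxE => ->.
move=> v _; exists (\sum_i v i 0 *: e i).
  by rewrite (basis_subsp be); exists (\row_i v i 0) => //; apply: eq_bigr => i _; rewrite mxE.
by apply/matrixP => i j; rewrite mxE fc (ord1 j).
Qed.

Variables (W : set H) (n : nat) (S : H -> 'cV[C]_n).
Hypotheses (hS : is_coordinates W S) (sW : subsp W).
Implicit Types (T U : H -> H).

Definition coord_vec j := xget 0 [set x | W x /\ S x = delta_mx j 0].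

Let lS : linear_on W S. Proof. by case: hS. Qed.

Lemma coord_vecP j : W (coord_vec j) /\ S (coord_vec j) = delta_mx j 0.
Proof.
have [_ [_ _ surj]] := hS; have [x wx hx] := surj (delta_mx j 0) I.
exact: (@xgetPex _ 0 [set x | W x /\ S x = delta_mx j 0]) (ex_intro _ x (conj wx hx)).
Qed.

Lemma coord_lin_comb (c : 'I_n -> C) : W (\sum_j c j *: coord_vec j) /\
  S (\sum_j c j *: coord_vec j) = \col_j c j.
Proof.
have We j : W (c j *: coord_vec j) by apply: (subZ sW); have [] := coord_vecP j.
split; first by apply: (sub_sum sW) => j _ _; exact: We.
rewrite (lin_sum sW lS); last by move=> j _ _; exact: We.
apply/matrixP => i k; rewrite summxE mxE (bigD1 i) //= (linZ sW lS); last by have [] := coord_vecP i.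
have [_ ->] := coord_vecP i; rewrite !mxE (ord1 k) !eqxx mulr1 big1 ?addr0 // => j ji.
rewrite (linZ sW lS); last by have [] := coord_vecP j.
by have [_ ->] := coord_vecP j; rewrite !mxE eq_sym (negbTE ji) mulr0.
Qed.

Lemma coordE x : W x -> x = \sum_j S x j 0 *: coord_vec j.
Proof.
move=> wx; have [_ [_ inj _]] := hS; have [h1 h2] := coord_lin_comb (fun j => S x j 0).
apply: inj; rewrite ?inE // h2; apply/matrixP => i k.
by rewrite mxE (ord1 k).
Qed.

Lemma coord_vec_basis : is_basis W coord_vec.
Proof.
split=> [c _|c d _ _ h|x wx]; first by have [] := coord_lin_comb (c 0).
  have [_ h1] := coord_lin_comb (c 0); have [_ h2] := coord_lin_comb (d 0).
  rewrite /lin_comb in h; rewrite h h2 in h1; apply/rowP => i.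
  by have := congr1 (fun v : 'cV_n => v i 0) h1; rewrite !mxE => ->.
exists (\row_j S x j 0) => //; rewrite /lin_comb {2}(coordE wx).
by apply: eq_bigr => j _; rewrite mxE.
Qed.

Lemma rep_mxE T i j : rep_mx W S T i j = S (T (coord_vec j)) i 0.
Proof. by rewrite mxE. Qed.

Lemma findim_det_rep T : linear_on W T -> (forall x, W x -> W (T x)) ->
  findim_det W T = \det (rep_mx W S T).
Proof.
move=> lT WT; apply: findim_det_mx coord_vec_basis _ => // j.
have [we _] := coord_vecP j; rewrite [LHS](coordE (WT _ we)).
by apply: eq_bigr => i _; rewrite rep_mxE.
Qed.

Lemma rep_mx_mul T x : linear_on W T -> (forall x, W x -> W (T x)) -> W x ->
  S (T x) = rep_mx W S T *m S x.
Proof.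
move=> lT WT wx; rewrite {1}(coordE wx).
have We j : W (S x j 0 *: coord_vec j) by apply: (subZ sW); have [] := coord_vecP j.
rewrite (lin_sum sW lT); last by move=> j _ _; exact: We.
rewrite (lin_sum sW lS); last by move=> j _ _; apply: WT; exact: We.
apply/matrixP => i k; rewrite summxE mxE; apply: eq_bigr => j _.
have [we _] := coord_vecP j.
by rewrite (linZ sW lT) // (linZ sW lS) ?mxE ?rep_mxE ?(ord1 k) 1?mulrC //; exact: WT.
Qed.

Lemma rep_mx_ext T U : (forall x, W x -> T x = U x) -> rep_mx W S T = rep_mx W S U.
Proof.
by move=> h; apply/matrixP => i j; rewrite !rep_mxE h //; have [] := coord_vecP j.
Qed.

Lemma rep_mxD T U : (forall x, W x -> W (T x)) -> (forall x, W x -> W (U x)) ->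
  rep_mx W S (fun x => T x + U x) = rep_mx W S T + rep_mx W S U.
Proof.
move=> hT hU; apply/matrixP => i j; have [we _] := coord_vecP j.
by rewrite [RHS]mxE !rep_mxE (linD lS) ?mxE //; [exact: hT|exact: hU].
Qed.

Lemma rep_mxZ a T : (forall x, W x -> W (T x)) ->
  rep_mx W S (fun x => a *: T x) = a *: rep_mx W S T.
Proof.
move=> hT; apply/matrixP => i j; have [we _] := coord_vecP j.
by rewrite [RHS]mxE !rep_mxE (linZ sW lS) ?mxE //; exact: hT.
Qed.

Lemma coord_bound : exists2 B : R, 0 <= B & forall x, W x -> forall i, normc (S x i 0) <= B * nm x.
Proof.
have [e' [We he]] := dual_basis Hdot coord_vec_basis.
exists (\sum_i nm (e' i)); first by apply: sumr_ge0 => i _; exact: nm_ge0.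
move=> x wx i; have -> : S x i 0 = dot x (e' i).
  rewrite {2}(coordE wx) dot_suml (bigD1 i) //= dotZl he eqxx mulr1 big1 ?addr0 // => j ji.
  by rewrite dotZl he eq_sym (negbTE ji) mulr0.
apply: le_trans (CS Hdot _ _) _; rewrite mulrC; apply: ler_wpM2r; first exact: nm_ge0.
by rewrite (bigD1 i) //= lerDl; apply: sumr_ge0 => j _; exact: nm_ge0.
Qed.

Lemma rep_mx_bound : exists2 B : R, 0 <= B & forall T (M : R), 0 <= M ->
  (forall x, W x -> W (T x)) -> (forall x, W x -> nm (T x) <= M * nm x) ->
  forall i j, normc (rep_mx W S T i j) <= B * M.
Proof.
have [B B0 hB] := coord_bound; exists (B * \sum_j nm (coord_vec j)).
  by rewrite mulr_ge0 // sumr_ge0 // => j _; exact: nm_ge0.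
move=> T M M0 WT bT i j; have [we _] := coord_vecP j; rewrite rep_mxE.
apply: le_trans (hB _ (WT _ we) _) _; rewrite -mulrA; apply: ler_wpM2l => //.
apply: le_trans (bT _ we) _; rewrite mulrC; apply: ler_wpM2r => //.
by rewrite (bigD1 j) //= lerDl; apply: sumr_ge0 => k _; exact: nm_ge0.
Qed.

(** By [jordan_kernel] the coordinate vectors of the columns without an entry 1 form a basis of the
    kernel; [size_kept] counts them. *)
Lemma jordan_kernel_dim T (J := rep_mx W S T) : linear_on W T -> (forall x, W x -> W (T x)) ->
  nilpotent_jordan_form J -> has_dim [set x | W x /\ T x = 0] (n - num_ones J).
Proof.
move=> lT WT hJ; have [_ _ sz] := size_kept hJ; pose s := kept_cols J.
have us : uniq s by rewrite filter_uniq // enum_uniq.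
have T0 x : W x -> T x = 0 <-> forall j, j \notin s -> S x j 0 = 0.
  move=> wx; have ST : T x = 0 <-> J *m S x = 0.
    rewrite -rep_mx_mul //; split=> [->|h]; first exact: (lin0 sW lS).
    have [_ [_ inj _]] := hS; apply: inj; rewrite ?inE ?h ?(lin0 sW lS) //.
      exact: WT.
    exact: (sub0 sW).
  rewrite ST jordan_kernel //.
  have mem j : (j \notin s) = ~~ [forall i, J i j != 1] by rewrite mem_filter mem_enum andbT.
  by split=> h j hj; apply: h; rewrite ?mem // -mem.
have sz' : size s = (n - num_ones J)%N by [].
rewrite -sz'; pose t := in_tuple s; exists (fun a => coord_vec (tnth t a)).
have comb (c : 'rV_(size s)) (v : 'I_n -> C) :
    (forall a, v (tnth t a) = c 0 a) -> (forall j, j \notin s -> v j = 0) ->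
    lin_comb (fun a => coord_vec (tnth t a)) c = \sum_j v j *: coord_vec j.
  move=> h1 h2; rewrite (bigID (mem s)) /= [X in _ + X]big1 ?addr0 => [|j js]; last first.
    by rewrite h2 ?scale0r.
  rewrite -(big_uniq _ us) /= -[s in RHS]/(tval t) big_tuple.
  by apply: eq_bigr => a _; rewrite h1.
pose ext (c : 'rV_(size s)) j : C := if insub (index j s) is Some a then c 0 a else 0.
have ext1 c a : ext c (tnth t a) = c 0 a.
  rewrite /ext (tnth_nth (tnth t a)) (index_uniq _ (ltn_ord a) us).
  by rewrite valK.
have ext2 c j : j \notin s -> ext c j = 0.
  move=> js; rewrite /ext insubF //; apply/negbTE; by rewrite -leqNgt memNindex.
have key c := comb c (ext c) (ext1 c) (ext2 c).
split=> [c _|c d _ _ h|x [wx Tx]].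
- rewrite key; have [h1 h2] := coord_lin_comb (ext c); split=> //.
  by apply/T0 => // j js; rewrite h2 mxE ext2.
- rewrite !key in h; have [_ h1] := coord_lin_comb (ext c); have [_ h2] := coord_lin_comb (ext d).
  rewrite h h2 in h1; apply/rowP => a; rewrite -!ext1.
  by have := congr1 (fun v : 'cV_n => v (tnth t a) 0) h1; rewrite !mxE => ->.
- exists (\row_a S x (tnth t a) 0) => //.
  rewrite (comb _ (fun j => S x j 0)); first exact/esym/coordE.
    by move=> a; rewrite mxE.
  by move=> j js; apply: (T0 x wx).1.
Qed.

End Coordinates.

(** * Expansion of the two block determinants for small [z] *)

Section Perturbation.
Variables (R : realType) (H : completeNormedModType R[i]).
Variable dot : {dot H for conjC}.
Hypothesis Hdot : dot_induces_norm dot.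
Local Notation C := R[i].
Local Notation normc := (@Normc.normc R).
Local Notation nucl := (nucl dot).
Local Notation nuc := (nuc dot).
Variables (A : C -> H -> H) (A0 A1 P : H -> H) (d K1 : R).
Hypotheses (nA0 : nucl setT A0) (nA1 : nucl setT A1).
Hypotheses (lopP : lop setT P) (PP : forall x, P (P x) = P x).
Hypotheses (PA0 : forall x, P (A0 x) = A0 (P x)) (Pfix : forall x, A0 x = x -> P x = x).
Hypotheses (d0 : 0 < d) (d1 : d <= 1) (K1_ge0 : 0 <= K1).
Hypothesis nA : forall z, normc z < d -> nucl setT (A z).
Hypothesis hA : forall z, normc z < d ->
  nuc setT (K1 * normc z ^+ 2) (fun x => A z x - (A0 x + z *: A1 x)).
Implicit Types (x y : H) (z : C).

Let Q x := x - P x.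
Let X z x := Q (A z (Q x)).
Let X0 x := Q (A0 (Q x)).
Let B z x := A z x - A0 x.
Let sT := @subspT R H.
Let lopQ : lop setT Q := compl_lop lopP.
Let QQ x : Q (Q x) = Q x. Proof. exact: compl_projQQ. Qed.
Let cQ : csubsp (range Q). Proof. exact: proj_range_csubsp. Qed.

Lemma nucl_compl_compress T : nucl setT T -> nucl (range Q) (fun x => Q (T (Q x))).
Proof. by move=> nT; apply: (nucl_compress lopQ QQ); exact: (nucl_comp_r Hdot lopQ). Qed.

Lemma compl_resolvent : exists M K, is_inv (range Q) X0 K M.
Proof.
have n0 := nucl_compl_compress nA0.
apply: (fredholm_alternative Hdot cQ n0.1 (nucl_opapprox Hdot n0)).
move=> x vx; have Px := range_compl lopP PP vx.
rewrite /X0 /Q Px subr0 PA0 Px; have [[_ lA0 _] _] := nA0.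
by rewrite (lin0 sT lA0) subr0 => h; rewrite -(Pfix h).
Qed.

Lemma perturbation_nuc : exists2 C1 : R, 0 <= C1 &
  forall z, normc z < d -> nuc setT (C1 * normc z) (B z).
Proof.
have [t nt] := nucl_nuc sT nA1; have t0 := nuc_ge0 nt.
exists (K1 + t); first exact: addr_ge0.
move=> z zd; have := nucD (hA zd) (nucZ z sT (fun _ _ => I) nt).
move=> h; apply: nuc_le (nuc_ext _ h); last first.
  by move=> x _; rewrite /B opprD addrA subrK.
rewrite mulrDl [t * _]mulrC lerD2r; apply: ler_wpM2l => //.
by rewrite expr2 ler_piMr ?normc_ge0 //; apply: ltW; exact: lt_le_trans d1.
Qed.

(** With [K0 = (1 - X0)^-1] and [Y = K0 Q B(z) Q], one has [1 - X z = (1 - X0)(1 - Y)] on [range Q].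
    As [Y] is nuclear of order [z], this yields both the inverse, with a bound uniform in [z], and
    the variation of the determinant. *)
Lemma perturbation_inv : exists d' C2 M : R, [/\ 0 < d', d' <= d, 0 <= C2, 0 <= M &
  forall z, normc z < d' -> exists2 K, is_inv (range Q) (X z) K M &
    normc (fredholm_det dot (range Q) (X z) - fredholm_det dot (range Q) X0) <= C2 * normc z].
Proof.
have [M0' [K0 hK0]] := compl_resolvent; have [_ _ b0 E1 E2] := hK0.
have [VK lK [M0 M00 bK]] := is_inv_lop hK0.
have [C1 C10 hC1] := perturbation_nuc; have [_ lQ [MQ MQ0 bQ]] := lopQ.
have QR x : range Q (Q x) by exists x.
pose C2 := M0 * MQ * (MQ * C1).
have C20 : 0 <= C2 by rewrite !mulr_ge0.
pose dQ := fredholm_det dot (range Q) X0.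
(* On this disc [C2 * normc z <= 1/8], the threshold of [fredholm_det_small]; it also suffices for
   [neumann]. *)
exists (Num.min d (8 * (C2 + 1))^-1), (normc dQ * (4 * C2)), (2 * M0).
have k0 : 0 < 8 * (C2 + 1) by lra.
split; rewrite ?lt_min ?d0 ?invr_gt0 ?ge_min ?lexx ?mulr_ge0 ?normc_ge0 //.
move=> z; rewrite lt_min => /andP[zd zs].
have z0 := normc_ge0 z.
have small : C2 * normc z <= 1 / 8.
  have h : normc z * (8 * (C2 + 1)) <= 1 by rewrite -ler_pdivlMr // div1r ltW.
  by have := mulr_ge0 C20 z0; lra.
pose Y x := K0 (Q (B z (Q x))).
have nB : nucl setT (B z) := nuclB sT (nA zd) nA0.
have nY : nucl (range Q) Y.
  apply: (nucl_map cQ.1 (is_inv_lop hK0)); exact: nucl_compl_compress.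
have nX0 : nucl (range Q) X0 by exact: nucl_compl_compress.
have nucY : nuc (range Q) (C2 * normc z) Y.
  have h := nuc_comp_r Hdot MQ0 lQ bQ (hC1 z zd).
  suff h2 : nuc (range Q) ((M0 * MQ) * (MQ * (C1 * normc z))) Y by move: h2; rewrite /C2 !mulrA.
  apply: (nuc_map_to (L := fun x => K0 (Q x)) cQ.1 _ _ _ _ h).
  - exact: mulr_ge0.
  - by move=> x; exact: VK.
  - by move=> a x y _ _; rewrite lQ // lK.
  - by move=> x _; apply: le_trans (bK _ (QR _)) _; rewrite -mulrA; apply: ler_wpM2l => //; exact: bQ.
have [G hG] : exists G, is_inv (range Q) Y G 2.
  have [[VY lY _] _] := nY; apply: (neumann cQ VY lY) => x vx.
  apply: le_trans (nuc_opb Hdot nucY vx) _; apply: ler_wpM2r; first exact: nm_ge0.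
  lra.
have [VG lG bG G1 G2] := hG; have [[VY lY _] _] := nY; have [[V0 l0 _] _] := nX0.
have lA0 : linear_on setT A0 by case: nA0 => -[].
have XE x : range Q x -> X z x = X0 x + Y x - X0 (Y x).
  move=> vx; have h := E2 _ (QR (B z (Q x))).
  have -> : X z x = X0 x + Q (B z (Q x)).
    by rewrite /X /X0 -(linD lQ) // /B addrC subrK.
  by rewrite -[in LHS]h addrA.
have XE' x : range Q x -> x - X z x = (x - Y x) - X0 (x - Y x).
  move=> vx; rewrite XE // (linB cQ.1 l0) //; last exact: VY.
  move: (X0 (Y x)) => b; move: (X0 x) (Y x) => a c.
  by rewrite !opprD !opprK !addrA; congr (_ + _); rewrite addrAC.
exists (fun x => G (K0 x)).
  split.
  - by move=> x vx; apply: VG; exact: VK.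
  - by move=> a x y vx vy; rewrite lK // lG //; exact: VK.
  - move=> x vx; apply: le_trans (bG _ (VK _ vx)) _; rewrite -mulrA; apply: ler_wpM2l => //.
    exact: bK.
  - move=> x vx; rewrite XE' // E1 ?G1 //.
    by apply: (subB cQ.1) => //; exact: VY.
  - move=> y vy; rewrite XE'; last by apply: VG; exact: VK.
    by rewrite G2 ?E2 //; exact: VK.
have -> : fredholm_det dot (range Q) (X z) = dQ * fredholm_det dot (range Q) Y.
  rewrite -(fredholm_det_mul Hdot cQ nX0 nY).
  by apply: (fredholm_det_ext Hdot cQ) => //; apply: nucl_compl_compress; exact: nA.
rewrite -[X in _ - X]mulr1 -mulrBr normcM -mulrA; apply: ler_wpM2l; first exact: normc_ge0.
by rewrite -mulrA; apply: (fredholm_det_small Hdot cQ nY nucY).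
Qed.

Let D0 x := A0 (P x) - P x.
Let sP : subsp (range P). Proof. by have [] := proj_range_csubsp lopP PP. Qed.
Let dQ := fredholm_det dot (range Q) (fun x => Q (A0 (Q x))).

Variables (n : nat) (S : H -> 'cV[C]_n).
Hypothesis hS : is_coordinates (range P) S.

(** Source of the factor [(-1) ^+ n]: [block_det] produces the determinant of the opposite of the
    operator in the expansion. *)
Lemma findim_detN T : linear_on (range P) T -> (forall x, range P x -> range P (T x)) ->
  findim_det (range P) (fun x => - T x) = (-1) ^+ n * findim_det (range P) T.
Proof.
move=> lT WT; have l1 : linear_on (range P) (fun x => (-1) *: T x).
  by move=> a x y wx wy; rewrite lT // scalerDr !scalerA mulrC.
have W1 x : range P x -> range P ((-1) *: T x) by move=> wx; apply: (subZ sP); exact: WT.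
have -> : (fun x => - T x) = (fun x => (-1) *: T x) by apply/funext => x; rewrite scaleN1r.
by rewrite !(findim_det_rep hS sP) // (rep_mxZ hS sP) // detZ.
Qed.

Lemma findim_det_ext T U : (forall x, range P x -> T x = U x) -> linear_on (range P) T ->
  (forall x, range P x -> range P (T x)) -> findim_det (range P) T = findim_det (range P) U.
Proof.
move=> h lT WT; rewrite !(findim_det_rep hS sP) ?(rep_mx_ext hS h) //.
  by move=> a x y wx wy; rewrite -!h //; [exact: lT|exact: sP.2].
by move=> x wx; rewrite -h //; exact: WT.
Qed.

(** On [range P] the Schur complement equals [- (D0 + z A1 + Y z)], where [Y z] gathers the
    second-order remainder of [A z] and the product of the off-diagonal blocks. *)
Lemma det_expansion : exists d' K : R, exists (f : C -> C) (E : C -> H -> H),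
  [/\ 0 < d', d' <= d, 0 <= K & forall z, normc z < d' ->
   [/\ normc (f z) <= K * normc z, lop setT (E z), opb setT (E z) (K * normc z)
    & fredholm_det dot setT (A z) = (dQ + f z) * (-1) ^+ n *
        findim_det (range P) (fun x => P (D0 (P x)) + z *: P (A1 (P x) + E z (P x)))]].
Proof.
have [d' [C2 [M [d'0 d'd C20 M0 inv]]]] :=
  perturbation_inv.
have [C1 C10 hC1] := perturbation_nuc.
have [_ lP [MP MP0 bP]] := lopP; have [_ lQ [MQ MQ0 bQ]] := lopQ.
have lA0 : linear_on setT A0 by case: nA0 => -[].
have lA1 : linear_on setT A1 by case: nA1 => -[].
have QR x : range Q (Q x) by exists x.
have PR x : range P (P x) by exists x.
have /choice[kz hk] : forall z, exists K, normc z < d' -> is_inv (range Q) (fun x => Q (A z (Q x))) K M.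
  move=> z; case: (boolP (normc z < d')) => [zd|_]; last by exists id.
  by have [K hK _] := inv z zd; exists K.
pose Y z x := P (A z x - (A0 x + z *: A1 x)) + P (A z (kz z (Q (A z (P x))))).
(* At [z = 0] the convention [0^-1 = 0] gives [E 0 = 0]; [z *: E z = Y z] still holds there because
   [Y 0 = 0]. *)
pose E z x := z^-1 *: Y z x.
pose f z := fredholm_det dot (range Q) (fun x => Q (A z (Q x))) - dQ.
(* The first term bounds the Taylor remainder of [A z]; in the second, the two factors [C1] come
   from the two off-diagonal blocks, each of order [z]. *)
pose C3 := MP * K1 + MP * (C1 * (M * (MQ * (C1 * MP)))).
have C30 : 0 <= C3 by rewrite /C3 addr_ge0 ?mulr_ge0.
have QP x : Q (P x) = 0 by rewrite /Q PP subrr.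
have lAz z : normc z < d' -> linear_on setT (A z).
  by move=> zd; have [[]] := nA (lt_le_trans zd d'd).
have bB z x : normc z < d' -> nm (A z x - A0 x) <= C1 * normc z * nm x.
  by move=> zd; have := nuc_opb Hdot (hC1 z (lt_le_trans zd d'd)); apply.
(* [P] commutes with [A0], so [Q A0 P = 0] and only the perturbation enters; [PAk] is the same for
   the other block. *)
have QAP z x : Q (A z (P x)) = Q (A z (P x) - A0 (P x)).
  by rewrite (linB sT lQ) // -PA0 QP subr0.
have PAk z y : normc z < d' -> range Q y -> P (A z (kz z y)) = P (A z (kz z y) - A0 (kz z y)).
  move=> zd vy; have [Vk _ _ _ _] := hk z zd.
  by rewrite (linB sT lP) // PA0 (range_compl lopP PP (Vk y vy)) (lin0 sT lA0) subr0.
have bY z x : normc z < d' -> nm (Y z x) <= C3 * normc z ^+ 2 * nm x.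
  move=> zd; have zd2 := lt_le_trans zd d'd; have z0 := normc_ge0 z.
  have [_ _ bk _ _] := hk z zd.
  rewrite /Y /C3 mulrDl mulrDl; apply: le_trans (nmD _ _) _; apply: lerD.
    apply: le_trans (bP _ I) _; rewrite -!mulrA; apply: ler_wpM2l => //.
    by rewrite [normc z * _]mulrA -expr2 [leRHS]mulrA; exact: (nuc_opb Hdot (hA zd2) I).
  rewrite (PAk z _ zd (QR _)) QAP.
  apply: le_trans (bP _ I) _; rewrite -!mulrA; apply: ler_wpM2l => //.
  apply: le_trans (bB _ _ zd) _; rewrite -mulrA; apply: ler_wpM2l => //.
  have h : nm (kz z (Q (A z (P x) - A0 (P x)))) <= M * (MQ * (C1 * normc z * (MP * nm x))).
    apply: le_trans (bk _ (QR _)) _; apply: ler_wpM2l => //.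
    apply: le_trans (bQ _ I) _; apply: ler_wpM2l => //.
    apply: le_trans (bB _ _ zd) _; apply: ler_wpM2l; first exact: mulr_ge0.
    exact: bP.
  apply: le_trans (ler_wpM2l z0 h) _; rewrite le_eqVlt; apply/orP; left; apply/eqP; ring.
have lY z : normc z < d' -> linear_on setT (Y z).
  move=> zd a x y _ _; have [_ lk _ _ _] := hk z zd; have lz := lAz z zd.
  rewrite /Y (lP a x y) // (lz a (P x)) // (lQ a (A z (P x))) // lk // (lz a (kz z _)) // (lP a (A z (kz z _))) //.
  have [_ lR _] : lop setT (fun x => A z x - (A0 x + z *: A1 x)).
    apply: (lopB sT (nA (lt_le_trans zd d'd)).1); apply: (lopD sT nA0.1).
    exact: (lopZ z sT nA1.1).
  by rewrite (lR a x y) // (lP a (_ - _)) // scalerDr addrACA.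
exists d', (Num.max C2 C3), f, E; split=> //; first by rewrite le_max C20.
move=> z zd; have zd2 := lt_le_trans zd d'd; have z0 := normc_ge0 z.
have bE : opb setT (E z) (C3 * normc z).
  move=> x _; rewrite nmZ normcV.
  have [->|zn] := eqVneq (normc z) 0; first by rewrite invr0 mul0r mulr0 mul0r.
  rewrite ler_pdivrMl ?lt_def ?zn //; apply: le_trans (bY _ _ zd) _.
  by rewrite le_eqVlt; apply/orP; left; apply/eqP; ring.
have lE : linear_on setT (E z).
  by move=> a x y _ _; rewrite /E lY // scalerDr !scalerA [a * _]mulrC.
have zE x : z *: E z x = Y z x.
  rewrite /E scalerA; have [z00|zn] := eqVneq z 0; last by rewrite mulfV // scale1r.
  rewrite z00 mul0r scale0r; apply/esym/nm_eq0/eqP; rewrite eq_le nm_ge0 andbT -z00.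
  by apply: le_trans (bY _ _ zd) _; rewrite z00 normc0 expr0n mulr0 mul0r.
split.
- have [K _ h] := inv z zd; apply: le_trans h _; apply: ler_wpM2r => //.
  by rewrite le_max lexx.
- by split=> //; exists (C3 * normc z) => //; exact: mulr_ge0.
- move=> x _; apply: le_trans (bE x I) _; apply: ler_wpM2r; first exact: nm_ge0.
  by apply: ler_wpM2r => //; rewrite le_max lexx orbT.
have -> : dQ + f z = fredholm_det dot (range Q) (fun x => Q (A z (Q x))) by rewrite addrC subrK.
rewrite (block_det Hdot lopP PP (coord_vec_basis hS sP) (nA zd2) (hk z zd)) -mulrA; congr (_ * _).
have lT : linear_on (range P) (fun x => P (D0 (P x)) + z *: P (A1 (P x) + E z (P x))).
  have lD : linear_on setT (fun x => P (D0 (P x)) + z *: P (A1 (P x) + E z (P x))).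
    move=> a x y _ _; rewrite lP // /D0 (lP a (P x)) // !PP (lA0 a) // lA1 // lE //.
    have -> : a *: A0 (P x) + A0 (P y) - (a *: P x + P y) = a *: (A0 (P x) - P x) + (A0 (P y) - P y).
      by rewrite scalerBr opprD addrACA.
    have -> : a *: A1 (P x) + A1 (P y) + (a *: E z (P x) + E z (P y)) =
        a *: (A1 (P x) + E z (P x)) + (A1 (P y) + E z (P y)).
      by rewrite scalerDr addrACA.
    by rewrite !lP // !scalerDr !scalerA [z * a]mulrC addrACA.
  by move=> a x y _ _; exact: lD.
have WT x : range P x -> range P (P (D0 (P x)) + z *: P (A1 (P x) + E z (P x))).
  by move=> _; apply: (subD sP) => //; apply: (subZ sP).
rewrite -findim_detN //; apply/esym/findim_det_ext.
- move=> x [w _ <-]; set u := P w; have Pu : P u = u by rewrite /u PP.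
  have hD : P (D0 u) = P (A0 u) - u by rewrite /D0 Pu (linB sT lP) // Pu.
  have PY : P (Y z u) = Y z u by rewrite /Y (linD lP) // !PP.
  have hz : z *: P (A1 u + E z u) = P (z *: A1 u) + Y z u.
    by rewrite -(linZ sT lP) // scalerDr zE (linD lP) // PY.
  have hY : Y z u = P (A z u) - (P (A0 u) + P (z *: A1 u)) + P (A z (kz z (Q (A z u)))).
    by rewrite /Y Pu (linB sT lP) // (linD lP).
  rewrite Pu hD hz hY -/(Q _); move: (P (A0 u)) (P (A z u)) (P (z *: A1 u)) => a c b.
  move: (P _) => e.
  rewrite [a + b]addrC [- (b + a)]opprD !addrA -[a - u + b + c]addrA [b + c]addrC addrA addrK.
  by rewrite [a - u]addrC -[- u + a + c]addrA [a + c]addrC addrA addrK !opprD opprK.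
- by move=> a x y wx wy; rewrite lT // scalerN opprD.
- by move=> x wx; apply: (subN sP); exact: WT.
Qed.

End Perturbation.

Section Near.
Variable R : realType.
Local Notation C := R[i].
Local Notation normc := (@Normc.normc R).

Lemma near0P (P : C -> Prop) : (\forall z \near (0 : C), P z) <->
  exists2 d : R, 0 < d & forall z, normc z < d -> P z.
Proof.
split=> [/nbhs_normP[e e0 h]|[d d0 h]].
  have ee := ge0_Re (ltW e0); exists (complex.Re e); first by rewrite -ltcR -ee.
  by move=> z hz; apply: h => /=; rewrite sub0r normrN normcE ee ltcR.
apply/nbhs_normP; exists d%:C; first by rewrite /= ltcR.
by move=> z /=; rewrite sub0r normrN normcE ltcR; exact: h.
Qed.

Lemma bigO0P (f g : C -> C) :
  (exists2 d : R, 0 < d & exists K : R, forall z, normc z < d -> normc (f z) <= K * normc (g z)) ->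
  \forall k \near +oo, \forall z \near nbhs (0 : C), `|f z| <= k * `|g z|.
Proof.
move=> [d d0 [K hK]]; exists K%:C; split; first by apply/complex_realP; exists K.
move=> k kK; apply/near0P; exists d => // z hz.
apply: le_trans (ler_wpM2r (normr_ge0 _) (ltW kK)).
by rewrite !normcE -rmorphM lecR hK.
Qed.

End Near.

Section LandauProduct.
Variable R : realType.
Local Notation C := R[i].
Local Notation normc := (@Normc.normc R).

Lemma product_expansion (X Y : C -> C) (a b : C) (k : nat) (d K L : R) : 0 < d -> 0 <= K -> 0 <= L ->
  (forall z, normc z < d -> normc (X z - a) <= K * normc z) ->
  (forall z, normc z < d -> normc (Y z - b * z ^+ k) <= L * normc z ^+ k.+1) ->
  exists2 d' : R, 0 < d' & exists M : R, forall z, normc z < d' ->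
    normc (X z * Y z - a * b * z ^+ k) <= M * normc (z ^+ k.+1).
Proof.
move=> d0 K0 L0 hX hY; exists (Num.min d 1); first by rewrite lt_min d0 ltr01.
exists ((normc a + K) * L + K * normc b) => z; rewrite lt_min => /andP[zd z1].
have z0 := normc_ge0 z; have zk : 0 <= normc z ^+ k by exact: exprn_ge0.
have -> : X z * Y z - a * b * z ^+ k = X z * (Y z - b * z ^+ k) + (X z - a) * (b * z ^+ k) by ring.
apply: le_trans (normcD _ _) _; rewrite normcX [leRHS]mulrDl; apply: lerD.
  rewrite normcM -mulrA; apply: ler_pM; rewrite ?normc_ge0 ?hY //.
  rewrite -[X z](subrK a) addrC; apply: le_trans (normcD _ _) _; rewrite lerD2l.
  by apply: le_trans (hX _ zd) _; rewrite ler_piMr // ltW.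
rewrite !normcM normcX exprS.
have := ler_wpM2r (mulr_ge0 (normc_ge0 b) zk) (hX _ zd).
by move/le_trans; apply; rewrite le_eqVlt; apply/orP; left; apply/eqP; ring.
Qed.

End LandauProduct.

Lemma dim1_colinear (R : realType) (H : completeNormedModType R[i]) (W : set H) (e : 'I_1 -> H) x w :
  is_basis W e -> W x -> x != 0 -> W w -> exists a, w = a *: x.
Proof.
move=> [_ _ surj] /surj[c _ <-] x0 /surj[b _ <-]; exists (b 0 0 / c 0 0).
move: x0; rewrite /lin_comb !big_ord1 scalerA => x0; congr (_ *: _).
rewrite divfK //; apply: contraNneq x0 => ->.
by rewrite scale0r.
Qed.

Theorem theorem2p3 (R : realType) (H : completeNormedModType R[i])
    (dot : {dot H for conjC}) (Hdot : dot_induces_norm dot) (Hsep : separable H)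
    (Omega0 : set R[i]) (Omega0_open : open Omega0) (Omega0_0 : Omega0 0)
    (A : R[i] -> H -> H) (A0 A1 P0 : H -> H) (r : R) (n0 : nat)
    (A_tc : forall z, Omega0 z -> trace_class dot setT (A z))
    (A_analytic : analytic_in_trace_norm dot Omega0 A)
    (A0_tc : trace_class dot setT A0) (A1_tc : trace_class dot setT A1)
    (A_expansion : first_order_expansion dot A A0 A1)
    (one_discrete : discrete_spectrum dot A0 1)
    (r_isolating : isolating_radius A0 1 r)
    (P0_riesz : is_riesz_projection dot A0 1 r P0)
    (P0_dim : has_dim (range P0) n0) :
  let Q0 x := x - P0 x in
  let D0 x := A0 (P0 x) - P0 x in
  let detH z := fredholm_det dot setT (A z) in
  let detQ := fredholm_det dot (range Q0) (fun x => Q0 (A0 (Q0 x))) in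
  let detP T := findim_det (range P0) T in
  let PA1P x := P0 (A1 (P0 x)) in
  let PD0P x := P0 (D0 (P0 x)) in
  let detHP := fredholm_det dot setT (fun x => P0 x + A0 x) in
  [/\ exists (f : R[i] -> R[i]) (E : R[i] -> H -> H),
        [/\ f =O_ (nbhs (0 : R[i])) (fun z => z),
            exists K : R, \forall z \near (0 : R[i]), bounded_on setT (E z) /\
              forall x, `|E z x| <= K%:C * `|z| * `|x|
          & \forall z \near (0 : R[i]),
              detH z = (detQ + f z) * (- 1) ^+ n0 *
                detP (fun x => PD0P x +
                               z *: P0 (A1 (P0 x) + E z (P0 x)))],
      forall S : H -> 'cV[R[i]]_n0, is_coordinates (range P0) S ->
        let J := rep_mx (range P0) S PD0P in
        let M1 := rep_mx (range P0) S PA1P in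
        let nu0 := num_ones J in
        nilpotent_jordan_form J ->
        detH = (fun z => detQ * \det (strike J M1) * (- z) ^+ (n0 - nu0))
          +O_ (nbhs (0 : R[i])) (fun z => z ^+ (n0 - nu0).+1)
        /\ has_dim [set x | A0 x = x] (n0 - nu0),
      (forall x, D0 x = 0) ->
        detH = (fun z => detQ * detP PA1P * (- z) ^+ n0)
          +O_ (nbhs (0 : R[i])) (fun z => z ^+ n0.+1)
        /\
        detH = (fun z => detHP * detP PA1P * z ^+ n0)
          +O_ (nbhs (0 : R[i])) (fun z => z ^+ n0.+1)
    & n0 = 1%N ->
        detH = (fun z => detHP * detP PA1P * z)
          +O_ (nbhs (0 : R[i])) (fun z => z ^+ 2)].
Proof.

move=> Q0 D0 detH detQ detP PA1P PD0P detHP.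
have sT := @subspT R H; have cT := @csubspT R H.
have nA0 := trace_class_nucl Hdot cT A0_tc; have nA1 := trace_class_nucl Hdot cT A1_tc.
have lopA0 := nA0.1; have lopA1 := nA1.1.
have /bounded_onP lopP : bounded_on setT P0 by case: P0_riesz.
have PP := riesz_idem Hdot lopA0 r_isolating P0_riesz.
have PA0 := riesz_comm Hdot lopA0 r_isolating P0_riesz.
have Pfix x : A0 x = x -> P0 x = x.
  by move=> h; apply: (riesz_fix Hdot r_isolating P0_riesz); rewrite scale1r.
have [e be] := P0_dim.
have sP : subsp (range P0) by have [] := proj_range_csubsp lopP PP.
have [_ lP [MP MP0 bP]] := lopP; have [_ lA0 _] := lopA0; have [_ lA1 _] := lopA1.
have [d [K1 [d0 d1 K10 nA hA]]] : exists d K1 : R, [/\ 0 < d, d <= 1, 0 <= K1,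
    forall z, Normc.normc z < d -> nucl dot setT (A z)
    & forall z, Normc.normc z < d ->
      nuc dot setT (K1 * Normc.normc z ^+ 2) (fun x => A z x - (A0 x + z *: A1 x))].
  have /near0P[d1 d10 h1] := open_nbhs_nbhs (conj Omega0_open Omega0_0).
  have [K /near0P[d2 d20 h2]] := A_expansion.
  exists (Num.min (Num.min d1 d2) 1), (Num.max K 0); split.
  - by rewrite !lt_min d10 d20 ltr01.
  - by rewrite ge_min lexx orbT.
  - by rewrite le_max lexx orbT.
  - move=> z; rewrite !lt_min => /andP[/andP[z1 _] _].
    by apply: (trace_class_nucl Hdot cT); apply: A_tc; exact: h1.
  - move=> z; rewrite !lt_min => /andP[/andP[z1 z2] _].
    have nz : nucl dot setT (A z) by apply: (trace_class_nucl Hdot cT); apply: A_tc; exact: h1.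
    have lopR : lop setT (fun x => A z x - (A0 x + z *: A1 x)).
      by apply: (lopB sT nz.1); apply: (lopD sT lopA0); exact: (lopZ z sT lopA1).
    have [nR _] := trace_norm_nuc Hdot cT lopR (h2 z z2).
    by apply: nuc_le nR; apply: ler_wpM2r; rewrite ?exprn_ge0 ?normc_ge0 // le_max lexx.
have expansion (S : H -> 'cV[R[i]]_n0) (hS : is_coordinates (range P0) S) :=
  det_expansion Hdot nA0 nA1 lopP PP PA0 Pfix d0 d1 K10 nA hA hS.
have PR x : range P0 (P0 x) by exists x.
have Pid x : range P0 x -> P0 x = x by move=> [y _ <-].
have lopPD : lop setT PD0P.
  have h : lop setT (fun x => P0 (P0 x)) := lop_comp lopP lopP.
  exact: (lop_comp lopP (lopB sT (lop_comp lopA0 h) h)).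
have [_ lPD _] := lopPD.
have WPD x : range P0 x -> range P0 (PD0P x) by move=> _; exact: PR.
(* For [a = (-1) ^+ (n0 - nu0)] and [b = (-1) ^+ nu0]: the sign of [det_merge_rows] cancels the part
   [b] of [(-1) ^+ n0], and [a] is left to form [(- z) ^+ (n0 - nu0)]. *)
have signs (q D a b w : R[i]) : b * b = 1 -> q * D * (a * w) = q * (a * b) * (b * D) * w.
  move=> bb; transitivity (q * D * (a * w) * (b * b)); first by rewrite bb mulr1.
  by ring.
have mulr_swap (q a D w : R[i]) : q * a * D * w = q * D * (a * w) by ring.
have part2 (S : H -> 'cV[R[i]]_n0) : is_coordinates (range P0) S ->
    let J := rep_mx (range P0) S PD0P in
    let M1 := rep_mx (range P0) S PA1P in
    let nu0 := num_ones J in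
    nilpotent_jordan_form J ->
    detH = (fun z => detQ * \det (strike J M1) * (- z) ^+ (n0 - nu0))
      +O_ (nbhs (0 : R[i])) (fun z => z ^+ (n0 - nu0).+1).
  move=> hS J M1 nu0 hJ.
  have [d' [K [f [E [d'0 d'd K0 hE]]]]] := expansion S hS.
  have [BS BS0 hBS] := rep_mx_bound Hdot hS sP.
  have B0 : 0 <= BS * (MP * (K * MP)) by rewrite !mulr_ge0.
  have [L L0 hL] := det_jordan_expansion M1 hJ B0.
  have [nuJ _ _] := size_kept hJ.
  apply/eqaddOP; apply: bigO0P.
  pose Y z := \det (J + z *: (M1 + rep_mx (range P0) S (fun x => P0 (E z (P0 x))))).
  have hX z : Normc.normc z < d' ->
      Normc.normc ((detQ + f z) * (-1) ^+ n0 - detQ * (-1) ^+ n0) <= K * Normc.normc z.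
    move=> zd; have [h _ _ _] := hE z zd.
    by rewrite -mulrBl [_ + f z]addrC addrK normcM normcX normcN1 expr1n mulr1.
  have hY z : Normc.normc z < d' ->
      Normc.normc (Y z - (-1) ^+ nu0 * \det (strike J M1) * z ^+ (n0 - nu0)) <= L * Normc.normc z ^+ (n0 - nu0).+1.
    move=> zd; have [_ lEz bEz _] := hE z zd; have z0 := normc_ge0 z.
    apply: hL; first by apply: ltW; apply: lt_le_trans zd _; exact: le_trans d'd d1.
    move=> i j; rewrite -!mulrA; apply: hBS.
    + by rewrite !mulr_ge0.
    + by move=> x _; exact: PR.
    + move=> x _; apply: le_trans (bP _ I) _; rewrite -!mulrA; apply: ler_wpM2l => //.
      apply: le_trans (bEz _ I) _; rewrite -!mulrA; apply: ler_wpM2l => //.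
      by rewrite [leRHS]mulrCA; apply: ler_wpM2l => //; exact: bP.
  have [d'' d''0 [M hM]] := product_expansion d'0 K0 L0 hX hY.
  exists (Num.min d' d''); first by rewrite lt_min d'0.
  exists M => z; rewrite lt_min => /andP[zd zd2].
  have [_ lopE _ hdet] := hE z zd.
  have -> : (detH - (fun z => detQ * \det (strike J M1) * (- z) ^+ (n0 - nu0))) z =
      (detQ + f z) * (-1) ^+ n0 * Y z -
      detQ * (-1) ^+ n0 * ((-1) ^+ nu0 * \det (strike J M1)) * z ^+ (n0 - nu0).
    have -> : Y z = detP (fun x => PD0P x + z *: P0 (A1 (P0 x) + E z (P0 x))).
      rewrite /detP (findim_det_rep hS sP); first last.
      - by move=> x _; apply: (subD sP); [exact: PR|apply: (subZ sP); exact: PR].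
      - have [_ lT _] := lopD sT lopPD (lopZ z sT (lop_comp lopP
          (lopD sT (lop_comp lopA1 lopP) (lop_comp lopE lopP)))).
        by move=> a x y _ _; exact: lT.
      rewrite (rep_mxD hS); first last.
      - by move=> x _; apply: (subZ sP); exact: PR.
      - exact: WPD.
      rewrite (rep_mxZ hS sP) => [|x _]; last exact: PR.
      rewrite /Y -(rep_mxD hS); [|by move=> x _; exact: PR|by move=> x _; exact: PR].
      congr (\det (_ + z *: _)); apply: (rep_mx_ext hS) => x _.
      by rewrite (linD lP).
    have -> : (detQ + f z) * (-1) ^+ n0 * detP (fun x => PD0P x + z *: P0 (A1 (P0 x) + E z (P0 x))) = detH z.
      exact/esym/hdet.
    congr (_ - _); rewrite [(- z) ^+ _]exprNn.
    have -> : (-1) ^+ n0 = (-1) ^+ (n0 - nu0) * (-1) ^+ nu0 :> R[i] by rewrite -exprD subnK.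
    have s1 : (-1) ^+ nu0 * (-1) ^+ nu0 = 1 :> R[i] by rewrite -expr2 sqrr_sign.
    exact: signs.
  exact: hM.
have [S0 hS0] := basis_coordinates be.
have nP : nucl dot setT P0.
  have frP : finite_rank setT P0 by split; [case: P0_riesz|exists n0].
  have [s iV hs] := finite_rank_fr Hdot cT frP.
  by apply: (nucl_ext sT _ (nucl_fr Hdot sT iV)) => x _; rewrite hs.
(* [block_det] is applied to [P0 + A0]. Its compression to [range Q0] is that of [A0], and on
   [range P0], where [A0] is the identity, [1 - P0 - A0] acts as [-1]. *)
have detHPE : (forall x, D0 x = 0) -> detHP = detQ * (-1) ^+ n0.
  move=> D00; have A0P x : range P0 x -> A0 x = x.
    by move=> wx; have := D00 x; rewrite /D0 Pid // => /eqP; rewrite subr_eq0 => /eqP.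
  have lQ : linear_on setT Q0 by have [] := compl_lop lopP.
  have [M [K0 hK0]] := compl_resolvent Hdot nA0 lopP PP PA0 Pfix.
  have QE x : Q0 (P0 (Q0 x) + A0 (Q0 x)) = Q0 (A0 (Q0 x)).
    by rewrite {2}/Q0 (linB sT lP) // PP subrr add0r.
  have nPA := nuclD sT nP nA0.
  have hK : is_inv (range Q0) (fun x => Q0 (P0 (Q0 x) + A0 (Q0 x))) K0 M.
    have -> // : (fun x => Q0 (P0 (Q0 x) + A0 (Q0 x))) = (fun x => Q0 (A0 (Q0 x))).
    by apply/funext => x; exact: QE.
  rewrite /detHP (block_det Hdot lopP PP be nPA hK); congr (_ * _).
    by apply: (congr1 (fredholm_det dot (range Q0))); apply/funext => x; exact: QE.
  have [_ lK _ _ _] := hK0.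
  have id_lin : linear_on (range P0) (fun x => x) by [].
  have id_in x : range P0 x -> range P0 x by [].
  transitivity ((-1) ^+ n0 * findim_det (range P0) (fun x => x)).
    rewrite -(findim_detN lopP PP hS0 id_lin id_in); apply/esym.
    apply: (findim_det_ext lopP PP hS0).
    - move=> x wx; rewrite (A0P x wx) (Pid x wx) (linD lP) // (Pid x wx).
      have -> : x + x - (x + x) = 0 by rewrite subrr.
      rewrite (lin0 (proj_range_csubsp (compl_lop lopP) (compl_projQQ lopP PP)).1 lK).
      by rewrite (lin0 sT lP) (lin0 sT lA0) addr0 (lin0 sT lP) subr0 opprD addrA subrr add0r.
    - by move=> a x y _ _; rewrite scalerN opprD.
    - by move=> x wx; apply: (subN sP).
  rewrite (findim_det_rep hS0 sP id_lin id_in) (_ : rep_mx _ _ _ = 1%:M) ?det1 ?mulr1 //.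
  apply/matrixP => i j; rewrite rep_mxE; have [_ ->] := coord_vecP hS0 j.
  by rewrite !mxE eqxx andbT.
have part3 : (forall x, D0 x = 0) ->
    detH = (fun z => detQ * detP PA1P * (- z) ^+ n0) +O_ (nbhs (0 : R[i])) (fun z => z ^+ n0.+1) /\
    detH = (fun z => detHP * detP PA1P * z ^+ n0) +O_ (nbhs (0 : R[i])) (fun z => z ^+ n0.+1).
  move=> D00.
  have eP z : detHP * detP PA1P * z ^+ n0 = detQ * detP PA1P * (- z) ^+ n0.
    rewrite detHPE // [(- z) ^+ n0]exprNn; exact: mulr_swap.
  suff h : detH = (fun z => detQ * detP PA1P * (- z) ^+ n0) +O_ (nbhs (0 : R[i])) (fun z => z ^+ n0.+1).
    have eF : (fun z => detHP * detP PA1P * z ^+ n0) = (fun z => detQ * detP PA1P * (- z) ^+ n0).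
      by apply/funext => z; exact: eP.
    by split; [exact: h|rewrite eF; exact: h].
  have J0 i j : rep_mx (range P0) S0 PD0P i j = 0.
    by rewrite rep_mxE /PD0P D00 (lin0 sT lP) (lin0 sP hS0.1) mxE.
  have hJ : nilpotent_jordan_form (rep_mx (range P0) S0 PD0P).
    by move=> i j; rewrite J0; case: eqP => // _; left.
  have nu0 : num_ones (rep_mx (range P0) S0 PD0P) = 0%N.
    by apply: eq_card0 => -[i j]; rewrite inE /= J0 eq_sym oner_eq0.
  have := part2 S0 hS0 hJ; rewrite /=.
  (* The two matrices have sizes [n0 - num_ones _] and [n0], equal but not convertible; for [J = 0]
     both determinants are compared with that of [merge_rows]. *)
  have -> : \det (strike (rep_mx (range P0) S0 PD0P) (rep_mx (range P0) S0 PA1P)) = detP PA1P.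
    have := det_merge_rows (rep_mx (range P0) S0 PA1P) hJ; rewrite [X in _ ^+ X]nu0 expr0 mul1r => <-.
    rewrite /detP (findim_det_rep hS0 sP); first last.
    - by move=> x _; exact: PR.
    - by have [_ l _] := lop_comp lopP (lop_comp lopA1 lopP); move=> a x y _ _; exact: l.
    congr (\det _); apply/matrixP => i j; rewrite mxE.
    by case: ifP => // /negP[]; apply/forallP => k; rewrite J0 eq_sym oner_eq0.
  by rewrite nu0 subn0.
split=> //.
- have [d' [K [f [E [d'0 d'd K0 hE]]]]] := expansion S0 hS0.
  exists f, E; split.
  + apply/eqOP/bigO0P; exists d' => //; exists K => z zd.
    by have [] := hE z zd.
  + exists K; apply/near0P; exists d' => // z zd; have [_ lopE bE _] := hE z zd.
    split; first exact/bounded_onP.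
    by move=> x; rewrite !nmE normcE -!rmorphM lecR; exact: bE.
  + by apply/near0P; exists d' => // z zd; have [_ _ _] := hE z zd.
- move=> S hS J M1 nu0 hJ; split; first exact: part2.
  (* Fixed vectors of [A0] lie in [range P0], on which [PD0P] is [A0 - 1]; the geometric
     multiplicity is therefore the nullity of [J]. *)
  have -> : [set x | A0 x = x] = [set x | range P0 x /\ PD0P x = 0].
    apply/seteqP; split=> x /= => [hx|[wx]].
      by rewrite /PD0P /D0 !(Pfix x hx) hx subrr (lin0 sT lP); split=> //; exists x => //; exact: Pfix.
    rewrite /PD0P /D0 !(Pid x wx) (linB sT lP) // PA0 !(Pid x wx) => /eqP.
    by rewrite subr_eq0 => /eqP.
  by apply: (jordan_kernel_dim hS sP) => //; move=> a x y _ _; exact: lPD.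
- move=> n1; have [[x x0 hx] _] := one_discrete.
  rewrite scale1r in hx.
  (* For [n0 = 1] semisimplicity is a consequence: the eigenvector [x] spans [range P0], and [A0]
     fixes it. *)
  have D00 y : D0 y = 0.
    move: P0_dim; rewrite n1 => -[e1 be1].
    have wx : range P0 x by rewrite -(Pfix x hx).
    rewrite /D0; have [a ->] := dim1_colinear be1 wx x0 (PR y).
    by rewrite (linZ sT lA0) // hx subrr.
  have [_] := part3 D00.
  by rewrite n1.
Qed.
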